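(* Let $Z$ be an oriented $n$-dimensional simple cell pseudo-manifold, and let $\Sigma\subset Z$ be the codimension-$2$ skeleton of $Z$. Then one can construct explicitly a cubic cell combinatorial manifold $M$ and a piecewise-smooth mapping $g:M\to Z$ such that 1) the restriction of $g$ to $g^{-1}(Z\setminus\Sigma)$ is a finite-fold covering $g^{-1}(Z\setminus\Sigma)\to Z\setminus\Sigma$; 2) $\dim g^{-1}(\Sigma)=n-1$.
   Context: All complexes are finite. A combinatorial sphere is a simplicial complex piecewise-linearly homeomorphic to the boundary of a simplex. A prime denotes barycentric subdivision. If $Y$ is an $(n-1)$-dimensional combinatorial sphere, for a vertex $y$ put $Dy=\mathrm{star}_{Y'}y$ (the union of all closed simplices of $Y'$ containing $y$) and for a simplex $\sigma$ put $D\sigma=\bigcap_{y\in\sigma}Dy$, the intersection over the vertices $y$ of $\sigma$; the $n$-dimensional simple cell dual to $Y$ is the simplicial complex $\mathrm{cone}(Y')$ together with its decomposition into faces $D\sigma$ ($\sigma$ a simplex of $Y$) and $D\emptyset=\mathrm{cone}(Y')$. Each face is again a simple cell. An isomorphism of simple cells is a simplicial isomorphism of the cones preserving the decompositions into faces. A simple cell complex is the quotient of a disjoint union of finitely many simple cells $P_1,\dots,P_q$ by an equivalence relation $\sim$ such that (1) $\sim$ identifies no two distinct points of the same $P_i$; (2) if $x_1\in P_i$ is identified with $x_2\in P_j$, then some face $F_1\ni x_1$ of $P_i$ is identified with some face $F_2\ni x_2$ of $P_j$ along an isomorphism. Its cells are the images of faces of the $P_i$. It is an $n$-dimensional simple cell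 pseudo-manifold if each cell lies in an $n$-dimensional cell and each $(n-1)$-dimensional cell lies in exactly two $n$-dimensional cells; pseudo-manifolds are always assumed normal, i.e. the $n$-th local homology group at every point is isomorphic to $\mathbb Z$. The codimension-$2$ skeleton is the union of the cells of dimension at most $n-2$. A cubic cell complex is the quotient of a disjoint union of finitely many closed cubes by an equivalence relation satisfying conditions (1),(2) above with cubes in place of simple cells and linear homeomorphisms of faces in place of isomorphisms. The link of a vertex $x$ is the simplicial cell complex formed by the convex hulls, in the cells $\tau\ni x$, $\tau\neq x$, of the midpoints of the edges of $\tau$ at $x$. An $m$-dimensional cubic cell combinatorial manifold is a cubic cell complex all of whose vertex links are piecewise-linearly homeomorphic to the boundary of an $m$-simplex.
   Formalization: Clause 2), dim g^{-1}(Σ) = n−1, is asserted only when Σ is nonempty (equivalently n ≥ 2 and Z nonempty); for n = 1 the skeleton Σ is empty, so the stated equality would fail. *)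

(* Defs.v *)
From HB Require Import structures.
From mathcomp Require Import all_boot all_order all_algebra generic_quotient.

Set Implicit Arguments.
Unset Strict Implicit.
Unset Printing Implicit Defensive.

(** * Simplicial complexes *)

(* This comes before the import of the classical sets, so that [set0],
   [\bigcap], etc. are about finite sets here. *)

(* The elements of [K] are the nonempty simplices; [v] is a vertex of [K] when
   [[set v]] belongs to [K]. *)
Definition is_complex (V : finType) (K : {set {set V}}) :=
  set0 \notin K /\
  forall s t : {set V}, s \in K -> t \subset s -> t != set0 -> t \in K.

(* Dimension plus one, so that the empty complex gets 0. *)
Definition succ_dim (V : finType) (K : {set {set V}}) : nat :=
  \max_(s in K) #|s|.

Definition bd_simplex (m : nat) : {set {set 'I_m.+1}} :=
  [set s : {set 'I_m.+1} | (s != set0) && (s != [set: 'I_m.+1])].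

Definition bary (V : finType) (K : {set {set V}}) : {set {set {set V}}} :=
  [set c : {set {set V}} | [&& c != set0, c \subset K &
     [forall s in c, forall t in c, (s \subset t) || (t \subset s)]]].

(* The vertex [None] is the apex. *)
Definition cone (V : finType) (K : {set {set V}}) : {set {set option V}} :=
  [set c : {set option V} | (c != set0) &&
     ([set v | Some v \in c] \in set0 |: K)].

Definition star (V : finType) (K : {set {set V}}) (v : V) : {set {set V}} :=
  [set c in K | [exists s in K, (v \in s) && (c \subset s)]].

(* The face D s of the cell dual to [Y], as a subcomplex of [cone (bary Y)].
   The vertex y of [Y] is the vertex [[set y]] of [bary Y]. *)
Definition dual_face (V : finType) (Y : {set {set V}}) (s : {set V}) :
    {set {set option {set V}}} :=
  if s == set0 then cone (bary Y)
  else [set Some @: (c : {set {set V}}) |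
          c in \bigcap_(y in s) star (bary Y) [set y]].

Definition dual_faces (V : finType) (Y : {set {set V}}) :
    {set {set {set option {set V}}}} :=
  [set dual_face Y s | s in set0 |: Y].

Definition map_complex (V W : finType) (h : V -> W) (K : {set {set V}}) :
    {set {set W}} :=
  [set h @: (c : {set V}) | c in K].

Definition simplicial_iso (V W : finType) (K : {set {set V}})
    (L : {set {set W}}) (h : V -> W) :=
  {in cover K &, injective h} /\ map_complex h K = L.

(* [F] and [G] are faces of the cells dual to [X] and [Y].  A face is itself a
   simple cell, and its faces are the faces of the ambient cell it contains. *)
Definition simple_cell_iso (V W : finType) (X : {set {set V}})
    (Y : {set {set W}}) (F : {set {set option {set V}}})
    (G : {set {set option {set W}}})
    (h : option {set V} -> option {set W}) :=
  simplicial_iso F G h /\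
  [set map_complex h H | H in [set H in dual_faces X | H \subset F]]
    = [set H in dual_faces Y | H \subset G].

From mathcomp Require Import all_classical all_reals all_analysis.

Import Order.TTheory GRing.Theory Num.Theory.
Import numFieldNormedType.Exports.
Local Open Scope classical_set_scope.
Local Open Scope quotient_scope.
Local Open Scope ring_scope.

(** * Polytopes, piecewise linear maps, smooth maps *)

(* The hull of the empty sequence is empty. *)
Definition hull (R : realType) n (s : seq 'rV[R]_n) : set 'rV[R]_n :=
  [set x | exists l : 'I_(size s) -> R,
     [/\ forall i, 0 <= l i, \sum_i l i = 1 & x = \sum_i l i *: s`_i]].

Definition polytope_cover (R : realType) n (A : set 'rV[R]_n)
    (S : seq (seq 'rV[R]_n)) :=
  A = [set x | exists2 s, s \in S & hull s x].

Definition affine_on (R : realType) n m (A : set 'rV[R]_n)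
    (f : 'rV[R]_n -> 'rV[R]_m) :=
  forall x y (t : R), A x -> A y -> 0 <= t <= 1 ->
    f (t *: x + (1 - t) *: y) = t *: f x + (1 - t) *: f y.

(* Continuity on [A] is automatic: the pieces are closed and finitely many. *)
Definition pl_on (R : realType) n m (A : set 'rV[R]_n)
    (f : 'rV[R]_n -> 'rV[R]_m) :=
  exists S, polytope_cover A S /\ forall s, s \in S -> affine_on (hull s) f.

(* The inverse of a piecewise linear bijection is piecewise linear. *)
Definition pl_homeo (R : realType) n m (A : set 'rV[R]_n)
    (B : set 'rV[R]_m) :=
  exists f : 'rV[R]_n -> 'rV[R]_m, pl_on A f /\ set_bij A B f.

Fixpoint cont_diff (R : realType) n (k : nat) (f : 'rV[R]_n -> R) : Prop :=
  if k is k'.+1 then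
    continuous f /\
    forall j : 'I_n, (forall x, derivable f x (delta_mx 0 j)) /\
      cont_diff k' (fun x => 'D_(delta_mx 0 j) f x)
  else continuous f.

Definition smooth (R : realType) n m (f : 'rV[R]_n -> 'rV[R]_m) :=
  forall (j : 'I_m) k, cont_diff k (fun x => f x 0 j).

(** * Geometric realization *)

Definition vtx (R : realType) (V : finType) (v : V) : 'rV[R]_#|V| :=
  delta_mx 0 (enum_rank v).

Definition realization (R : realType) (V : finType) (K : {set {set V}}) :
    set 'rV[R]_#|V| :=
  [set x | exists2 s, s \in K & hull [seq vtx R v | v <- enum s] x].
Arguments realization R {V} K.

Definition realize_map (R : realType) (V W : finType) (h : V -> W)
    (x : 'rV[R]_#|V|) : 'rV[R]_#|W| :=
  \sum_(v : V) x 0 (enum_rank v) *: vtx R (h v).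

(* The dimension of the sphere is n - 1; for n = 0 it is the empty complex. *)
Definition combinatorial_sphere (R : realType) (V : finType)
    (Y : {set {set V}}) (n : nat) :=
  is_complex Y /\ pl_homeo (realization R Y) (realization R (bd_simplex n)).

(** * Cell complexes *)

(* What a cell complex is built from: the shapes of the cells, their bodies in
   Euclidean spaces, their faces sorted by dimension, and the maps along which
   a face of one cell may be identified with a face of another one (of which
   only the values on the first face matter). *)
Record cell_kind (R : realType) := CellKind {
  shape : Type;
  ambient : shape -> nat;
  body : forall P : shape, set 'rV[R]_(ambient P);
  is_face : forall P : shape, nat -> set 'rV[R]_(ambient P) -> Prop;
  face_iso : forall P Q : shape, set 'rV[R]_(ambient P) ->
    set 'rV[R]_(ambient Q) -> ('rV[R]_(ambient P) -> 'rV[R]_(ambient Q)) ->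
    Prop
}.
Arguments body {R c} P.

Definition points (R : realType) (K : cell_kind R) (P : shape K) :
    topologicalType :=
  set_type (body P).

Definition disjoint_cells (R : realType) (K : cell_kind R) q
    (P : 'I_q -> shape K) : topologicalType :=
  {i : 'I_q & points (P i)}.

Record cell_complex (R : realType) (K : cell_kind R) := CellComplex {
  ncells : nat;
  cells : 'I_ncells -> shape K;
  glued : rel (disjoint_cells cells);
  glued_refl : reflexive glued;
  glued_sym : symmetric glued;
  glued_trans : transitive glued;
  glued_inj : forall i (x y : points (cells i)),
    glued (existT _ i x) (existT _ i y) -> x = y;
  glued_faces : forall i j (x : points (cells i)) (y : points (cells j)),
    glued (existT _ i x) (existT _ j y) ->
    exists d e F G phi,
      [/\ is_face d F /\ F (val x), is_face e G /\ G (val y),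
          face_iso F G phi &
          forall (p : points (cells i)) (p' : points (cells j)),
            F (val p) -> val p' = phi (val p) ->
            glued (existT _ i p) (existT _ j p')]
}.

Section CellComplexes.
Variables (R : realType) (K : cell_kind R) (Z : cell_complex K).

Definition glued_equiv : equiv_rel (disjoint_cells (@cells R K Z)) :=
  EquivRel (@glued R K Z) (@glued_refl R K Z) (@glued_sym R K Z)
    (@glued_trans R K Z).

Definition total_space : topologicalType :=
  quotient_topology {eq_quot glued_equiv}.

Definition chart (i : 'I_(ncells Z)) (x : points (cells i)) : total_space :=
  \pi_({eq_quot glued_equiv}) (existT _ i x).

Definition is_cell (d : nat) (c : set total_space) :=
  exists (i : 'I_(ncells Z)) (F : set 'rV[R]_(ambient (cells i))),
    is_face d F /\
    c = [set z | exists2 x : points (cells i), F (val x) & z = chart x].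

(* The union of the cells of dimension at most n - 2. *)
Definition codim2_skeleton (n : nat) : set total_space :=
  [set z | exists d c, [/\ (d.+2 <= n)%N, is_cell d c & c z]].

End CellComplexes.
Arguments codim2_skeleton {R K} Z n.

(** * Simple cell complexes *)

Record simple_cell (R : realType) := SimpleCell {
  simple_dim : nat;
  simple_vertices : finType;
  simple_base : {set {set simple_vertices}};
  _ : combinatorial_sphere R simple_base simple_dim
}.

Definition simple_face (R : realType) (P : simple_cell R) (d : nat)
    (F : set 'rV[R]_#|{: option {set simple_vertices P}}|) :=
  exists D : {set {set option {set simple_vertices P}}},
    [/\ D \in dual_faces (simple_base P), succ_dim D = d.+1 &
        F = realization R D].

Definition simple_face_iso (R : realType) (P Q : simple_cell R)
    (F : set 'rV[R]_#|{: option {set simple_vertices P}}|)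
    (G : set 'rV[R]_#|{: option {set simple_vertices Q}}|)
    (phi : 'rV[R]_#|{: option {set simple_vertices P}}| ->
           'rV[R]_#|{: option {set simple_vertices Q}}|) :=
  exists (D : {set {set option {set simple_vertices P}}})
    (E : {set {set option {set simple_vertices Q}}})
    (h : option {set simple_vertices P} -> option {set simple_vertices Q}),
    [/\ D \in dual_faces (simple_base P) /\ F = realization R D,
        E \in dual_faces (simple_base Q) /\ G = realization R E,
        simple_cell_iso (simple_base P) (simple_base Q) D E h &
        phi = realize_map h].

Definition simple_kind (R : realType) : cell_kind R :=
  @CellKind R (simple_cell R)
    (fun P => #|{: option {set simple_vertices P}}|)
    (fun P => realization R (cone (bary (simple_base P))))
    (@simple_face R) (@simple_face_iso R).

Definition simple_cell_complex (R : realType) := cell_complex (simple_kind R).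

(** * Cubic cell complexes *)

Definition cube (R : realType) d : set 'rV[R]_d :=
  [set x | forall i, 0 <= x 0 i <= 1].

(* [a i] is the value prescribed to the i-th coordinate, if any. *)
Definition cube_face_set (R : realType) d (a : {ffun 'I_d -> option bool}) :
    set 'rV[R]_d :=
  [set x | cube x /\ forall i b, a i = Some b -> x 0 i = b%:R].

Definition cube_face (R : realType) (d k : nat) (F : set 'rV[R]_d) :=
  exists a : {ffun 'I_d -> option bool},
    #|[pred i | a i == None]| = k /\ F = @cube_face_set R d a.

Definition cube_face_iso (R : realType) (d e : nat) (F : set 'rV[R]_d)
    (G : set 'rV[R]_e) (phi : 'rV[R]_d -> 'rV[R]_e) :=
  [/\ exists k, cube_face k F, exists k, cube_face k G,
      affine_on F phi & set_bij F G phi].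

Definition cube_kind (R : realType) : cell_kind R :=
  @CellKind R nat id (@cube R) (@cube_face R) (@cube_face_iso R).

Definition cubic_cell_complex (R : realType) := cell_complex (cube_kind R).

Definition cube_vertex (R : realType) d (v : {ffun 'I_d -> bool}) : 'rV[R]_d :=
  \row_i (v i)%:R.

Definition edge_midpoints (R : realType) d (v : {ffun 'I_d -> bool}) :
    seq 'rV[R]_d :=
  [seq \row_i (if i == j then 2^-1 else (v i)%:R) | j <- enum 'I_d].

Section Links.
Variables (R : realType) (M : cubic_cell_complex R).

Definition vertex_at (x : total_space M) (i : 'I_(ncells M))
    (v : {ffun 'I_(cells i) -> bool}) :=
  exists p : points (cells i), val p = cube_vertex R v /\ chart p = x.

(* It is enough to consider the glued cubes: for a face of a cube the convex
   hull of the midpoints is a face of the hull for the whole cube. *)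
Definition link (x : total_space M) : set (total_space M) :=
  [set y | exists (i : 'I_(ncells M)) (v : {ffun 'I_(cells i) -> bool})
       (p : points (cells i)),
     [/\ vertex_at x v, hull (edge_midpoints R v) (val p) & y = chart p]].

(* The link of [x] is piecewise linearly homeomorphic to the boundary of an
   m-simplex; the piecewise linear structure of the link is that of the
   simplices it is glued from. *)
Definition link_is_sphere (m : nat) (x : total_space M) :=
  exists f : total_space M -> 'rV[R]_#|'I_m.+1|,
    set_bij (link x) (realization R (bd_simplex m)) f /\
    forall (i : 'I_(ncells M)) (v : {ffun 'I_(cells i) -> bool}),
      vertex_at x v ->
      exists h : 'rV[R]_(cells i) -> 'rV[R]_#|'I_m.+1|,
        pl_on (hull (edge_midpoints R v)) h /\
        forall p : points (cells i),
          hull (edge_midpoints R v) (val p) -> f (chart p) = h (val p).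

Definition cubic_combinatorial_manifold (m : nat) :=
  forall x : total_space M, is_cell 0 [set x] -> link_is_sphere m x.

End Links.

(** * Singular homology *)

Definition std_simplex (R : realType) k : set 'rV[R]_k.+1 :=
  [set x | (forall i, 0 <= x 0 i) /\ \sum_i x 0 i = 1].

Definition coface_row (R : realType) k (i : 'I_k.+2) (x : 'rV[R]_k.+1) :
    'rV[R]_k.+2 :=
  \row_j (if unlift i j is Some j' then x 0 j' else 0).

Lemma coface_subproof (R : realType) k (i : 'I_k.+2)
    (x : set_type (@std_simplex R k)) :
  coface_row i (val x) \in @std_simplex R k.+1.
Proof.
case: x => x /= /set_mem[x0 x1]; apply/mem_set; split=> [j|].
  by rewrite mxE; case: unliftP.
rewrite (bigD1_ord i)//= mxE unlift_none add0r -x1.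
by apply: eq_bigr => j _; rewrite mxE liftK.
Qed.

Definition coface (R : realType) k (i : 'I_k.+2)
    (x : set_type (@std_simplex R k)) : set_type (@std_simplex R k.+1) :=
  exist _ (coface_row i (val x)) (coface_subproof i x).

Section SingularHomology.
Variables (R : realType) (X : topologicalType).

(* Integral singular chains, as coefficient functions. *)
Definition chain k := (set_type (@std_simplex R k) -> X) -> int.

Definition chain_in k (A : set X) (c : chain k) :=
  finite_set [set s | c s != 0] /\
  forall s, c s != 0 -> continuous s /\ range s `<=` A.

Definition boundary k (c : chain k.+1) : chain k :=
  fun t => \sum_(i < k.+2)
    (-1) ^+ i *
    \sum_(s \in [set s : set_type (@std_simplex R k.+1) -> X |
                  s \o coface i = t]) c s.

Definition rel_cycle k (A : set X) : chain k -> Prop :=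
  if k is k'.+1 then
    fun c : chain k'.+1 => chain_in setT c /\ chain_in A (boundary c)
  else chain_in setT.

Definition rel_boundary k (A : set X) (c : chain k) :=
  exists b a, [/\ @chain_in k.+1 setT b, chain_in A a & c = boundary b + a].

(* H_k(X, A) is isomorphic to the integers: by the first isomorphism theorem,
   there is a surjective homomorphism from the relative cycles to the integers
   whose kernel consists of the relative boundaries. *)
Definition rel_homology_is_Z k (A : set X) :=
  exists phi : chain k -> int,
    [/\ forall c d, rel_cycle A c -> rel_cycle A d ->
          phi (c + d) = phi c + phi d,
        forall m, exists2 c, rel_cycle A c & phi c = m &
        forall c, rel_cycle A c -> (phi c = 0 <-> rel_boundary A c)].

Definition local_homology_is_Z k (x : X) := rel_homology_is_Z k (~` [set x]).

(* A representative of a fundamental class: a k-cycle generating every local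
   homology group. *)
Definition fundamental_cycle k (mu : chain k) :=
  rel_cycle set0 mu /\
  forall x c, rel_cycle (~` [set x]) c ->
    exists m : int, rel_boundary (~` [set x]) (c - mu *~ m).

End SingularHomology.

(** * Pseudo-manifolds *)

Definition simple_cell_pseudomanifold (R : realType) (n : nat)
    (Z : simple_cell_complex R) :=
  [/\ forall d c, @is_cell _ _ Z d c -> exists2 a, is_cell n a & c `<=` a,
      forall d c, d.+1 = n -> @is_cell _ _ Z d c ->
        exists a b, [/\ a <> b, is_cell n a /\ c `<=` a,
          is_cell n b /\ c `<=` b &
          forall a', is_cell n a' -> c `<=` a' -> a' = a \/ a' = b] &
      forall z : total_space Z, local_homology_is_Z R n z].

(* Since the pseudo-manifold is normal, the n-cycle made of coherently oriented
   n-cells generates the local homology at every point, not only at those off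
   the codimension-2 skeleton. *)
Definition orientation (R : realType) (n : nat) (Z : simple_cell_complex R)
    (mu : chain R (total_space Z) n) :=
  fundamental_cycle mu.

(** * Maps *)

(* Every cell of [M] is cut into finitely many polytopes, each of which [g] maps
   into one cell of [Z] by the restriction of a smooth map between the ambient
   Euclidean spaces. *)
Definition piecewise_smooth (R : realType) (K L : cell_kind R)
    (M : cell_complex K) (Z : cell_complex L)
    (g : total_space M -> total_space Z) :=
  continuous g /\
  forall i : 'I_(ncells M), exists S,
    polytope_cover (body (cells i)) S /\
    forall s, s \in S -> exists (j : 'I_(ncells Z))
      (f : 'rV[R]_(ambient (cells i)) -> 'rV[R]_(ambient (cells j))),
      smooth f /\
      forall p : points (cells i), hull s (val p) ->
        exists2 q : points (cells j), val q = f (val p) & g (chart p) = chart q.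

(* The restriction of [g] to the preimage of the open set [B] is a k-fold
   covering of [B]. *)
Definition fold_covering (X Y : topologicalType) (g : X -> Y) (B : set Y)
    (k : nat) :=
  forall y, B y -> exists U (V : 'I_k -> set X),
    [/\ [/\ open U, U y & U `<=` B],
        forall i j, i <> j -> V i `&` V j = set0,
        g @^-1` U = \bigcup_i V i &
        forall i, [/\ open (V i), set_bij (V i) U g,
          {within V i, continuous g} &
          forall W, open W -> W `<=` V i -> open (g @` W)]].

(** * Covering dimension *)

(* Every finite open cover of [A] has an open refinement of which no point of
   [A] belongs to more than [k] members, i.e. dim A <= k - 1. *)
Definition covering_order_le (X : topologicalType) (A : set X) (k : nat) :=
  forall r (U : 'I_r -> set X),
    (forall i, open (U i)) -> A `<=` \bigcup_i U i ->
    exists s (W : 'I_s -> set X),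
      [/\ forall j, open (W j), A `<=` \bigcup_j W j,
          forall j, exists i, W j `&` A `<=` U i &
          forall x, A x -> (#|[pred j | `[< W j x >]]| <= k)%N].

Definition covering_dim (X : topologicalType) (A : set X) (d : nat) :=
  covering_order_le A d.+1 /\ ~ covering_order_le A d.

(* Main.v *)
From mathcomp Require Import all_boot all_order all_algebra generic_quotient.
From mathcomp Require Import boolp reals topology.
From mathcomp Require classical_sets fingroup perm.
From mathcomp Require Import ring lra zify.
Require Import Defs.

Set Implicit Arguments.
Unset Strict Implicit.
Unset Printing Implicit Defensive.

(* Cut every n-cell of Z into the simplices spanned by its apex c_{-1} and by the
   maximal flags c_0 < ... < c_{n-1} of simplices of the base sphere Y.  The
   complex M has 2^n cubes [0,1]^n over each such simplex, indexed by signs e_k.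
   The cube is mapped onto the simplex by giving the weight
   t_k prod_{j>k} (1 - t_j) to c_k and prod_j (1 - t_j) to c_{-1}; this collapses
   the faces t_k = 1.  Two cubes are glued at t when the faces spanned by the c_k
   with t_k > 0 and, if t_0 < 1, by c_{-1} have the same barycenter in Z and the
   signs agree except on the mirrors t_k = 1, k >= 1.

   Off the codimension-2 skeleton t is a function of the point of Z and the signs
   are free, so that g is a covering with 2^n sheets.  The preimage of the
   skeleton consists of the points with t_k = 1 for some k >= 1, i.e. of
   (n-1)-cubes; its covering dimension is bounded below by Sperner's lemma, and
   above by the coloring of a grid according to the number of coordinates close
   to the grid values.

   A direction at a vertex of M with t = 1 exactly for k in K corresponds to a
   direction at the point p = sum_(k in K) c_k of the cone over Y': the
   coordinate at c_k is negative on the far side of the k-th mirror, and for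
   k = 0 in the neighbouring n-cell.  So the link of the vertex is the l1-sphere
   of the tangent cone of Cone(Y') at p.  The derivative of a homogeneous
   piecewise linear homeomorphism Cone(Y') = Cone(bd simplex) maps this tangent
   cone onto a Euclidean space. *)

(** * Flags and dual faces *)

(** The gluing of [M] is defined as equality of an invariant, which makes it an equivalence relation
    at once. A barycenter can stand for its face because flag simplices meet in [Z] only at points
    with equal barycentric coordinates, and an identification at one point extends to the whole face
    carrying it. The delicate point is the link. That links of simplices in a combinatorial sphere
    are spheres is usually proved by stellar moves or regular neighbourhoods. Here everything is
    made homogeneous instead: a piecewise linear homeomorphism of spheres becomes a map of cones,
    linear on finitely many polyhedral pieces, and such a map has at every point a derivative of the
    same kind. Two corrections are needed: the tangent cone of the boundary of an orthant is brought
    back to that boundary by projecting along the diagonal, and the radial projection to unit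
    spheres, only projective on the pieces, is replaced by a rescaling along a system of rays. The
    linear pieces also give the invariance of dimension by which combinatorial spheres are pure, so
    that full flags exist. *)

Section SetInterpolation.
Variable T : finType.

Lemma subset_interpolate (a b : {set T}) k : a \subset b -> #|a| <= k <= #|b| ->
  exists c : {set T}, [/\ a \subset c, c \subset b & #|c| = k].
Proof.
move=> ab /andP[ak kb].
exists (a :|: [set x in take (k - #|a|) (enum (b :\: a))]); split.
- exact: subsetUl.
- rewrite subUset ab /=; apply/subsetP => x; rewrite inE => /mem_take.
  by rewrite mem_enum inE => /andP[].
- rewrite cardsU disjoint_setI0 ?cards0 ?subn0; last first.
    rewrite -setI_eq0; apply/eqP/setP => x; rewrite !inE.
    apply/negbTE/negP => /andP[xa /mem_take].
    by rewrite mem_enum inE xa.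
  rewrite cardsE (card_uniqP (take_uniq _ (enum_uniq _))) size_take -cardE.
  rewrite cardsD (setIidPr ab).
  by have := subset_leq_card ab; move: ak kb; case: ltnP; lia.
Qed.

Definition chainb (c : {set {set T}}) :=
  [forall s in c, forall t in c, (s \subset t) || (t \subset s)].

Lemma chainbP (c : {set {set T}}) : reflect
  (forall s t, s \in c -> t \in c -> (s \subset t) || (t \subset s)) (chainb c).
Proof.
apply: (iffP forall_inP) => [h s t sc tc|h s sc].
  by have /forall_inP := h s sc; apply.
by apply/forall_inP => t; apply: h.
Qed.

Lemma chain_card_inj (c : {set {set T}}) s t : chainb c -> s \in c -> t \in c ->
  #|s| = #|t| -> s = t.
Proof.
move=> /chainbP cc sc tc e; apply/eqP.
by have /orP[st|ts] := cc _ _ sc tc; [|rewrite eq_sym]; rewrite eqEcard ?st ?ts /= e.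
Qed.

End SetInterpolation.

Section Flags.
Variables (V : finType) (Y : {set {set V}}) (n : nat).
Hypothesis cY : is_complex Y.

(** Adjoining [set0] lets the empty complex be pure with n = 0; it is the base of the 0-dimensional
    cell. *)
Definition pure :=
  (forall s, s \in Y -> #|s| <= n) /\
  (forall s, s \in set0 |: Y ->
     exists2 t, t \in set0 |: Y & s \subset t /\ #|t| = n).
Hypothesis pY : pure.

Definition is_flag (f : {ffun 'I_n -> {set V}}) :=
  [forall k, (f k \in Y) && (#|f k| == k.+1)] &&
  [forall k : 'I_n, forall l : 'I_n, (k <= l) ==> (f k \subset f l)].

Lemma flagP f : is_flag f -> [/\ forall k, f k \in Y, forall k, #|f k| = k.+1 &
  forall k l : 'I_n, k <= l -> f k \subset f l].
Proof.
move=> /andP[/forallP h1 /forallP h2]; split=> [k|k|k l kl].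
- by have /andP[] := h1 k.
- by have /andP[_ /eqP] := h1 k.
- by have /forallP/(_ l)/implyP := h2 k; apply.
Qed.

(** A maximal chain [C] containing c has a member of every size k from 1 to n. Otherwise take its
    largest member below size k (or [set0]) and its smallest member above (or, by purity, a simplex
    of size n): a set of size k between the two is comparable with all of [C], against
    maximality. *)
Lemma flag_extend (c : {set {set V}}) : c \subset Y -> chainb c ->
  exists2 f, is_flag f & forall s, s \in c -> exists k, f k = s.
Proof.
move=> cY' cc; have [Y0 Yc] := cY; have [Yle Yt] := pY.
have P0 : [&& c \subset c, c \subset Y & chainb c] by rewrite subxx cY'.
have [C /and3P[cC CY CC] Cmax] := @arg_maxnP _ c
  (fun C => [&& c \subset C, C \subset Y & chainb C]) (fun C : {set {set V}} => #|C|) P0.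
have CCP := elimT (chainbP _) CC.
have full k : 0 < k <= n -> exists2 s, s \in C & #|s| = k.
  move=> /andP[k0 kn].
  have [/existsP[s /andP[sC /eqP sk]]|nk] := boolP [exists s, (s \in C) && (#|s| == k)].
    by exists s.
  have nkP s : s \in C -> #|s| <> k.
    by move=> sC sk; case/negP: nk; apply/existsP; exists s; rewrite sC sk eqxx.
  have Q0 : (set0 \in set0 |: C) && (#|@set0 V| < k) by rewrite setU11 cards0.
  have [a /andP[aC ak] amax] := @arg_maxnP _ set0
    (fun a => (a \in set0 |: C) && (#|a| < k)) (fun a : {set V} => #|a|) Q0.
  have aY : a \in set0 |: Y.
    by move: aC; rewrite !in_setU1 => /predU1P[->|/(subsetP CY)->]; rewrite ?eqxx ?orbT.
  have aS s : s \in C -> #|s| < k -> s \subset a.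
    move=> sC sk; have := amax s; rewrite in_setU1 sC orbT sk => /(_ isT) sa.
    move: aC; rewrite in_setU1 => /predU1P[a0|aC].
      by move: sa; rewrite a0 cards0 /= leqn0 cards_eq0 => /eqP->; rewrite sub0set.
    have /orP[//|as_] := CCP _ _ sC aC.
    by suff /eqP<- : a == s by []; rewrite eqEcard as_.
  have [b [bY ab kb bS]] : exists b, [/\ b \in Y, a \subset b, k <= #|b| &
      forall s, s \in C -> k < #|s| -> b \subset s].
    have [/existsP[s1 s1P]|nb] := boolP [exists s, (s \in C) && (k < #|s|)].
      have [b /andP[bC kb] bmin] := @arg_minnP _ s1
        (fun s => (s \in C) && (k < #|s|)) (fun s : {set V} => #|s|) s1P.
      exists b; split=> //; [exact: subsetP CY _ bC| |exact: ltnW|].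
        move: aC; rewrite in_setU1 => /predU1P[->|aC]; first by rewrite sub0set.
        have /orP[//|ba] := CCP _ _ aC bC.
        by have := leq_trans kb (subset_leq_card ba); rewrite ltnNge ltnW.
      move=> s sC ks; have /orP[//|sb] := CCP _ _ bC sC.
      suff /eqP-> : s == b by [].
      by rewrite eqEcard sb; apply: bmin; rewrite sC.
    have [b bY [ab bn]] := Yt _ aY; exists b; split=> //; last 2 first.
    - by rewrite bn.
    - move=> s sC ks; case/negP: nb; apply/existsP; exists s; by rewrite sC.
    move: bY; rewrite in_setU1 => /predU1P[b0|//].
    by move: (leq_trans k0 kn); rewrite -bn b0 cards0.
  have [|s [as_ sb sk]] := @subset_interpolate _ a b k ab; first by rewrite ltnW.
  have s0 : s != set0 by rewrite -card_gt0 sk.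
  have sY := Yc _ _ bY sb s0.
  have sC : s \notin C by apply/negP => /nkP.
  have cmp t : t \in C -> (s \subset t) || (t \subset s).
    move=> tC; have := nkP _ tC; case: (ltngtP #|t| k) => // tk _.
      by rewrite (subset_trans (aS _ tC tk) as_) orbT.
    by rewrite (subset_trans sb (bS _ tC tk)).
  have := Cmax (s |: C).
  have -> : [&& c \subset s |: C, s |: C \subset Y & chainb (s |: C)].
    rewrite (subset_trans cC (subsetUr _ _)) subUset sub1set sY CY /=.
    apply/chainbP => t u; rewrite !in_setU1 => /predU1P[->|tC] /predU1P[->|uC].
    - by rewrite subxx.
    - exact: cmp.
    - by rewrite orbC cmp.
    - exact: CCP.
  by move=> /(_ isT); rewrite /= cardsU1 sC add1n ltnn.
pose f := [ffun k : 'I_n => odflt set0 [pick s in C | #|s| == k.+1]].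
have fP k : f k \in C /\ #|f k| = k.+1.
  rewrite ffunE; case: pickP => [s /andP[sC /eqP sk]//|no].
  have [|s sC sk] := full k.+1; first by rewrite ltn_ord.
  by have := no s; rewrite sC sk eqxx.
exists f.
  apply/andP; split; apply/forallP => k; have [fC fk] := fP k.
    by rewrite (subsetP CY)// fk eqxx.
  apply/forallP => l; apply/implyP => kl; have [lC fl] := fP l.
  have /orP[//|lk] := CCP _ _ fC lC.
  suff /eqP-> : f l == f k by [].
  by rewrite eqEcard lk fk fl ltnS.
move=> s sc; have sC := subsetP cC _ sc; have sY := subsetP CY _ sC.
have sn : #|s|.-1 < n.
  rewrite prednK ?Yle// card_gt0.
  by apply: contraNneq Y0 => <-.
exists (Ordinal sn); have [fC fk] := fP (Ordinal sn).
apply: chain_card_inj CC fC sC _; rewrite fk /= prednK// card_gt0.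
by apply: contraNneq Y0 => <-.
Qed.

End Flags.

(* The vertices of the cell dual to [Y] are the members of [set0 |: Y]; the
   apex [None] stands for [set0]. *)
Definition unvert (V : finType) (o : option {set V}) : {set V} := odflt set0 o.

(** * Dual faces as complexes of chains of simplices *)

Section DualFaces.
Variables (V : finType) (Y : {set {set V}}).
Hypothesis cY : is_complex Y.

Definition vert (s : {set V}) : option {set V} := if s == set0 then None else Some s.

Definition is_vert (o : option {set V}) := if o is Some s then s \in Y else true.

Lemma unvertK o : is_vert o -> vert (unvert o) = o.
Proof.
case: o => [s|] /= h; rewrite /vert /unvert /= ?eqxx//.
by case: eqP h => // ->; rewrite (negbTE cY.1).
Qed.

Lemma vertK s : unvert (vert s) = s.
Proof. by rewrite /vert; case: eqP => [->|]. Qed.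

Lemma is_vert_vert s : is_vert (vert s) = (s \in set0 |: Y).
Proof. by rewrite /vert in_setU1; case: eqP. Qed.

Lemma unvert_in o : is_vert o -> unvert o \in set0 |: Y.
Proof. by move=> vo; rewrite -is_vert_vert unvertK. Qed.

Lemma unvert_inj o o' : is_vert o -> is_vert o' -> unvert o = unvert o' -> o = o'.
Proof. by move=> vo vo' e; rewrite -[o]unvertK// e unvertK. Qed.

Lemma mem_dual_face s c : s \in set0 |: Y -> c \in dual_face Y s <->
  [/\ c != set0, forall o, o \in c -> is_vert o /\ s \subset unvert o &
      forall o o', o \in c -> o' \in c ->
        (unvert o \subset unvert o') || (unvert o' \subset unvert o)].
Proof.
have [Y0 Yc] := cY => sY; rewrite /dual_face; case: eqP => [->|/eqP s0].
  rewrite inE in_setU1.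
  have SE : forall t : {set V}, (t \in [set v | Some v \in c]) = (Some t \in c).
    by move=> t; rewrite inE.
  split=> [/andP[c0 h]|[c0 cv cc]].
    have cY' t : Some t \in c -> t \in Y.
      move: h => /predU1P[h|]; first by rewrite -SE h inE.
      by rewrite inE => /and3P[_ /subsetP h _]; rewrite -SE; apply: h.
    split=> // [[t|] tc|[t|] [u|] tc uc]; rewrite ?sub0set ?orbT//.
      by split=> //; apply: cY'.
    move: h => /predU1P[h|]; first by rewrite -SE h inE in tc.
    rewrite inE => /and3P[_ _ /forall_inP h].
    by rewrite -!SE in tc uc; have /forall_inP := h _ tc; apply.
  rewrite c0 /=; case: eqP => //= /eqP e0; rewrite inE e0 /=.
  apply/andP; split; first by apply/subsetP => t; rewrite SE => /cv[].
  apply/forall_inP => t; rewrite SE => tc; apply/forall_inP => u; rewrite SE => uc.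
  exact: cc _ _ tc uc.
have sY' : s \in Y by move: sY; rewrite in_setU1 (negbTE s0).
have [y0 y0s] := set0Pn _ s0.
split=> [/imsetP[b /bigcapP hb ->]|[c0 cv cc]].
  have hb1 y : y \in s -> b \in bary Y /\ forall t, t \in b -> y \in t.
    move=> /hb; rewrite inE => /andP[bB /existsP[d /and3P[]]].
    rewrite inE => /and3P[_ /subsetP dY /forall_inP dc] yd bd; split=> // t tb.
    have td := subsetP bd _ tb.
    have /forall_inP/(_ _ td) := dc _ yd; rewrite sub1set => /orP[//|].
    rewrite subset1 => /orP[/eqP->|/eqP t0]; first by rewrite inE.
    by have := dY _ td; rewrite t0 (negbTE Y0).
  have [] := hb1 _ y0s; rewrite inE => /and3P[b0 /subsetP bY /forall_inP bc] _.
  split.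
  - have [t tb] := set0Pn _ b0; apply/set0Pn; exists (Some t); exact: imset_f.
  - move=> _ /imsetP[t tb ->]; split; first exact: bY.
    by apply/subsetP => y /hb1[_]; apply.
  - move=> _ _ /imsetP[t tb ->] /imsetP[u ub ->] /=.
    by have /forall_inP := bc _ tb; apply.
pose b := [set t | Some t \in c].
have bE t : (t \in b) = (Some t \in c) by rewrite inE.
have cb : c = [set Some t | t in b].
  apply/setP => o; apply/idP/imsetP => [oc|[t]]; last by rewrite bE => tc ->.
  case: o oc => [t tc|/cv[_]]; first by exists t; rewrite ?bE.
  by rewrite subset0 (negbTE s0).
apply/imsetP; exists b => //; apply/bigcapP => y ys.
have bB : b \in bary Y.
  rewrite inE; apply/and3P; split.
  - by apply: contraNneq c0 => b0; rewrite cb b0 imset0.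
  - by apply/subsetP => t; rewrite bE => /cv[].
  - apply/forall_inP => t; rewrite bE => tc; apply/forall_inP => u.
    by rewrite bE => uc; apply: (cc _ _ tc uc).
rewrite inE bB /=; apply/existsP; exists ([set y] |: b).
rewrite setU11 subsetUr andbT /= andbT.
have yb t : t \in b -> y \in t.
  by rewrite bE => /cv[_ /subsetP]; apply.
move: bB; rewrite !inE => /and3P[b0 bY bc]; apply/and3P; split.
- by apply/set0Pn; exists [set y]; rewrite setU11.
- rewrite subUset bY sub1set andbT; apply: Yc sY' _ _; first by rewrite sub1set.
  by apply/set0Pn; exists y; rewrite inE.
- apply/chainbP => t u; rewrite !in_setU1 => /predU1P[->|tb] /predU1P[->|ub].
  + by rewrite subxx.
  + by rewrite sub1set yb.
  + by rewrite orbC sub1set yb.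
  + exact: (elimT (chainbP b) bc).
Qed.

Lemma dual_face_complex s : s \in set0 |: Y -> is_complex (dual_face Y s).
Proof.
move=> sY; split=> [|c d].
  by apply/negP => /(mem_dual_face _ sY)[]; rewrite eqxx.
move=> /(mem_dual_face _ sY)[c0 cv cc] /subsetP dc d0.
apply/mem_dual_face => //; split=> // [o /dc/cv//|o o' /dc oc /dc oc'].
exact: cc.
Qed.

Lemma vert_dual_face s o : s \in set0 |: Y ->
  ([set o] \in dual_face Y s) = is_vert o && (s \subset unvert o).
Proof.
move=> sY; apply/idP/andP => [/(mem_dual_face _ sY)[_ h _]|[vo so]].
  by apply: h; rewrite inE.
apply/mem_dual_face => //; split.
- by apply/set0Pn; exists o; rewrite inE.
- by move=> o'; rewrite inE => /eqP->.
- by move=> o1 o2; rewrite !inE => /eqP-> /eqP->; rewrite subxx.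
Qed.

Lemma cover_dual_face s o : s \in set0 |: Y ->
  (o \in cover (dual_face Y s)) = is_vert o && (s \subset unvert o).
Proof.
move=> sY; apply/bigcupP/idP => [[c cD oc]|].
  by have [_ /(_ _ oc)[-> ->] _] := (mem_dual_face _ sY).1 cD.
by rewrite -vert_dual_face// => oD; exists [set o]; rewrite ?inE.
Qed.

Lemma sub_dual_face s t : s \in set0 |: Y -> t \in set0 |: Y ->
  (dual_face Y s \subset dual_face Y t) = (t \subset s).
Proof.
move=> sY tY; apply/idP/idP => [/subsetP/(_ [set vert s])|ts].
  by rewrite !vert_dual_face// is_vert_vert sY vertK subxx => /(_ isT).
apply/subsetP => c /(mem_dual_face _ sY)[c0 cv cc]; apply/mem_dual_face => //.
by split=> // o /cv[vo so]; split=> //; apply: subset_trans ts so.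
Qed.

Definition flag_vert n (f : {ffun 'I_n -> {set V}}) (k : 'I_n.+1) : option {set V} :=
  if unlift ord0 k is Some k' then Some (f k') else None.

Lemma flag_vertP n f (k : 'I_n.+1) : is_flag Y f ->
  is_vert (flag_vert f k) /\ #|unvert (flag_vert f k)| = k.
Proof.
move=> /flagP[fY fc _]; rewrite /flag_vert; case: unliftP => [k' ->|->] /=.
  by rewrite fc.
by rewrite cards0.
Qed.

Lemma flag_vert_sub n f (k l : 'I_n.+1) : is_flag Y f -> k <= l ->
  unvert (flag_vert f k) \subset unvert (flag_vert f l).
Proof.
move=> /flagP[fY fc fm]; rewrite /flag_vert.
case: unliftP => [k' ->|->] kl /=; last exact: sub0set.
case: unliftP kl => [l' ->|->] //=; rewrite /bump /= !add1n.
by rewrite ltnS; apply: fm.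
Qed.

Lemma flag_vert_inj n f : is_flag Y f -> injective (@flag_vert n f).
Proof.
move=> ff k l e; apply: val_inj => /=.
by have [_ <-] := flag_vertP k ff; rewrite e; case: (flag_vertP l ff).
Qed.

Lemma flag_face n f (B : {set 'I_n.+1}) s : is_flag Y f -> s \in set0 |: Y ->
  B != set0 -> (forall k, k \in B -> s \subset unvert (flag_vert f k)) ->
  [set flag_vert f k | k in B] \in dual_face Y s.
Proof.
move=> ff sY /set0Pn[k0 k0B] sB; apply/mem_dual_face => //; split.
- by apply/set0Pn; exists (flag_vert f k0); apply: imset_f.
- by move=> _ /imsetP[k kB ->]; split; [case: (flag_vertP k ff) | apply: sB].
- move=> _ _ /imsetP[k kB ->] /imsetP[l lB ->].
  by case: (leqP k l) => [|/ltnW] kl; rewrite (flag_vert_sub ff kl) ?orbT.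
Qed.

Lemma flag_through n (c : {set option {set V}}) s : pure Y n -> s \in set0 |: Y ->
  c \in dual_face Y s -> exists2 f : {ffun 'I_n -> {set V}}, is_flag Y f &
    forall o, o \in c -> exists k, flag_vert f k = o.
Proof.
move=> pY sY /(mem_dual_face _ sY)[c0 cv cc].
pose b := [set t | Some t \in c].
have bE t : (t \in b) = (Some t \in c) by rewrite inE.
have [||f ff fb] := @flag_extend _ _ n cY pY b.
- by apply/subsetP => t; rewrite bE => /cv[].
- by apply/chainbP => t u; rewrite !bE => tc uc; apply: (cc _ _ tc uc).
exists f => // -[t tc|_].
  have [|k fk] := fb t; first by rewrite bE.
  by exists (lift ord0 k); rewrite /flag_vert liftK fk.
by exists ord0; rewrite /flag_vert unlift_none.
Qed.

(** Cardinality is injective on a chain and takes values between [#|s|] and n on [dual_face Y s]; a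
    full flag through s attains all of them. *)
Lemma succ_dim_dual_face n s : pure Y n -> s \in set0 |: Y ->
  succ_dim (dual_face Y s) = n.+1 - #|s|.
Proof.
move=> pY sY; have [Yle _] := pY; apply/eqP; rewrite eqn_leq; apply/andP; split.
  apply/bigmax_leqP => c /(mem_dual_face _ sY)[c0 cv cc].
  have le o : o \in c -> #|s| <= #|unvert o| <= n.
    move=> /cv[vo so]; rewrite subset_leq_card//=.
    by case: (o) vo => [t /Yle//|_]; rewrite cards0.
  have rI : {in enum c &, injective (fun o : option {set V} => #|unvert o|)}.
    move=> o o'; rewrite !mem_enum => oc oc' e.
    have [vo _] := cv _ oc; have [vo' _] := cv _ oc'; apply: unvert_inj => //.
    have cI : chainb [set unvert o; unvert o'].
      by apply/chainbP => t u; rewrite !inE => /orP[] /eqP-> /orP[] /eqP->;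
        rewrite ?subxx ?cc.
    by apply: chain_card_inj cI _ _ e; rewrite !inE eqxx ?orbT.
  rewrite cardE -(size_map (fun o : option {set V} => #|unvert o|)).
  rewrite -(size_iota #|s| (n.+1 - #|s|)); apply: uniq_leq_size.
    by rewrite map_inj_in_uniq ?enum_uniq.
  move=> k /mapP[o]; rewrite mem_enum => /le/andP[so on] ->.
  by rewrite mem_iota so subnKC ?ltnS// (leq_trans so (leqW on)).
have [|f ff fs] := @flag_through n [set vert s] s pY sY.
  by rewrite vert_dual_face// is_vert_vert sY vertK subxx.
have [|k0 fk0] := fs (vert s); first by rewrite inE.
have k0E : k0 = #|s| :> nat by have [_ <-] := flag_vertP k0 ff; rewrite fk0 vertK.
pose B := [set k : 'I_n.+1 | k0 <= k].
have BD : [set flag_vert f k | k in B] \in dual_face Y s.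
  apply: flag_face => //; first by apply/set0Pn; exists k0; rewrite inE.
  by move=> k; rewrite inE => /(flag_vert_sub ff); rewrite fk0 vertK.
apply: leq_trans (leq_bigmax_cond _ BD).
rewrite card_imset; last exact: flag_vert_inj.
rewrite -k0E -(card_ord (n.+1 - k0)) -cardsT.
have lt (i : 'I_(n.+1 - k0)) : k0 + i < n.+1 by have := ltn_ord i; lia.
have gI : injective (fun i => Ordinal (lt i)).
  by move=> i j /(congr1 val) /= /addnI /val_inj.
rewrite -(card_imset _ gI); apply/subset_leq_card/subsetP => _ /imsetP[i _ ->].
by rewrite inE /= leq_addr.
Qed.

End DualFaces.

(** * Isomorphisms between faces of simple cells *)

Section FaceIso.
Variables (V W : finType) (X : {set {set V}}) (Y : {set {set W}}).
Hypotheses (cX : is_complex X) (cY : is_complex Y).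
Variables (s : {set V}) (t : {set W}) (h : option {set V} -> option {set W}).
Hypotheses (sX : s \in set0 |: X) (tY : t \in set0 |: Y).
Hypothesis hiso : simple_cell_iso X Y (dual_face X s) (dual_face Y t) h.

Lemma iso_inj o o' : is_vert X o -> is_vert X o' -> s \subset unvert o ->
  s \subset unvert o' -> h o = h o' -> o = o'.
Proof.
move=> vo vo' so so'; have [[hI _] _] := hiso.
by apply: hI; rewrite cover_dual_face// ?vo ?vo'.
Qed.

Lemma iso_simplex c : c \in dual_face X s -> h @: c \in dual_face Y t.
Proof. by have [[_ <-] _] := hiso => cD; apply/imsetP; exists c. Qed.

Lemma iso_vert o : is_vert X o -> s \subset unvert o ->
  is_vert Y (h o) /\ t \subset unvert (h o).
Proof.
move=> vo so; have := @iso_simplex [set o].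
by rewrite vert_dual_face// vo so imset_set1 vert_dual_face// => /(_ isT)/andP.
Qed.

Lemma mem_map_face r o : r \in set0 |: X -> s \subset r -> is_vert X o ->
  s \subset unvert o ->
  ([set h o] \in map_complex h (dual_face X r)) = (r \subset unvert o).
Proof.
move=> rX sr vo so; apply/imsetP/idP => [[c cD]|ro]; last first.
  by exists [set o]; rewrite ?imset_set1// vert_dual_face// vo.
have [/set0Pn[o' o'c] cv _] := (mem_dual_face cX _ rX).1 cD.
move=> /setP/(_ (h o')); rewrite inE imset_f// => /eqP e.
have [vo' ro'] := cv _ o'c.
by rewrite -(iso_inj vo' vo (subset_trans sr ro') so e).
Qed.

(* A vertex of the cell lies in a smallest face, the one dual to it. *)
Lemma iso_face o : is_vert X o -> s \subset unvert o ->
  map_complex h (dual_face X (unvert o)) = dual_face Y (unvert (h o)).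
Proof.
move=> vo so; have [vho tho] := iso_vert vo so; have [_ hF] := hiso.
have oX := unvert_in cX vo; have hoY := unvert_in cY vho.
(* Both the image of the smallest face at [o] and the smallest face at [h o] contain the vertex
   [h o]. As h induces a bijection between the faces of the two cells, the second is also the image
   of a face, and minimality on either side gives the two inclusions. *)
have : map_complex h (dual_face X (unvert o)) \in
    [set H in dual_faces Y | H \subset dual_face Y t].
  rewrite -hF; apply/imsetP; exists (dual_face X (unvert o)) => //.
  by rewrite inE sub_dual_face// so andbT; apply/imsetP; exists (unvert o).
rewrite inE => /andP[/imsetP[u uY eu] _].
have : dual_face Y (unvert (h o)) \in
    [set H in dual_faces Y | H \subset dual_face Y t].
  by rewrite inE sub_dual_face// tho andbT; apply/imsetP; exists (unvert (h o)).
rewrite -hF => /imsetP[H]; rewrite inE => /andP[/imsetP[r rX eH] sr] er.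
rewrite eH sub_dual_face// in sr er.
have ro : r \subset unvert o.
  by rewrite -(mem_map_face rX sr vo so) -er vert_dual_face// vho subxx.
apply/eqP; rewrite eqEsubset; apply/andP; split; last first.
  rewrite eu sub_dual_face//.
  by have := mem_map_face oX so vo so; rewrite subxx eu vert_dual_face// => /andP[].
by rewrite er; apply: imsetS; rewrite sub_dual_face.
Qed.

Lemma succ_dim_map_face r : r \in set0 |: X -> s \subset r ->
  succ_dim (map_complex h (dual_face X r)) = succ_dim (dual_face X r).
Proof.
move=> rX sr.
have cardE c : c \in dual_face X r -> #|h @: c| = #|c|.
  move=> /(mem_dual_face cX _ rX)[_ cv _]; apply: card_in_imset => o o' oc o'c.
  have [vo ro] := cv _ oc; have [vo' ro'] := cv _ o'c.
  by apply: iso_inj => //; apply: subset_trans sr _.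
apply/eqP; rewrite eqn_leq; apply/andP; split; apply/bigmax_leqP.
  move=> _ /imsetP[c cD ->]; rewrite cardE//.
  by rewrite /succ_dim; apply: leq_bigmax_cond.
move=> c cD; rewrite -cardE//.
by rewrite /succ_dim; apply: leq_bigmax_cond; apply: imset_f.
Qed.

Lemma iso_succ_dim o : is_vert X o -> s \subset unvert o ->
  succ_dim (dual_face Y (unvert (h o))) = succ_dim (dual_face X (unvert o)).
Proof.
by move=> vo so; rewrite -iso_face// succ_dim_map_face//; apply: unvert_in.
Qed.

End FaceIso.

(** * Sperner's lemma *)

Section Combinatorics.
Import fingroup perm.

(** * Sperner's lemma: doors of one simplex *)

Section Doors.
Variables (n : nat) (f : 'I_n.+1 -> 'I_n.+1).

(** A door, in the path-following proof of Sperner's lemma, is a facet carrying all labels but the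
    last; [m] is the vertex opposite to it. *)
Definition door m := [forall c, (c != ord_max) ==> [exists l, (l != m) && (f l == c)]].
Definition full := [forall c, [exists l, f l == c]].

Lemma doorP m : reflect (forall c, c != ord_max -> exists2 l, l != m & f l = c) (door m).
Proof.
apply: (iffP forallP) => [h c cm|h c].
  have /implyP/(_ cm)/existsP[l /andP[lm /eqP e]] := h c; by exists l.
apply/implyP => /h[l lm e]; apply/existsP; exists l; by rewrite lm e eqxx.
Qed.

Lemma fullP : reflect (forall c, exists l, f l = c) full.
Proof.
apply: (iffP forallP) => h c; first by have /existsP[l /eqP] := h c; exists l.
by have [l e] := h c; apply/existsP; exists l; rewrite e.
Qed.

(** A fully labelled simplex has the single door opposite to its vertex labelled [ord_max]. If
    another simplex has a door opposite to m0, the label of m0 occurs once more, at m1, and the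
    doors are exactly those opposite to m0 and m1. *)
Lemma odd_doors : odd #|[set m | door m]| = full.
Proof.
case: fullP => [fs|nfull].
  have fI : injective f.
    suff /image_injP h : #|image f 'I_n.+1| == #|'I_n.+1| by move=> x y; apply: h.
    apply/eqP/eq_card => c; rewrite inE.
    by have [l <-] := fs c; rewrite image_f.
  have [m fm] := fs ord_max.
  suff -> : [set m | door m] = [set m] by rewrite cards1.
  apply/setP => m'; rewrite !inE; apply/doorP/eqP => [h|-> c cm].
    case: (f m' =P ord_max) => [e|/eqP/h[l lm /fI e]]; first by apply: fI; rewrite fm.
    by rewrite e eqxx in lm.
  have [l fl] := fs c; exists l => //; apply: contraNneq cm => e.
  by rewrite -fl e fm.
have [->|/set0Pn[m0]] := eqVneq [set m | door m] set0; first by rewrite cards0.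
rewrite inE => /doorP h0.
set A := ~: [set m0]; have cA : #|A| = n by rewrite cardsC1 card_ord.
have cB : #|~: [set ord_max : 'I_n.+1]| = n by rewrite cardsC1 card_ord.
have sub : ~: [set ord_max] \subset f @: A.
  apply/subsetP => c; rewrite !inE => /h0[l lm <-].
  by apply: imset_f; rewrite !inE.
have cf : #|f @: A| = n.
  apply/eqP; rewrite eqn_leq; apply/andP; split.
    by apply: leq_trans (leq_imset_card _ _) _; rewrite cA.
  by apply: leq_trans (subset_leq_card sub); rewrite cB.
have fA : f @: A = ~: [set ord_max].
  by apply/esym/eqP; rewrite eqEcard sub cf cB /=.
have fI : {in A &, injective f} by apply/imset_injP; rewrite cf cA.
have fm0 : f m0 != ord_max.
  apply/eqP => e; apply: nfull => c; have [->|cm] := eqVneq c ord_max; first by exists m0.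
  by have [l _] := h0 c cm; exists l.
have [m1 m10 fm1] := h0 _ fm0.
suff -> : [set m | door m] = [set m0; m1] by rewrite cards2 eq_sym m10.
apply/setP => m; rewrite !inE; apply/doorP/idP => [hm|/orP[] /eqP->].
- have [//|m0' /=] := eqVneq m m0.
  have fm : f m != ord_max.
    have : f m \in f @: A by apply: imset_f; rewrite !inE.
    by rewrite fA !inE.
  have [l lm fl] := hm _ fm; have [e|l0] := eqVneq l m0.
    by apply/eqP/fI; rewrite ?inE// fm1 -e fl.
  case/eqP: lm; by apply: fI; rewrite ?inE.
- exact: h0.
- move=> c /h0[l lm0 fl]; have [e|] := eqVneq l m1; last by exists l.
  by exists m0; rewrite 1?eq_sym// -fl e fm1.
Qed.

End Doors.

Lemma even_involution (T : finType) (A : {set T}) (s : T -> T) :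
  (forall x, x \in A -> s x \in A) -> (forall x, s (s x) = x) -> (forall x, s x <> x) ->
  ~~ odd #|A|.
Proof.
move=> sA ss sx; elim: {A}#|A| {-2}A (leqnn #|A|) sA => [|k IH] A.
  by rewrite leqn0 => /eqP->.
have [->|/set0Pn[x xA]] := eqVneq A set0; first by rewrite cards0.
move=> Ak sA; have sxA := sA x xA.
have sxx : s x \in A :\ x by rewrite !inE sxA andbT; apply/eqP/sx.
rewrite (cardsD1 x) xA (cardsD1 (s x)) sxx /= negbK.
apply: IH => [|y].
  by have := Ak; rewrite (cardsD1 x) xA (cardsD1 (s x)) sxx; lia.
rewrite !inE => /and3P[ysx yx yA]; rewrite sA// andbT.
rewrite (inj_eq (can_inj ss)) yx /=.
by apply: contraNneq ysx => <-; rewrite ss.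
Qed.

(** * Sperner's lemma on the Kuhn triangulation of a grid *)

Section Sperner.
Variables (D N : nat) (lab : {ffun 'I_D.+1 -> nat} -> nat).
(** The face where the coordinates from d on vanish carries only labels up to d, so that the
    induction on d can run; a facet on the far side, where the i-th coordinate is N+1, lacks the
    label i and is never a door. *)
Hypothesis lab0 : forall (x : {ffun 'I_D.+1 -> nat}) (i : 'I_D.+1), x i = 0 -> lab x <= i.
Hypothesis labN : forall (x : {ffun 'I_D.+1 -> nat}) (i : 'I_D.+1), x i = N.+1 -> lab x <> i.
Hypothesis labD : forall x, lab x <= D.+1.

(* Simplices of the Kuhn triangulation of the grid: from the corner [b], the
   i-th coordinate is incremented at the step [p i]. *)
Let simp := ({ffun 'I_D.+1 -> 'I_N.+1} * {perm 'I_D.+1})%type.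

Definition kvert (s : simp) (m : nat) : {ffun 'I_D.+1 -> nat} :=
  [ffun i => s.1 i + (s.2 i < m)].

(** The vertices 0, ..., d of [s] span a d-simplex of the face where the coordinates from d on
    vanish. Requiring the steps from d on to be in standard order makes [s] the only code of this
    d-simplex. *)
Definition kface (d : nat) (s : simp) :=
  [forall i : 'I_D.+1, (d <= i) ==> (s.1 i == 0 :> nat) && (s.2 i == i)].

Lemma kfaceP d (s : simp) : reflect (forall i : 'I_D.+1, d <= i -> s.1 i = 0 :> nat /\ s.2 i = i) (kface d s).
Proof.
apply: (iffP forallP) => h i; first by have /implyP h' := h i; move=> /h' /andP[/eqP ? /eqP].
by apply/implyP => /h[-> ->]; rewrite !eqxx.
Qed.

Definition klab d s (m : 'I_d.+1) : 'I_d.+1 := inord (lab (kvert s m)).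

Lemma klab_val d (s : simp) (m : 'I_d.+1) : kface d s -> d <= D.+1 -> klab s m = lab (kvert s m) :> nat.
Proof.
move=> /kfaceP fs dD; rewrite inordK// ltnS.
have [dD'|dD'] := ltnP d D.+1; last by apply: leq_trans dD'.
have [b0 p0] := fs (Ordinal dD') (leqnn _).
by apply: (@lab0 _ (Ordinal dD')); rewrite ffunE b0 p0 /= ltnNge -ltnS ltn_ord.
Qed.

Definition kfull d s := full (@klab d s).
Definition kdoor d s m := door (@klab d s) m.

Lemma kvert_mid (s : simp) m l (i j : 'I_D.+1) : i = m.-1 :> nat -> j = m :> nat -> 0 < m -> l <> m ->
  kvert (s.1, (s.2 * tperm i j)%g) l = kvert s l.
Proof.
move=> im jm m0 lm; apply/ffunP => k; rewrite !ffunE /= permM; congr (_ + nat_of_bool _).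
by case: tpermP => [->|->|//]; rewrite im jm; apply/idP/idP; lia.
Qed.

(** Exchanging the steps m-1 and m moves only the vertex m, so the simplices with a door opposite to
    an intermediate vertex come in pairs. *)
Lemma even_mid (d : nat) (m : 'I_d.+1) : d <= D.+1 -> 0 < m < d ->
  ~~ odd #|[set s : simp | kface d s && kdoor s m]|.
Proof.
move=> dD /andP[m0 md].
have iD : m.-1 < D.+1 by lia.
have jD : m < D.+1 by lia.
pose i := Ordinal iD; pose j := Ordinal jD.
pose f (s : simp) : simp := (s.1, (s.2 * tperm i j)%g).
apply: (even_involution (s := f)) => [s|s|s].
- rewrite !inE => /andP[/kfaceP fs ds].
  have ff : kface d (f s).
    apply/kfaceP => k dk; have [-> pk] := fs k dk; split=> //=.
    by rewrite permM pk tpermD// -val_eqE /=; lia.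
  rewrite ff /=; apply/doorP => c /(doorP _ _ ds)[l lm e]; exists l => //.
  rewrite -e /klab (@kvert_mid s m)//.
  by move=> e'; case/eqP: lm; apply: val_inj.
- by case: s => b p; rewrite /f /= -mulgA tperm2 mulg1.
- move=> e; have /(congr1 (mulg s.2^-1)) : (s.2 * tperm i j = s.2)%g by case: (s) e => b p [].
  rewrite mulKg mulVg => /permP/(_ i); rewrite tpermL perm1 => /(congr1 val) /=; lia.
Qed.

Section Cycle.
Variable d : 'I_D.+1.

Definition cyc_fun (j : 'I_D.+1) : 'I_D.+1 :=
  if j == 0 :> nat then d else if j <= d then inord j.-1 else j.

Lemma cyc_fun_val j : cyc_fun j = (if j == 0 :> nat then val d else if j <= d then j.-1 else j) :> nat.
Proof.
rewrite /cyc_fun; case: eqP => // j0; case: leqP => // jd.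
by rewrite inordK//; have := ltn_ord j; lia.
Qed.

Lemma cyc_inj : injective cyc_fun.
Proof.
move=> j j' /(congr1 val); rewrite /= !cyc_fun_val => e; apply/ord_inj.
by move: e; do 2 case: eqP => ? /=; do ?case: leqP => ?; lia.
Qed.

Definition cyc := perm cyc_inj.

Lemma cyc_val j : cyc j = (if j == 0 :> nat then val d else if j <= d then j.-1 else j) :> nat.
Proof. by rewrite permE cyc_fun_val. Qed.

(** The neighbour across the facet opposite to the vertex 0: the first step is absorbed into the
    corner and repeated as the last one, of index d, so that the vertex l+1 becomes the vertex l. *)
Definition kshift (s : simp) : simp :=
  ([ffun i => if s.2 i == 0 :> nat then inord (s.1 i).+1 else s.1 i], (s.2 * cyc)%g).

Definition kback (s : simp) : simp :=
  ([ffun i => if s.2 i == d then inord (s.1 i).-1 else s.1 i], (s.2 * cyc^-1)%g).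

Lemma cyc_d j : (cyc j == d) = (j == 0 :> nat).
Proof.
by rewrite -val_eqE /= cyc_val; have [//|j0] := eqVneq (nat_of_ord j) 0; rewrite ?eqxx//; case: leqP => ?; apply/eqP; lia.
Qed.

Lemma kshiftK (s : simp) : (forall i, s.2 i = 0 :> nat -> s.1 i < N) -> kback (kshift s) = s.
Proof.
case: s => b p /= h; rewrite /kback /kshift /= -mulgA mulgV mulg1; congr (_, _).
apply/ffunP => i; rewrite !ffunE permM cyc_d; case: eqP => // /h bi.
by apply: val_inj; rewrite /= inordK inordK//=; lia.
Qed.

Lemma kbackK (s : simp) : (forall i, s.2 i = d -> 0 < s.1 i) -> kshift (kback s) = s.
Proof.
case: s => b p /= h; rewrite /kback /kshift /= -mulgA mulVg mulg1; congr (_, _).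
apply/ffunP => i; rewrite !ffunE permM -cyc_d permKV; case: eqP => // /h bi.
have bN := ltn_ord (b i).
by apply: val_inj; rewrite /= inordK inordK//=; lia.
Qed.

Lemma kshift_vert (s : simp) l : (forall i, s.2 i = 0 :> nat -> s.1 i < N) -> l <= d ->
  kvert (kshift s) l = kvert s l.+1.
Proof.
case: s => b p /= h ld; apply/ffunP => i; rewrite !ffunE /= permM cyc_val.
have [p0|p0] := eqVneq (nat_of_ord (p i)) 0.
  by rewrite p0 /= inordK ?ltnS ?h// addn1 [d < l]ltnNge ld addn0.
by rewrite ?(negbTE p0); congr (_ + nat_of_bool _); have [?|?] := leqP (p i) d; apply/idP/idP; lia.
Qed.

End Cycle.

Section Step.
Variable d : 'I_D.+1.
Let dS := d.+1.

Lemma kface_fix (s : simp) (i : 'I_D.+1) : kface d.+1 s -> s.2 i <= d -> i <= d.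
Proof.
move=> /kfaceP fs pi; rewrite leqNgt; apply/negP => di; have [_ e] := fs i di.
by rewrite e in pi; lia.
Qed.

Lemma door_label s (m : 'I_d.+2) (c : nat) : kface d.+1 s -> kdoor s m -> c <= d ->
  exists2 l : 'I_d.+2, l != m & lab (kvert s l) = c.
Proof.
move=> fs /doorP ds cd.
have [|l lm e] := ds (inord c).
  by rewrite -val_eqE /= inordK; lia.
exists l => //; rewrite -(klab_val _ fs)// e inordK//; lia.
Qed.

Lemma door_first (s : simp) : kface d.+1 s -> kdoor s (ord0 : 'I_d.+2) ->
  forall i, s.2 i = 0 :> nat -> s.1 i < N.
Proof.
move=> fs ds i pi; have id : i <= d by apply: (kface_fix fs); rewrite pi.
have [l l0 e] := door_label fs ds id.
rewrite ltn_neqAle -ltnS ltn_ord andbT; apply/eqP => bN.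
apply: (@labN (kvert s l) i) e; rewrite ffunE bN pi.
have -> : 0 < l by rewrite lt0n; apply: contraNneq l0 => l0; apply/eqP/ord_inj.
by rewrite addn1.
Qed.

(** Let i be the coordinate of the last step. If it starts at 0, it vanishes on the whole facet,
    whose labels are then at most i; as the label d occurs, i = d and the facet lies in the next
    smaller face. Otherwise there is a neighbour behind the facet. *)
Lemma door_last (s : simp) : kface d.+1 s -> kdoor s (ord_max : 'I_d.+2) ->
  (forall i, s.2 i = d -> 0 < s.1 i) \/ kface d s.
Proof.
move=> fs ds; pose i := (s.2^-1)%g d.
have pid : s.2 i = d by rewrite permKV.
have id : i <= d by apply: (kface_fix fs); rewrite pid.
have [b0|b0] := posnP (s.1 i); last first.
  left=> i' e; suff -> : i' = i by [].
  by apply: (@perm_inj _ s.2); rewrite e pid.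
right; have [l lm e] := door_label fs ds (leqnn d).
have ld : l <= d by have := ltn_ord l; move: lm; rewrite -val_eqE /=; lia.
have : lab (kvert s l) <= i by apply: lab0; rewrite ffunE b0 pid ltnNge ld.
rewrite e => di; have ei : i = d by apply: val_inj => /=; lia.
rewrite ei in pid b0.
apply/kfaceP => k; rewrite leq_eqVlt => /predU1P[dk|dk].
  have -> : k = d by apply: val_inj.
  by rewrite b0 pid.
by have /kfaceP := fs; apply.
Qed.

Lemma kface_sub s : kface d s -> kface d.+1 s.
Proof. by move=> /kfaceP fs; apply/kfaceP => i di; apply: fs; apply: ltnW. Qed.

Lemma door_boundary s : kface d s -> kdoor s (ord_max : 'I_d.+2) = (kfull d s).
Proof.
move=> fs; have fs' := kface_sub fs.
apply/idP/fullP => [ds c|h].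
  have [|l lm e] := door_label fs' ds (_ : c <= d); first by rewrite -ltnS ltn_ord.
  have ld : l < d.+1 by have := ltn_ord l; move: lm; rewrite -val_eqE /=; lia.
  exists (Ordinal ld); apply: val_inj; rewrite /= klab_val//= ?e//; exact: ltnW.
apply/doorP => c cm.
have cd : c < d.+1 by have := ltn_ord c; move: cm; rewrite -val_eqE /=; lia.
have [l e] := h (Ordinal cd); have ld := ltn_ord l.
exists (inord l); first by rewrite -val_eqE /= inordK; lia.
apply: val_inj; rewrite /= klab_val// inordK; last by lia.
by rewrite -(klab_val _ fs) ?e//; apply: ltnW.
Qed.

Let P m := [set s : simp | kface d.+1 s && kdoor s (m : 'I_d.+2)].
Let Q := [set s : simp | kface d s && kfull d s].

Lemma kshift_door (s : simp) : kface d.+1 s -> (forall i, s.2 i = 0 :> nat -> s.1 i < N) ->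
  kface d.+1 (kshift d s) /\ kdoor (kshift d s) (ord_max : 'I_d.+2) = kdoor s (ord0 : 'I_d.+2).
Proof.
move=> fs h.
have fs' : kface d.+1 (kshift d s).
  apply/kfaceP => i di; have /kfaceP/(_ _ di)[b0 pi] := fs.
  have i0 : (nat_of_ord i == 0) = false by apply/eqP; lia.
  split; first by rewrite /= ffunE pi i0.
  apply: val_inj => /=; rewrite permM cyc_val pi i0; case: leqP => //; lia.
split=> //; apply/doorP/doorP => hd c cm.
  have [l lm e] := hd c cm.
  have ld : l < d.+1 by have := ltn_ord l; move: lm; rewrite -val_eqE /=; lia.
  exists (lift ord0 (Ordinal ld)) => //; rewrite -e /klab kshift_vert//.
have [l l0 e] := hd c cm; case: (unliftP ord0 l) l0 e => [l' ->|->] // _ e.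
have ld := ltn_ord l'.
exists (widen_ord (leqnSn _) l'); first by apply/eqP => /(congr1 val) /= el; move: ld; rewrite el ltnn.
by rewrite -e /klab /= kshift_vert//; lia.
Qed.

(** [kshift] matches the doors opposite to the vertex 0 with those doors opposite to the last vertex
    that have a simplex behind them; the remaining ones are the full simplices of the smaller
    face. *)
Lemma card_ends : #|P ord_max| = #|P ord0| + #|Q|.
Proof.
have QP : Q \subset P ord_max.
  apply/subsetP => s; rewrite !inE => /andP[fs qs].
  by rewrite kface_sub//= door_boundary.
rewrite -(cardsID Q (P ord_max)) (setIidPr QP) addnC; congr (_ + _).
have nQ s : s \in P ord_max :\: Q -> forall i, s.2 i = d -> 0 < s.1 i.
  rewrite !inE => /and3P[nq fs ds]; have [//|fd] := door_last fs ds.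
  by rewrite fd -door_boundary// ds in nq.
have img : [set kshift d s | s in P ord0] = P ord_max :\: Q.
  apply/setP => s; apply/imsetP/idP => [[s']|sPQ].
    rewrite inE => /andP[fs ds] ->; have h := door_first fs ds.
    have [fs' ds'] := kshift_door fs h.
    rewrite in_setD; apply/andP; split; last by rewrite inE fs' ds' ds.
    rewrite inE; apply/negP => /andP[fd _]; have [b0 pd] := kfaceP _ _ fd d (leqnn d).
    have p0 : s'.2 d = 0 :> nat by apply/eqP; rewrite -(cyc_d d) -[X in X == _]permM pd.
    by move: b0; rewrite /= ffunE p0 eqxx inordK// ltnS h.
  have bk := kbackK (nQ s sPQ); exists (kback d s) => //.
  have sP : s \in P ord_max by move: sPQ; rewrite inE => /andP[].
  move: sP; rewrite !inE => /andP[fs ds].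
  have fb : kface d.+1 (kback d s).
    apply/kfaceP => i di; have /kfaceP/(_ _ di)[b0 pi] := fs.
    have i0 : (i == d) = false by apply/negP => /eqP e; rewrite e in di; lia.
    split; first by rewrite /= ffunE pi i0.
    rewrite /= permM pi; apply: (@perm_inj _ (cyc d)); rewrite permKV.
    apply: val_inj => /=; rewrite cyc_val; case: eqP => [|_]; first lia.
    by case: leqP => //; lia.
  have h i : (kback d s).2 i = 0 :> nat -> (kback d s).1 i < N.
    move=> /eqP; rewrite -(cyc_d d) /= permM permKV ffunE => e; rewrite e.
    have := nQ s sPQ i (eqP e); have := ltn_ord (s.1 i) => b1 b2.
    have lt : (s.1 i).-1 < N by rewrite -ltnS prednK.
    by rewrite inordK// ltnS ltnW.
  have [_ <-] := kshift_door fb h; by rewrite bk fb ds.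
rewrite -img card_in_imset// => s s'; rewrite !inE => /andP[fs ds] /andP[fs' ds'] e.
by rewrite -(kshiftK d (door_first fs ds)) e (kshiftK d (door_first fs' ds')).
Qed.

(** Doors are counted twice: simplex by simplex their parity is the number of full simplices; vertex
    by vertex, the intermediate vertices contribute evenly and the two ends cancel up to [Q]. *)
Lemma odd_step : odd #|[set s : simp | kface d.+1 s && kfull d.+1 s]| = odd #|Q|.
Proof.
have dD : d.+1 <= D.+1 by [].
have -> : odd #|[set s : simp | kface d.+1 s && kfull d.+1 s]| =
    odd (\sum_(s | kface d.+1 s) #|[set m | kdoor s (m : 'I_d.+2)]|).
  rewrite -sum1_card big_mkcond /= [in RHS]big_mkcond /=.
  apply: (big_ind2 (fun a b => odd a = odd b)) => // [a b a' b'|s _].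
    by rewrite !oddD => -> ->.
  by rewrite inE; case: (kface _ s) => //=; rewrite odd_doors; rewrite /kfull; case: full.
have -> : \sum_(s | kface d.+1 s) #|[set m | kdoor s (m : 'I_d.+2)]| = \sum_m #|P m|.
  under eq_bigr => s _ do rewrite -sum1dep_card big_mkcond.
  rewrite exchange_big /=; apply: eq_bigr => m _; rewrite -sum1dep_card.
  by rewrite -big_mkcondr.
rewrite big_ord_recl big_ord_recr /=.
have -> : lift ord0 (@ord_max d) = ord_max by apply: val_inj.
rewrite card_ends !oddD.
suff -> : odd (\sum_(i < d) #|P (lift ord0 (widen_ord (leqnSn d) i))|) = false by case: (odd #|P _|); case: (odd _).
apply: (big_ind (fun a => odd a = false)) => // [a b|i _]; first by rewrite oddD => -> ->.
by apply/negbTE/even_mid => //=; rewrite /bump /= add1n; have := ltn_ord i; lia.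
Qed.

End Step.

Lemma odd_full d : d <= D.+1 -> odd #|[set s : simp | kface d s && kfull d s]|.
Proof.
elim: d => [_|d IH dD]; last by rewrite (odd_step (Ordinal dD)) IH// ltnW.
suff -> : [set s : simp | kface 0 s && kfull 0 s] = [set ([ffun=> ord0], 1%g)] by rewrite cards1.
apply/setP => s; rewrite !inE; apply/andP/eqP => [[/kfaceP fs _]|->].
  case: s fs => b p fs; congr (_, _); first by apply/ffunP => i; rewrite ffunE; apply: val_inj; have [] := fs i isT.
  by apply/permP => i; rewrite perm1; have [] := fs i isT.
split; first by apply/kfaceP => i _; rewrite /= ffunE perm1.
by apply/fullP => c; exists c; rewrite !ord1.
Qed.

Lemma sperner : exists s : simp, forall c, c <= D.+1 ->
  exists2 l : nat, l <= D.+1 & lab (kvert s l) = c.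
Proof.
have := odd_full (leqnn _); set A := [set s : simp | _] => oA.
have /card_gt0P[s] : 0 < #|A| by case: #|A| oA.
rewrite inE => /andP[fs /fullP h]; exists s => c cD.
have [l e] := h (inord c); exists l; first by rewrite -ltnS ltn_ord.
by rewrite -(klab_val l fs)// e inordK.
Qed.

End Sperner.

End Combinatorics.

Import Order.TTheory GRing.Theory Num.Theory.
Local Open Scope ring_scope.

(** * Polyhedral cones and homogeneous piecewise linear maps *)

Section PolyhedralCones.
Variable R : realFieldType.

Definition ev a (x : 'rV[R]_a) (h : 'cV[R]_a) : R := (x *m h) 0 0.

Lemma ev0l a (h : 'cV[R]_a) : ev 0 h = 0.
Proof. by rewrite /ev mul0mx mxE. Qed.

Lemma ev0r a (x : 'rV[R]_a) : ev x 0 = 0.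
Proof. by rewrite /ev mulmx0 mxE. Qed.

Lemma evD a (x y : 'rV[R]_a) h : ev (x + y) h = ev x h + ev y h.
Proof. by rewrite /ev mulmxDl mxE. Qed.

Lemma evZ a c (x : 'rV[R]_a) h : ev (c *: x) h = c * ev x h.
Proof. by rewrite /ev -scalemxAl mxE. Qed.

Lemma evN a (x : 'rV[R]_a) h : ev (- x) h = - ev x h.
Proof. by rewrite -scaleN1r evZ mulN1r. Qed.

Lemma evB a (x y : 'rV[R]_a) h : ev (x - y) h = ev x h - ev y h.
Proof. by rewrite evD evN. Qed.

Lemma evDr a (x : 'rV[R]_a) h k : ev x (h + k) = ev x h + ev x k.
Proof. by rewrite /ev mulmxDr mxE. Qed.

Lemma evZr a c (x : 'rV[R]_a) h : ev x (c *: h) = c * ev x h.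
Proof. by rewrite /ev -scalemxAr mxE. Qed.

Lemma evNr a (x : 'rV[R]_a) h : ev x (- h) = - ev x h.
Proof. by rewrite -scaleN1r evZr mulN1r. Qed.

Lemma evBr a (x : 'rV[R]_a) h k : ev x (h - k) = ev x h - ev x k.
Proof. by rewrite evDr evNr. Qed.

Lemma ev_sum a (I : Type) (r : seq I) (P : pred I) (F : I -> 'rV[R]_a) h :
  ev (\sum_(i <- r | P i) F i) h = \sum_(i <- r | P i) ev (F i) h.
Proof. by rewrite /ev mulmx_suml summxE. Qed.

Lemma ev_coord a (x : 'rV[R]_a) j : ev x (delta_mx j 0) = x 0 j.
Proof.
rewrite /ev mxE (bigD1 j)//= mxE !eqxx mulr1 big1 ?addr0// => i ij.
by rewrite mxE (negbTE ij) mulr0.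
Qed.

Lemma ev_mul a b (x : 'rV[R]_a) (M : 'M[R]_(a, b)) h :
  ev (x *m M) h = ev x (M *m h).
Proof. by rewrite /ev mulmxA. Qed.

Fixpoint gcone a (G : seq 'rV[R]_a) (x : 'rV[R]_a) : Prop :=
  if G is g :: G' then exists2 m : R, 0 <= m & gcone G' (x - m *: g)
  else x = 0.

Lemma gconeP a (G : seq 'rV[R]_a) x : gcone G x <->
  exists l : 'I_(size G) -> R,
    (forall i, 0 <= l i) /\ x = \sum_i l i *: G`_i.
Proof.
elim: G x => [|g G IH] x /=.
  split=> [->|[l [_ ->]]]; last by rewrite big_ord0.
  by exists (fun=> 0); split=> //; rewrite big_ord0.
split=> [[m m0 /IH[l [l0 e]]]|[l [l0 e]]].
  exists (fun i => if unlift ord0 i is Some j then l j else m); split.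
    by move=> i; case: unliftP => [j|] _ //.
  rewrite big_ord_recl unlift_none /=.
  under eq_bigr do rewrite liftK.
  by rewrite -e addrC subrK.
exists (l ord0) => //; apply/IH; exists (fun j => l (lift ord0 j)); split=> //.
by rewrite e big_ord_recl /= addrAC subrr add0r.
Qed.

(* Fourier-Motzkin elimination of the coefficient of one generator. *)
Lemma gcone_halfspaces a (G : seq 'rV[R]_a) :
  exists (I : finType) (h : I -> 'cV[R]_a),
    forall x, gcone G x <-> forall i, 0 <= ev x (h i).
Proof.
elim: G => [|g G [I [h IH]]] /=.
  exists (bool * 'I_a)%type,
    (fun i => if i.1 then delta_mx i.2 0 else - delta_mx i.2 0) => x.
  split=> [-> i|h]; first by rewrite ev0l.
  apply/rowP => j; apply/le_anti; rewrite mxE.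
  have := h (true, j); have := h (false, j); rewrite /= evNr ev_coord.
  by rewrite oppr_ge0 => -> ->.
exists (I + I * I)%type, (fun k => match k with
  | inl i => if 0 <= ev g (h i) then h i else 0
  | inr (i, j) => if (ev g (h i) < 0) && (0 < ev g (h j)) then
      ev g (h j) *: h i - ev g (h i) *: h j else 0 end) => x; split.
  case=> m m0 /IH hx [i|[i j]].
    case: ifP => gi; last by rewrite ev0r.
    by have := hx i; rewrite evB evZ subr_ge0; apply: le_trans; rewrite mulr_ge0.
  case: ifP => [/andP[gi gj]|_]; last by rewrite ev0r.
  rewrite evBr !evZr.
  have := hx i; have := hx j; rewrite !evB !evZ => xj xi.
  by nra.
move=> hx.
(* The least multiple of [g] whose removal repairs all inequalities negative on [g]. The mixed
   inequalities say that it does not exceed the bounds set by those positive on [g]. *)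
pose m := \big[Num.max/0]_(i | ev g (h i) < 0) (ev x (h i) / ev g (h i)).
have m0 : 0 <= m by apply: bigmax_ge_id.
exists m => //; apply/IH => i; rewrite evB evZ subr_ge0.
case: (ltgtP (ev g (h i)) 0) => gi.
- by rewrite -ler_ndivrMr//; apply: le_bigmax_cond.
- rewrite -ler_pdivlMr//; apply/bigmax_leP; split=> [|k gk].
    have := hx (inl i); rewrite (ltW gi) => xi.
    by apply: divr_ge0 => //; apply: ltW.
  have := hx (inr (k, i)); rewrite gk gi /= evBr !evZr subr_ge0 => xki.
  rewrite ler_pdivlMr// mulrAC ler_ndivrMr// mulrC.
  by rewrite [leRHS]mulrC.
- by have := hx (inl i); rewrite gi lexx mulr0.
Qed.

Lemma row_factor k a b (P : 'M[R]_(k, a)) (F : 'M[R]_(k, b)) :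
  (forall l : 'rV_k, l *m P = 0 -> l *m F = 0) -> exists M, F = P *m M.
Proof.
move=> PF; exists (pinvmx P *m F).
apply/row_matrixP => i; rewrite mulmxA; apply/eqP; rewrite -subr_eq0.
rewrite -linearB /= -{1}[F]mul1mx -mulmxBl row_mul; apply/eqP/PF.
by rewrite -row_mul mulmxBl mul1mx mulmxKpV ?submx_refl// subrr row0.
Qed.

Lemma linear_extension a b (G : seq 'rV[R]_a) (f : 'I_(size G) -> 'rV[R]_b) :
  (forall l : 'I_(size G) -> R, \sum_i l i *: G`_i = 0 ->
     \sum_i l i *: f i = 0) ->
  exists M, forall i, f i = G`_i *m M.
Proof.
move=> h.
have [l|M hM] := @row_factor _ _ _ (\matrix_i G`_i) (\matrix_i f i).
  rewrite !mulmx_sum_row.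
  under eq_bigr do rewrite rowK.
  by move=> /h; under [X in _ -> X = _]eq_bigr do rewrite rowK.
by exists M => i; have /(congr1 (row i)) := hM; rewrite row_mul !rowK.
Qed.

(** [pos h x \subset pos h y] says that y satisfies all inequalities satisfied by x: it lies in the
    smallest cone cut out by members of [h] that contains x. *)
Definition pos a (I : finType) (h : I -> 'cV[R]_a) (x : 'rV[R]_a) : {set I} :=
  [set i | 0 <= ev x (h i)].

(* [A] is linear on each of the closed polyhedral cones
   [{y | pos h x \subset pos h y}], x in C, which make up [C]. *)
Definition hpl a b (C : 'rV[R]_a -> Prop) (A : 'rV[R]_a -> 'rV[R]_b) :=
  exists (I : finType) (h : I -> 'cV[R]_a) (M : {set I} -> 'M[R]_(a, b)),
  forall x y, C x -> pos h x \subset pos h y ->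
    C y /\ A y = y *m M (pos h x).

(** The description of the pieces by generators, which passes easily to inverse maps. The
    description by half-spaces in [hpl] is the one that passes to compositions and derivatives. *)
Definition vpl a b (C : 'rV[R]_a -> Prop) (A : 'rV[R]_a -> 'rV[R]_b) :=
  exists L : seq (seq 'rV[R]_a),
    (forall x, C x <-> exists2 G, G \in L & gcone G x) /\
    forall G, G \in L -> exists M : 'M[R]_(a, b),
      forall x, gcone G x -> A x = x *m M.

(** All half-spaces of all the generated cones form one arrangement, and the matrix is chosen from
    any generated cone whose inequalities all hold. The default 0 is never reached on [C]. *)
Lemma vpl_hpl a b C (A : 'rV[R]_a -> 'rV[R]_b) : vpl C A -> hpl C A.
Proof.
case=> L [CL AL].
pose I G : finType := sval (cid (@gcone_halfspaces a G)).
have hs G : {h : I G -> 'cV[R]_a |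
    forall x, gcone G x <-> forall i, 0 <= ev x (h i)}.
  exact: cid (svalP (cid (@gcone_halfspaces a G))).
pose h G := sval (hs G); have hI G := svalP (hs G).
have /choice[M hM] (k : 'I_(size L)) : exists M : 'M[R]_(a, b),
    forall x, gcone (nth [::] L k) x -> A x = x *m M.
  by apply: AL; apply: mem_nth.
pose Ik (k : 'I_(size L)) : finType := I (nth [::] L k).
pose hk (u : {k & Ik k}) := h (nth [::] L (tag u)) (tagged u).
pose good (P : {set {k & Ik k}}) k := [forall i : Ik k, Tagged Ik i \in P].
exists {k & Ik k}, hk, (fun P => if [pick k | good P k] is Some k then M k else 0).
move=> x y Cx xy; case: pickP => [k /forallP kx|ng].
  have yk : gcone (nth [::] L k) y.
    by apply/hI => i; have := subsetP xy _ (kx i); rewrite inE.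
  by split; [apply/CL; exists (nth [::] L k) => //; apply: mem_nth | apply: hM].
have [G GL xG] := (CL x).1 Cx.
have iG : (index G L < size L)%N by rewrite index_mem.
case/idP: (ng (Ordinal iG)); apply/forallP => i; rewrite inE /hk /=.
by move: i; rewrite /Ik /= nth_index// => i; apply/(hI G x).1.
Qed.

Lemma gcone_map a b (G : seq 'rV[R]_a) (M : 'M[R]_(a, b)) y :
  gcone [seq g *m M | g <- G] y <-> exists2 x, gcone G x & y = x *m M.
Proof.
elim: G y => [|g G IH] y /=.
  by split=> [->|[x -> ->]]; rewrite ?mul0mx//; exists 0; rewrite ?mul0mx.
split=> [[m m0 /IH[x xG e]]|[x [m m0 xG] ->]].
  exists (x + m *: g); first by exists m; rewrite ?addrK.
  by rewrite mulmxDl -e -scalemxAl subrK.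
exists m => //; apply/IH; exists (x - m *: g) => //.
by rewrite mulmxBl -scalemxAl.
Qed.

Lemma gcone_gen a (G : seq 'rV[R]_a) l : (forall i, 0 <= l i) ->
  gcone G (\sum_(i < size G) l i *: G`_i).
Proof. by move=> l0; apply/gconeP; exists l. Qed.

Lemma vpl_inv a b C C' (A : 'rV[R]_a -> 'rV[R]_b) B : vpl C A ->
  (forall x, C x -> C' (A x)) -> (forall y, C' y -> C (B y)) ->
  (forall x, C x -> B (A x) = x) -> (forall y, C' y -> A (B y) = y) ->
  vpl C' B.
Proof.
case=> L [CL AL] CA CB AK BK.
have /choice[M hM] (G : seq 'rV[R]_a) : exists M : 'M[R]_(a, b),
    G \in L -> forall x, gcone G x -> A x = x *m M.
  have [/AL[M hM]|] := boolP (G \in L); first by exists M.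
  by exists 0.
exists [seq [seq g *m M G | g <- G] | G <- L]; split=> [y|_ /mapP[G GL ->]].
  split=> [Cy|[_ /mapP[G GL ->] /gcone_map[x xG ->]]].
    have [G GL BG] := (CL _).1 (CB _ Cy).
    exists [seq g *m M G | g <- G]; first by apply: map_f.
    by apply/gcone_map; exists (B y); rewrite // -hM// BK.
  by rewrite -hM//; apply/CA/CL; exists G.
have [|N hN] := @linear_extension b a [seq g *m M G | g <- G]
    (fun i => G`_i).
  rewrite size_map => l e.
  (* A linear relation among the images of the generators, split by sign, is an equality of the
     images of two points of the cone; applying [B] makes it a relation among the generators
     themselves. *)
  pose u := \sum_i Num.max (l i) 0 *: G`_i.
  pose v := \sum_i Num.max (- l i) 0 *: G`_i.
  have uG : gcone G u by apply: gcone_gen => i; rewrite le_max lexx orbT.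
  have vG : gcone G v by apply: gcone_gen => i; rewrite le_max lexx orbT.
  have uv : u - v = \sum_i l i *: G`_i.
    rewrite -sumrB; apply: eq_bigr => i _; rewrite -scalerBl; congr (_ *: _).
    by rewrite !maxEle; case: ifP; case: ifP; lra.
  rewrite -uv; apply/eqP; rewrite subr_eq0; apply/eqP.
  have Cu : C u by apply/CL; exists G.
  have Cv : C v by apply/CL; exists G.
  rewrite -(AK _ Cu) -(AK _ Cv); congr (B _).
  rewrite !(hM G)//; apply/eqP; rewrite -subr_eq0 -mulmxBl uv mulmx_suml.
  apply/eqP; rewrite -[RHS]e; apply: eq_bigr => i _.
  by rewrite (nth_map 0)// scalemxAl.
exists N => y /gcone_map[x xG ->].
rewrite -hM// AK; last by apply/CL; exists G.
rewrite (hM G)//; case/gconeP: xG => l [_ ->].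
rewrite !mulmx_suml; apply: eq_bigr => i _.
have iG : (i < size [seq g *m M G | g <- G])%N by rewrite size_map.
by rewrite -!scalemxAl; have := hN (Ordinal iG); rewrite /= (nth_map 0)// => <-.
Qed.

(** The half-spaces of [B] are pulled back by each of the finitely many matrices of [A]; only those
    pulled back by the matrix in force at x are consulted. *)
Lemma hpl_comp a b c C C' (A : 'rV[R]_a -> 'rV[R]_b) (B : 'rV[R]_b -> 'rV[R]_c) :
  hpl C A -> hpl C' B -> (forall x, C x -> C' (A x)) -> hpl C (B \o A).
Proof.
case=> I [h [M hM]] [J [k [N hN]]] CC'.
pose H (u : I + {set I} * J) : 'cV[R]_a := match u with
  | inl i => h i | inr (P, j) => M P *m k j end.
exists (I + {set I} * J)%type, H,
  (fun Q : {set I + {set I} * J} => let P := [set i | inl i \in Q] in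
    M P *m N [set j | inr (P, j) \in Q]) => x y Cx xy /=.
have -> : [set i | inl i \in pos H x] = pos h x by apply/setP => i; rewrite !inE.
have xyh : pos h x \subset pos h y.
  by apply/subsetP => i; have := subsetP xy (inl i); rewrite !inE.
have [Cy Ay] := hM _ _ Cx xyh; have [_ Ax] := hM _ _ Cx (subxx _).
split=> //=.
have -> : [set j | inr (pos h x, j) \in pos H x] = pos k (A x).
  by apply/setP => j; rewrite !inE Ax ev_mul.
have [|_ ->] := hN (A x) (A y) (CC' _ Cx); last by rewrite Ay mulmxA.
apply/subsetP => j; have := subsetP xy (inr (pos h x, j)).
by rewrite !inE Ay Ax /= -!ev_mul.
Qed.

Lemma hpl_refine a b C (A : 'rV[R]_a -> 'rV[R]_b) (I : finType)
    (h : I -> 'cV[R]_a) M :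
  (forall x y, C x -> pos h x \subset pos h y ->
     C y /\ A y = y *m M (pos h x)) ->
  forall (J : finType) (k : J -> 'cV[R]_a) (f : I -> J),
  (forall i, k (f i) = h i) -> exists N,
  forall x y, C x -> pos k x \subset pos k y -> C y /\ A y = y *m N (pos k x).
Proof.
move=> hM J k f kf; exists (fun Q : {set J} => M (f @^-1: Q)) => x y Cx xy.
have fk z : f @^-1: pos k z = pos h z.
  by apply/setP => i; rewrite !inE kf.
by rewrite fk; apply: hM; rewrite // -!fk; apply: preimsetS.
Qed.

Definition tcone a (C : 'rV[R]_a -> Prop) p d :=
  exists2 t0 : R, 0 < t0 & forall t, 0 < t <= t0 -> C (p + t *: d).

Lemma finite_small (I : finType) (P : I -> R -> Prop) :
  (forall i, exists2 t0 : R, 0 < t0 & forall t, 0 < t <= t0 -> P i t) ->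
  exists2 t0 : R, 0 < t0 & forall t, 0 < t <= t0 -> forall i, P i t.
Proof.
move=> h; have /choice[s hs] i : exists s : R, 0 < s /\
    forall t, 0 < t <= s -> P i t by have [s] := h i; exists s.
exists (\big[Num.min/1]_i s i).
  by apply/bigmin_gtP; split=> [|i _]; rewrite ?ltr01//; case: (hs i).
move=> t /andP[t0 tm] i; apply: (hs i).2; rewrite t0 (le_trans tm)//.
exact: bigmin_le.
Qed.

(** With P the positivity set of d, this is the one of p + t d for small t > 0: d decides only where
    the form vanishes at p. *)
Definition posd a (I : finType) (h : I -> 'cV[R]_a) (p : 'rV[R]_a)
  (P : {set I}) : {set I} :=
  [set i | (0 < ev p (h i)) || (ev p (h i) == 0) && (i \in P)].

Lemma pos_small a (I : finType) (h : I -> 'cV[R]_a) p d :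
  exists2 t0 : R, 0 < t0 & forall t, 0 < t <= t0 ->
    pos h (p + t *: d) = posd h p (pos h d).
Proof.
have [|t0 t00 ht] := @finite_small I (fun i t =>
   (i \in pos h (p + t *: d)) = (i \in posd h p (pos h d))); last first.
  by exists t0 => // t /ht e; apply/setP.
move=> i; set u := ev p (h i); set v := ev d (h i).
have e t : (i \in pos h (p + t *: d)) = (0 <= u + t * v).
  by rewrite inE evD evZ.
have -> : (i \in posd h p (pos h d)) = (0 < u) || (u == 0) && (0 <= v).
  by rewrite !inE.
have [u0|u0|u0] := ltgtP u 0.
- exists (- u / (2 * (1 + `|v|))); first by rewrite divr_gt0 ?mulr_gt0//; have := normr_ge0 v; lra.
  move=> t /andP[t0]; rewrite e ler_pdivlMr; last by have := normr_ge0 v; lra.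
  move=> tu; apply/negbTE; rewrite -ltNge.
  have : t * v <= t * `|v| by rewrite ler_pM2l// ler_norm.
  by nra.
- exists (u / (2 * (1 + `|v|))); first by rewrite divr_gt0 ?mulr_gt0//; have := normr_ge0 v; lra.
  move=> t /andP[t0]; rewrite e ler_pdivlMr; last by have := normr_ge0 v; lra.
  move=> tu; apply/idP.
  have : - (t * `|v|) <= t * v by rewrite -mulrN ler_pM2l// lerNl ler_normr lexx orbT.
  by move=> ? /=; nra.
- by exists 1 => // t /andP[t0 _]; rewrite e u0 add0r pmulr_rge0.
Qed.

(** The piece containing p + t d for small t is the same for all such t and also contains p. So [A]
    is given by one matrix on the whole segment, and [D] applies this matrix to d. *)
Lemma hpl_tangent a b C (A : 'rV[R]_a -> 'rV[R]_b) p : hpl C A -> C p ->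
  exists D, hpl (tcone C p) D /\
    forall d, tcone C p d -> exists2 t0 : R, 0 < t0 &
      forall t, 0 < t <= t0 -> A (p + t *: d) = A p + t *: D d.
Proof.
case=> I [h [M hM]] Cp.
exists (fun d => d *m M (posd h p (pos h d))); split.
  exists I, h, (fun P => M (posd h p P)) => d d' [s s0 sC] dd'.
  have [t t0 ht] := pos_small h p d; have [t' t0' ht'] := pos_small h p d'.
  have ss : posd h p (pos h d) \subset posd h p (pos h d').
    apply/subsetP => i; rewrite !(inE, in_set) => /orP[->//|/andP[-> /=]].
    by have := subsetP dd' i; rewrite !inE => dd /dd ->; rewrite orbT.
  have AP x : 0 < x <= Num.min s t ->
      A p = p *m M (posd h p (pos h d)) /\ forall e,
      posd h p (pos h d) \subset pos h e ->
      C e /\ A e = e *m M (posd h p (pos h d)).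
    rewrite !le_min => /and3P[x0 xs xt].
    rewrite -(ht x) ?x0//; split; last by move=> e; apply: hM; apply: sC; rewrite x0.
    apply: (hM (p + x *: d) p _ _).2; first by apply: sC; rewrite x0.
    rewrite ht ?x0//; apply/subsetP => i; rewrite !inE => /orP[/ltW//|].
    by move=> /andP[/eqP-> _].
  pose m := Num.min (Num.min s t) t'.
  have m0 : 0 < m by rewrite !lt_min s0 t0.
  have [Ap Ae] : A p = p *m M (posd h p (pos h d)) /\ forall e,
      posd h p (pos h d) \subset pos h e ->
      C e /\ A e = e *m M (posd h p (pos h d)).
    by apply: (AP m); rewrite m0 /m ge_min lexx.
  have Cm x : 0 < x <= m -> C (p + x *: d') /\
      A (p + x *: d') = (p + x *: d') *m M (posd h p (pos h d)).
    rewrite !le_min => /andP[x0 /andP[_ xt']].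
    by apply: Ae; rewrite ht' ?x0.
  split; first by exists m => // x /Cm[].
  have [|C1 A1] := Cm m; first by rewrite m0 lexx.
  have Pm : pos h (p + m *: d') = posd h p (pos h d').
    by apply: ht'; rewrite m0 /m ge_min lexx orbT.
  have [_ A2] := hM _ _ C1 (subxx _).
  have [|_ A3] := hM (p + m *: d') p C1.
    rewrite Pm; apply/subsetP => i; rewrite !inE => /orP[/ltW//|].
    by move=> /andP[/eqP-> _].
  (* The matrices belonging to d and to d' agree at p and at p + m d', hence at d'. *)
  move: A2; rewrite A1 Pm !mulmxDl -{1}Pm -A3 Ap => /addrI.
  rewrite -!scalemxAl => /(congr1 (fun v => m^-1 *: v)).
  by rewrite !scalerA mulVf ?gt_eqF// !scale1r.
move=> d [s s0 sC]; have [t t0 ht] := pos_small h p d.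
exists (Num.min s t); first by rewrite lt_min s0.
move=> x; rewrite le_min => /and3P[x0 xs xt].
have Cx : C (p + x *: d) by apply: sC; rewrite x0.
have Px := ht x; rewrite x0 xt in Px; rewrite -(Px isT).
have [_ ->] := hM _ _ Cx (subxx _).
have [|_ ->] := hM _ p Cx; last by rewrite mulmxDl scalemxAl.
rewrite (Px isT); apply/subsetP => i; rewrite !inE => /orP[/ltW//|].
by move=> /andP[/eqP-> _].
Qed.

End PolyhedralCones.

(** * Decomposition of points along chains of cells of a central arrangement *)

Section Flags.
Variables (R : realFieldType) (a : nat) (I : finType) (h : I -> 'cV[R]_a).
Variable C : 'rV[R]_a -> Prop.
(** Symmetry turns [pos h x] into a full sign vector, which grows as more forms vanish: inclusion
    becomes the closure order on open cells, with the origin as the largest element by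
    [h_pointed]. *)
Hypothesis h_sym : forall i, exists j, h j = - h i.
Hypothesis h_pointed : forall x, (forall i, ev x (h i) = 0) -> x = 0.
Hypothesis C_closed : forall x y, C x -> pos h x \subset pos h y -> C y.
Variable r : {set I} -> 'rV[R]_a.
Hypothesis r_pos : forall x, C x -> x != 0 -> pos h (r (pos h x)) = pos h x.

Lemma posP x i : (i \in pos h x) = (0 <= ev x (h i)).
Proof. by rewrite inE. Qed.

Lemma pos_full x : pos h x = [set: I] -> x = 0.
Proof.
move=> x0; apply: h_pointed => i; apply/le_anti.
have [j hj] := h_sym i.
have := in_setT j; have := in_setT i; rewrite -x0 !posP hj evNr => -> /=.
by rewrite oppr_ge0 => ->.
Qed.

Lemma pos0 : pos h 0 = [set: I].
Proof. by apply/setP => i; rewrite posP ev0l lexx inE. Qed.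

Lemma posD (P : {set I}) x y : P \subset pos h x -> P \subset pos h y ->
  P \subset pos h (x + y).
Proof.
move=> /subsetP Px /subsetP Py; apply/subsetP => i iP.
by have := Px i iP; have := Py i iP; rewrite !posP evD => *; rewrite addr_ge0.
Qed.

Lemma posZ (P : {set I}) c x : 0 <= c -> P \subset pos h x -> P \subset pos h (c *: x).
Proof.
move=> c0 /subsetP Px; apply/subsetP => i iP.
by have := Px i iP; rewrite !posP evZ => *; rewrite mulr_ge0.
Qed.

Lemma pos_sum (P : {set I}) (J : Type) (s : seq J) (Q : pred J) (F : J -> 'rV[R]_a) :
  (forall j, Q j -> P \subset pos h (F j)) ->
  P \subset pos h (\sum_(j <- s | Q j) F j).
Proof.
move=> PF; apply: (big_ind (fun x => P \subset pos h x)) => //.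
  by rewrite pos0 subsetT.
exact: posD.
Qed.

Lemma pos_opp x y i : i \notin pos h x -> pos h x \subset pos h y ->
  ev y (h i) <= 0.
Proof.
have [j hj] := h_sym i; rewrite posP -ltNge => xi /subsetP/(_ j).
by rewrite !posP hj !evNr !oppr_ge0; apply; apply: ltW.
Qed.

Lemma pos_scale c x : 0 < c -> pos h (c *: x) = pos h x.
Proof. by move=> c0; apply/setP => i; rewrite !posP evZ pmulr_rge0. Qed.

Definition valid (P : {set I}) := [/\ C (r P), r P != 0 & pos h (r P) = P].

(** The rays [r P], one in each open cell, span simplicial cones over chains of cells: a derived
    subdivision of the arrangement. [l] holds the coordinates of x in such a cone. *)
Definition isdec x (l : {set I} -> R) :=
  [/\ forall P, 0 <= l P, forall P, l P != 0 -> valid P,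
      forall P Q, l P != 0 -> l Q != 0 -> (P \subset Q) || (Q \subset P) &
      x = \sum_P l P *: r P].

Definition drop (l : {set I} -> R) P Q := if Q == P then 0 else l Q.

Lemma validP x : C x -> x != 0 -> valid (pos h x).
Proof.
move=> Cx x0; split; last exact: r_pos.
  by apply: (C_closed Cx); rewrite r_pos.
have := r_pos Cx x0; apply: contra_eqN => /eqP->; rewrite pos0.
by apply: contraNneq x0 => /esym /pos_full->.
Qed.

(** The largest multiple of the ray of the cell of x that keeps x in the closed cell is subtracted.
    The remainder lies on the boundary, where more forms vanish, and induction applies to it. *)
Lemma isdec_ex x : C x -> exists l, isdec x l /\
  forall P, l P != 0 -> pos h x \subset P.
Proof.
have [k] := ubnP #|~: pos h x|; elim: k => // k IH in x * => xk Cx.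
have [->|x0] := eqVneq x 0.
  exists (fun=> 0); split; last by move=> P; rewrite eqxx.
  split=> [P|P|P Q|]; rewrite ?eqxx//.
  by rewrite big1// => P _; rewrite scale0r.
set P := pos h x; have [Cr r0 rP] := validP Cx x0; rewrite -/P in Cr r0 rP.
have [i1 i1P] : exists i1, i1 \in ~: P.
  apply/existsP; apply: contraNT x0; rewrite negb_exists => /forallP xP.
  apply/eqP/pos_full/setP => i; rewrite inE; have := xP i.
  by rewrite !inE negbK.
have nP i : i \in ~: P -> ev x (h i) < 0 /\ ev (r P) (h i) < 0.
  by rewrite inE => iP; split; rewrite ltNge; rewrite -posP ?rP.
have [i0 i0P i0min] := arg_minP (fun i => ev x (h i) / ev (r P) (h i)) i1P.
set m := ev x (h i0) / ev (r P) (h i0) in i0min.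
have m0 : 0 < m by have [? ?] := nP _ i0P; rewrite /m -mulrNN -invrN divr_gt0 ?oppr_gt0.
have m_le i : i \in ~: P -> ev x (h i) <= m * ev (r P) (h i).
  by move=> iP; rewrite -ler_ndivlMr ?(nP _ iP).2//; apply: i0min.
pose y := x - m *: r P.
have yE i : ev y (h i) = ev x (h i) - m * ev (r P) (h i) by rewrite evB evZ.
have Py : P \subset pos h y.
  apply/subsetP => i iP; rewrite posP yE.
  have [j hj] := h_sym i; have [jP|jP] := boolP (j \in P).
    have ev0 z : pos h z = P -> ev z (h i) = 0.
      move=> zP; apply/le_anti; move: iP jP.
      by rewrite -zP !posP hj evNr oppr_ge0 => -> ->.
    by rewrite !ev0// mulr0 subrr.
  have := m_le j; rewrite inE => /(_ jP); rewrite hj !evNr mulrN.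
  by rewrite lerN2 subr_ge0.
have i0y : i0 \in pos h y.
  by rewrite posP yE /m divfK ?subrr ?lexx// lt_eqF// (nP _ i0P).2.
have PyS : P \proper pos h y.
  rewrite properE Py; apply/subsetPn; exists i0 => //.
  by rewrite -in_setC.
have Cy : C y by apply: (C_closed Cx).
have [|l [[l0 lv lc ly] lP]] := IH y _ Cy.
  rewrite -ltnS; apply: leq_trans xk; rewrite ltnS; apply: proper_card.
  by rewrite properC.
have lP0 : l P = 0.
  by apply/eqP; apply: contraTT PyS => /lP yP; rewrite properE yP andbF.
exists (fun Q => if Q == P then m else l Q); split; [split|].
- by move=> Q; case: eqP => // _; apply: ltW.
- by move=> Q; case: (Q =P P) => [->|_ /lv].
- move=> Q S; case: (Q =P P) => [->|_]; case: (S =P P) => [->|_]; rewrite ?subxx//.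
  + by move=> _ /lP yS; rewrite (subset_trans Py yS).
  + by move=> /lP yS _; rewrite (subset_trans Py yS) orbT.
  + exact: lc.
- rewrite (bigD1 P)//= eqxx -[LHS](subrK (m *: r P)) addrC -/y; congr (_ + _).
  rewrite ly [LHS](bigD1 P)//= lP0 scale0r add0r.
  by apply: eq_bigr => Q /negbTE->.
- by move=> Q; case: (Q =P P) => [->//|_ /lP]; apply: subset_trans.
Qed.

Lemma isdec_drop x l P : isdec x l -> isdec (x - l P *: r P) (drop l P).
Proof.
rewrite /drop => -[l0 lv lc ->]; split.
- by move=> Q; case: eqP.
- by move=> Q; case: (Q =P P) => [|_ /lv//]; rewrite eqxx.
- by move=> Q S; case: (Q =P P); case: (S =P P); rewrite ?eqxx// => _ _; apply: lc.
- rewrite (bigD1 P)//= addrAC subrr add0r [RHS](bigD1 P)//= eqxx scale0r add0r.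
  by apply: eq_bigr => Q /negbTE->.
Qed.

(** A form negative on the ray of the smallest cell of the chain is nonpositive on all other rays
    involved, hence negative at x; so the smallest cell is the cell of x. *)
Lemma isdec_min x l P : isdec x l -> l P != 0 ->
  [/\ l (pos h x) != 0, forall Q, l Q != 0 -> pos h x \subset Q & x != 0].
Proof.
move=> [l0 lv lc ex] lP.
have [P1 lP1 P1min] := @arg_minnP _ P (fun Q => l Q != 0) (fun Q => #|Q|) lP.
have P1s Q : l Q != 0 -> P1 \subset Q.
  move=> lQ; have /orP[//|QP] := lc _ _ lP1 lQ.
  by have /eqP<- : Q == P1 by rewrite eqEcard QP P1min.
have [Cr r0 rP1] := lv _ lP1.
have x_neg i : i \notin P1 -> ev x (h i) < 0.
  move=> iP; rewrite ex ev_sum (bigD1 P1)//= evZ.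
  rewrite ltr_wnDr//.
    apply: sumr_le0 => Q QP1; have [->|lQ] := eqVneq (l Q) 0.
      by rewrite scale0r ev0l.
    rewrite evZ; apply: mulr_ge0_le0 => //.
    by apply: (@pos_opp (r P1)); rewrite rP1//; have [_ _ ->] := lv _ lQ; apply: P1s.
  have lP0 : 0 < l P1 by rewrite lt0r lP1 l0.
  by rewrite pmulr_rlt0// ltNge -posP rP1.
have xP1 : pos h x = P1.
  apply/eqP; rewrite eqEsubset; apply/andP; split.
    by apply/subsetP => i; rewrite posP; apply: contraTT => /x_neg; rewrite -ltNge.
  rewrite ex; apply: pos_sum => Q _; have [->|lQ] := eqVneq (l Q) 0.
    by rewrite scale0r pos0 subsetT.
  by apply: posZ => //; have [_ _ ->] := lv _ lQ; apply: P1s.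
rewrite xP1; split=> //; apply: contraNneq r0 => x0.
by apply/eqP/pos_full; rewrite rP1 -xP1 x0 pos0.
Qed.

(** After the removal of l P times the ray of its cell P, some form negative on P has become
    nonnegative; removing the larger l' P would make it positive, but it must remain nonpositive. *)
Lemma isdec_top_le x l l' : isdec x l -> isdec x l' ->
  l (pos h x) != 0 -> l' (pos h x) != 0 -> l' (pos h x) <= l (pos h x).
Proof.
set P := pos h x => dl dl' lP l'P; rewrite leNgt; apply/negP => ll'.
have := isdec_drop P dl; set y := x - _ => dy.
have [_ lv _ _] := dl; have [Cr r0 rP] := lv _ lP.
have [i iP iy] : exists2 i, i \notin P & 0 <= ev y (h i).
  have [/existsP[Q lQ]|] := boolP [exists Q, drop l P Q != 0].
    have [ly _ _] := isdec_min dy lQ; move: ly; rewrite /drop.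
    case: (_ =P P) => [|/eqP yP ly]; first by rewrite eqxx.
    have [_ /(_ _ ly) Py _] := isdec_min dl lP.
    have : P \proper pos h y by rewrite properEneq eq_sym yP.
    by move=> /properP[_ [i iy iP]]; exists i; rewrite // -posP.
  rewrite negb_exists => /forallP l0.
  have -> : y = 0.
    have [_ _ _ ->] := dy; rewrite big1// => Q _.
    by have := l0 Q; rewrite negbK => /eqP->; rewrite scale0r.
  have [i iP] : exists i, i \notin P.
    apply/existsP; apply: contraNT r0; rewrite negb_exists => /forallP xP.
    by apply/eqP/pos_full/setP => i; rewrite rP in_setT; have := xP i; rewrite negbK.
  by exists i; rewrite ?ev0l.
have [l'0 l'v _ l'x] := dl'; have [_ l'min _] := isdec_min dl' l'P.
have : ev (x - l' P *: r P) (h i) <= 0.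
  have [_ _ _ ->] := isdec_drop P dl'; rewrite ev_sum sumr_le0// => Q _.
  rewrite /drop; case: (Q =P P) => [_|_]; first by rewrite scale0r ev0l.
  have [->|lQ] := eqVneq (l' Q) 0; first by rewrite scale0r ev0l.
  rewrite evZ; apply: mulr_ge0_le0 => //.
  by apply: (@pos_opp (r P)); rewrite rP//; have [_ _ ->] := l'v _ lQ; apply: l'min.
have : ev (r P) (h i) < 0 by rewrite ltNge -posP rP.
by move: iy; rewrite /y !evB !evZ; nra.
Qed.

Lemma isdec_uniq x l l' : isdec x l -> isdec x l' -> l =1 l'.
Proof.
have [k] := ubnP #|[set P | l P != 0]|; elim: k => // k IH in x l l' *.
move=> lk dl dl'.
have zero m m' : isdec x m -> isdec x m' -> (forall P, m P = 0) -> m =1 m'.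
  move=> dm dm' m0 P; apply/eqP; rewrite m0 eq_sym.
  apply/negP => /negP m'P; have [_ _ /eqP] := isdec_min dm' m'P; case.
  by have [_ _ _ ->] := dm; rewrite big1// => Q _; rewrite m0 scale0r.
have [/existsP[P lP]|] := boolP [exists P, l P != 0]; last first.
  rewrite negb_exists => /forallP l0; apply: zero => // P.
  by have := l0 P; rewrite negbK => /eqP.
have [/existsP[P' l'P]|] := boolP [exists P, l' P != 0]; last first.
  rewrite negb_exists => /forallP l0 Q; apply/esym; apply: zero => // S.
  by have := l0 S; rewrite negbK => /eqP.
have [lx _ _] := isdec_min dl lP; have [l'x _ _] := isdec_min dl' l'P.
have e : l (pos h x) = l' (pos h x).
  by apply/le_anti; rewrite !isdec_top_le.
have := isdec_drop (pos h x) dl'; rewrite -e => dd'.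
have ll' := IH _ _ _ _ (isdec_drop (pos h x) dl) dd'.
move=> Q; have := ll' _ Q; rewrite /drop; case: (Q =P _) => [->//|_]; apply.
rewrite -ltnS; apply: leq_trans lk; rewrite ltnS; apply: proper_card; apply/properP; split.
  by apply/subsetP => S; rewrite !inE; case: ifP => //; rewrite eqxx.
by exists (pos h x); rewrite !inE ?eqxx.
Qed.

Definition dec x : {set I} -> R :=
  if pselect (exists l, isdec x l) is left e then sval (cid e) else fun=> 0.

Lemma decP x l : isdec x l -> isdec x (dec x) /\ dec x =1 l.
Proof.
move=> dl; rewrite /dec; case: pselect => [e|[]]; last by exists l.
by case: cid => l' /= d; split=> //; apply: isdec_uniq d dl.
Qed.

(** Stretches the ray of each cell P by c P and extends linearly over the simplicial cones; for
    positive c this maps every closed cell to itself, with inverse the rescaling by 1/c. *)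
Definition rescale (c : {set I} -> R) x := \sum_P (c P * dec x P) *: r P.

Lemma rescaleE c x l : isdec x l -> rescale c x = \sum_P (c P * l P) *: r P.
Proof. by case/decP => _ e; apply: eq_bigr => P _; rewrite e. Qed.

Lemma isdec_rescale c x l : (forall P, 0 < c P) -> isdec x l ->
  isdec (rescale c x) (fun P => c P * l P).
Proof.
move=> c0 dl; have ce P : (c P * l P != 0) = (l P != 0).
  by rewrite mulf_eq0 gt_eqF.
rewrite (rescaleE _ dl); case: dl => l0 lv lc _; split=> //.
- by move=> P; rewrite mulr_ge0// ltW.
- by move=> P; rewrite ce => /lv.
- by move=> P Q; rewrite !ce; apply: lc.
Qed.

Lemma rescaleK c x : (forall P, 0 < c P) -> C x ->
  rescale (fun P => (c P)^-1) (rescale c x) = x.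
Proof.
move=> c0 Cx; have [l [dl _]] := isdec_ex Cx.
have [_ _ _ {2}->] := dl; rewrite (rescaleE _ (isdec_rescale c0 dl)).
by apply: eq_bigr => P _; rewrite mulKf ?gt_eqF.
Qed.

Lemma pos_rescale c x : (forall P, 0 < c P) -> C x ->
  pos h x \subset pos h (rescale c x).
Proof.
move=> c0 Cx; have [l [dl lx]] := isdec_ex Cx.
rewrite (rescaleE _ dl); apply: pos_sum => P _.
have [->|lP] := eqVneq (l P) 0; first by rewrite mulr0 scale0r pos0 subsetT.
have [l0 /(_ _ lP)[_ _ rP] _ _] := dl.
by rewrite posZ ?mulr_ge0 ?(ltW (c0 _))// rP lx.
Qed.

End Flags.

(** * From a homogeneous map to a map between unit spheres *)

Section Radial.
Variable R : realFieldType.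

Definition norm1 a (x : 'rV[R]_a) := \sum_j `|x 0 j|.

Lemma norm1_eq0 a (x : 'rV[R]_a) : norm1 x = 0 -> x = 0.
Proof.
move=> /eqP; rewrite psumr_eq0// => /allP x0; apply/rowP => j.
by have := x0 j; rewrite mem_index_enum normr_eq0 mxE => /(_ isT)/eqP.
Qed.

Lemma norm1_ge0 a (x : 'rV[R]_a) : 0 <= norm1 x.
Proof. exact: sumr_ge0. Qed.

Lemma norm1Z a c (x : 'rV[R]_a) : norm1 (c *: x) = `|c| * norm1 x.
Proof.
by rewrite /norm1 mulr_sumr; apply: eq_bigr => j _; rewrite mxE normrM.
Qed.

(** The l1-norm is additive on vectors of a common closed orthant. *)
Lemma norm1_sum a (T : finType) (l : T -> R) (r : T -> 'rV[R]_a) :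
  (forall P, 0 <= l P) ->
  (forall j, (forall P, l P != 0 -> 0 <= r P 0 j) \/
             (forall P, l P != 0 -> r P 0 j <= 0)) ->
  norm1 (\sum_P l P *: r P) = \sum_P l P * norm1 (r P).
Proof.
move=> l0 sgn; rewrite /norm1.
under [RHS]eq_bigr do rewrite mulr_sumr.
rewrite exchange_big; apply: eq_bigr => j _ /=; rewrite summxE.
have key (u : T -> R) : (forall P, l P != 0 -> 0 <= u P) ->
    `|\sum_P l P * u P| = \sum_P l P * `|u P|.
  move=> u0; rewrite ger0_norm; last first.
    apply: sumr_ge0 => P _; have [->|lP] := eqVneq (l P) 0; first by rewrite mul0r.
    by rewrite mulr_ge0 ?u0.
  apply: eq_bigr => P _; have [->|lP] := eqVneq (l P) 0; first by rewrite !mul0r.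
  by rewrite ger0_norm ?u0.
have -> : \sum_P (l P *: r P) 0 j = \sum_P l P * r P 0 j.
  by apply: eq_bigr => P _; rewrite mxE.
case: (sgn j) => s; first exact: key.
rewrite -normrN -sumrN (eq_bigr (fun P => l P * - r P 0 j)); last first.
  by move=> P _; rewrite mulrN.
rewrite key; first by apply: eq_bigr => P _; rewrite normrN.
by move=> P lP; rewrite oppr_ge0 s.
Qed.

Definition csum b (y : 'rV[R]_b) := \sum_j y 0 j.

Lemma csumZ b c (y : 'rV[R]_b) : csum (c *: y) = c * csum y.
Proof. by rewrite /csum mulr_sumr; apply: eq_bigr => j _; rewrite mxE. Qed.

Lemma csumD b (x y : 'rV[R]_b) : csum (x + y) = csum x + csum y.
Proof. by rewrite /csum -big_split; apply: eq_bigr => j _; rewrite mxE. Qed.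

Lemma csum0 b : csum (0 : 'rV[R]_b) = 0.
Proof. by rewrite /csum big1// => j _; rewrite mxE. Qed.

Lemma csum_sum b (I : Type) (s : seq I) (P : pred I) (F : I -> 'rV[R]_b) :
  csum (\sum_(i <- s | P i) F i) = \sum_(i <- s | P i) csum (F i).
Proof. by apply: (big_morph _ (@csumD b)); apply: csum0. Qed.

Lemma csum_eq0 b (y : 'rV[R]_b) : (forall j, 0 <= y 0 j) -> csum y = 0 -> y = 0.
Proof.
move=> y0 /eqP; rewrite psumr_eq0// => /allP s0; apply/rowP => j.
by have := s0 j; rewrite mem_index_enum mxE => /(_ isT)/eqP.
Qed.

(* The unit spheres of the l1-norm in [C] and of the coordinate sum in [C'] are
   not related by the piecewise linear homeomorphism [A] followed by the radial
   projection, which is only piecewise projective.  Rather, the arrangement on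
   whose cones [A] is linear is triangulated by rays, and [F] is the map which
   is the radial projection on the rays and linear on the simplices. *)
Lemma radial_homeo a b (C : 'rV[R]_a -> Prop) (C' : 'rV[R]_b -> Prop)
    (A : 'rV[R]_a -> 'rV[R]_b) :
  hpl C A -> (forall x, C x -> C' (A x)) ->
  (forall x y, C x -> C y -> A x = A y -> x = y) ->
  (forall y, C' y -> exists2 x, C x & A x = y) ->
  (forall y, C' y -> forall j, 0 <= y 0 j) ->
  exists (T : finType) (r : T -> 'rV[R]_a) (chains : {set {set T}})
      (F : 'rV[R]_a -> 'rV[R]_b),
    [/\ forall x, C x -> norm1 x = 1 -> C' (F x) /\ csum (F x) = 1,
        forall x y, C x -> C y -> norm1 x = 1 -> norm1 y = 1 -> F x = F y -> x = y,
        forall y, C' y -> csum y = 1 -> exists x, [/\ C x, norm1 x = 1 & F x = y],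
        forall x, C x -> norm1 x = 1 -> exists2 c, c \in chains &
          exists l : T -> R, [/\ forall P, 0 <= l P, \sum_P l P = 1,
            forall P, P \notin c -> l P = 0, x = \sum_P l P *: r P &
            forall P, P \in c -> forall j, (0 <= x 0 j -> 0 <= r P 0 j) /\
              (x 0 j <= 0 -> r P 0 j <= 0)] &
        forall c, c \in chains -> (forall P, P \in c -> C (r P) /\ norm1 (r P) = 1)
          /\ forall l : T -> R, (forall P, 0 <= l P) -> \sum_P l P = 1 ->
            (forall P, P \notin c -> l P = 0) ->
            F (\sum_P l P *: r P) = \sum_P l P *: F (r P)].
Proof.
case=> I [h [M hM]] CC' Ainj Asurj C'0.
(* The coordinate forms and all opposites are added: the arrangement becomes symmetric and pointed,
   and each of its cells lies in an orthant, so that [norm1] is linear on it. *)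
pose h' (u : bool * (I + 'I_a)) : 'cV[R]_a :=
  let v := match u.2 with inl i => h i | inr j => delta_mx j 0 end in
  if u.1 then v else - v.
have [N hN] := hpl_refine hM (fun i => erefl : h' (true, inl i) = h i).
have h_sym u : exists v, h' v = - h' u.
  by case: u => -[] u; [exists (false, u) | exists (true, u)]; rewrite /h'/= ?opprK.
have h_pt x : (forall u, ev x (h' u) = 0) -> x = 0.
  move=> x0; apply/rowP => j; have := x0 (true, inr j).
  by rewrite /h' /= ev_coord mxE.
have C_cl x y : C x -> pos h' x \subset pos h' y -> C y.
  by move=> Cx xy; case: (hN x y Cx xy).
have hsgn x y : pos h' x \subset pos h' y ->
    forall j, (0 <= x 0 j -> 0 <= y 0 j) /\ (x 0 j <= 0 -> y 0 j <= 0).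
  move=> /subsetP xy j; have := xy (true, inr j); have := xy (false, inr j).
  by rewrite !inE /h' /= !evNr !ev_coord !oppr_ge0.
pose r (P : {set bool * (I + 'I_a)}) : 'rV[R]_a :=
  if pselect (exists x, [/\ C x, x != 0 & pos h' x = P]) is left e
  then (norm1 (sval (cid e)))^-1 *: sval (cid e) else 0.
have norm1_gt0 x : x != 0 :> 'rV[R]_a -> 0 < norm1 x.
  by move=> x0; rewrite lt0r norm1_ge0 andbT; apply: contraNneq x0 => /norm1_eq0->.
have r_pos x : C x -> x != 0 -> pos h' (r (pos h' x)) = pos h' x.
  move=> Cx x0; rewrite /r; case: pselect => [e|[]]; last by exists x.
  by case: cid => y /= [Cy y0 <-]; rewrite pos_scale// invr_gt0 norm1_gt0.
have r1 P : r P != 0 -> norm1 (r P) = 1.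
  rewrite /r; case: pselect => [e|_]; last by rewrite eqxx.
  case: cid => y /= [Cy y0 _] _; rewrite norm1Z ger0_norm ?invr_ge0 ?norm1_ge0//.
  by rewrite mulVf// gt_eqF// norm1_gt0.
have A0 x : C x -> C 0 /\ A 0 = 0.
  move=> Cx; have [|C0 ->] := hN x 0 Cx; first by rewrite pos0 subsetT.
  by rewrite mul0mx.
have csA x : C x -> x != 0 -> 0 < csum (A x).
  move=> Cx x0; have Ax := C'0 _ (CC' _ Cx); rewrite lt0r sumr_ge0// andbT.
  apply: contraNneq x0 => /(csum_eq0 Ax) e; have [C0 A00] := A0 _ Cx.
  by apply/eqP/Ainj => //; rewrite A00.
(* [r P] has norm 1, and [k P] stretches it so that its image has coordinate sum 1. The default 1
   keeps k positive on sets P that are not cells. *)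
pose k P : R := if 0 < csum (A (r P)) then (csum (A (r P)))^-1 else 1.
have k0 P : 0 < k P by rewrite /k; case: ifP => //; rewrite invr_gt0.
have kV P : 0 < (k P)^-1 by rewrite invr_gt0.
pose val := valid h' C r; pose decomp := isdec h' C r.
have valE P : val P -> [/\ C (r P), norm1 (r P) = 1 & k P * csum (A (r P)) = 1].
  move=> [Cr r0 _]; split=> //; first exact: r1.
  by rewrite /k csA// mulVf// gt_eqF// csA.
have dec_ex x : C x -> exists l, decomp x l /\
    forall P, l P != 0 -> pos h' x \subset P.
  exact: isdec_ex.
have A_dec c x l : (forall P, 0 < c P) -> C x -> decomp x l ->
    A (rescale h' C r c x) = \sum_P (c P * l P) *: A (r P).
  move=> c0 Cx dl; rewrite (rescaleE h_sym h_pt _ dl).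
  have lx P : l P != 0 -> pos h' x \subset P.
    by move=> lP; case: (isdec_min h_sym h_pt dl lP) => _ /(_ _ lP).
  have [l0 lv _ _] := dl.
  have [|_ ->] := hN x (\sum_P (c P * l P) *: r P) Cx.
    apply: pos_sum => P _; have [->|lP] := eqVneq (l P) 0.
      by rewrite mulr0 scale0r pos0 subsetT.
    have [_ _ rP] := lv _ lP.
    by rewrite posZ ?mulr_ge0 ?(ltW (c0 _))// rP lx.
  rewrite mulmx_suml; apply: eq_bigr => P _; rewrite -scalemxAl.
  have [->|lP] := eqVneq (l P) 0; first by rewrite mulr0 !scale0r.
  have [_ _ rP] := lv _ lP.
  by have [|_ ->] := hN x (r P) Cx; rewrite // rP lx.
have N1_dec x l : C x -> decomp x l -> norm1 x = \sum_P l P.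
  move=> Cx dl; have [l0 lv _ ex] := dl.
  have lx P : l P != 0 -> pos h' x \subset pos h' (r P).
    move=> lP; have [_ _ ->] := lv _ lP.
    by case: (isdec_min h_sym h_pt dl lP) => _ /(_ _ lP).
  rewrite {1}ex norm1_sum//.
    apply: eq_bigr => P _; have [->|lP] := eqVneq (l P) 0; first by rewrite mul0r.
    by have [_ -> _] := valE _ (lv _ lP); rewrite mulr1.
  move=> j; case: (lerP 0 (x 0 j)) => [xj|/ltW xj]; [left|right] => P /lx /hsgn/(_ j)[].
    by move=> /(_ xj).
  by move=> _ /(_ xj).
pose rs c x := rescale h' C r c x.
have C_rs c x : (forall P, 0 < c P) -> C x -> C (rs c x).
  by move=> c0 Cx; apply: (C_cl _ _ Cx); apply: (pos_rescale h_sym h_pt).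
have cs_rs x : C x -> csum (A (rs k x)) = norm1 x.
  move=> Cx; have [l [dl _]] := dec_ex _ Cx.
  rewrite (A_dec k x l)// (N1_dec x l)// csum_sum; apply: eq_bigr => P _.
  rewrite csumZ; have [->|lP] := eqVneq (l P) 0; first by rewrite mulr0 mul0r.
  have [_ lv _ _] := dl; have [_ _] := valE _ (lv _ lP).
  by rewrite mulrAC => ->; rewrite mul1r.
have rsK x : C x -> rs (fun P => (k P)^-1) (rs k x) = x.
  by move=> Cx; apply: rescaleK.
have rsVK x : C x -> rs k (rs (fun P => (k P)^-1) x) = x.
  move=> Cx; rewrite -[RHS](@rescaleK _ _ _ _ C h_sym h_pt _ r r_pos (fun P => (k P)^-1))//.
  by congr (rescale _ _ _ _ _); apply: funext => P; rewrite invrK.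
pose chains := [set c : {set {set bool * (I + 'I_a)}} |
  [forall P in c, `[< val P >]] &&
  [forall P in c, forall Q in c, (P \subset Q) || (Q \subset P)]].
exists {set bool * (I + 'I_a)}, r, chains, (fun x => A (rs k x)); split.
- by move=> x Cx x1; split; [apply/CC'/C_rs | rewrite cs_rs].
- move=> x y Cx Cy _ _ /Ainj e; rewrite -[x]rsK// -[y]rsK// e//; exact: C_rs.
- move=> y Cy y1; have [x Cx xy] := Asurj _ Cy.
  exists (rs (fun P => (k P)^-1) x); split; first exact: C_rs.
    by rewrite -cs_rs ?rsVK ?xy//; apply: C_rs.
  by rewrite rsVK.
- move=> x Cx x1; have [l [dl lx]] := dec_ex _ Cx; have [l0 lv lc ex] := dl.
  exists [set P | l P != 0].
    rewrite inE; apply/andP; split.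
      by apply/forall_inP => P; rewrite inE => /lv vP; apply/asboolP.
    apply/forall_inP => P; rewrite inE => lP.
    by apply/forall_inP => Q; rewrite inE => lQ; apply: lc.
  exists l; split=> //; first by rewrite -(N1_dec x l).
    by move=> P; rewrite inE negbK => /eqP.
  move=> P; rewrite inE => lP j; apply: hsgn; have [_ _ ->] := lv _ lP.
  exact: lx.
- move=> c; rewrite inE => /andP[/forall_inP cv /forall_inP cc].
  have {}cv P : P \in c -> val P by move=> /cv /asboolP.
  split=> [P /cv /valE[]//|l l0 l1 lc].
  have cl P : l P != 0 -> P \in c by apply: contraR => /lc ->.
  have dl : decomp (\sum_P l P *: r P) l.
    split=> //; first by move=> P /cl /cv.
    by move=> P Q /cl /cc /forall_inP cP /cl /cP.
  have Cx : C (\sum_P l P *: r P).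
    have [P lP] : exists P, l P != 0.
      apply/existsP; apply: contraT; rewrite negb_exists => /forallP l00.
      move: l1; rewrite big1 => [/eqP|P _]; first by rewrite eq_sym oner_eq0.
      by have := l00 P; rewrite negbK => /eqP.
    have [lx _ _] := isdec_min h_sym h_pt dl lP.
    have [Cr _ rx] := cv _ (cl _ lx); apply: (C_cl _ _ Cr).
    by rewrite rx.
  rewrite (A_dec k _ l)//; apply: eq_bigr => P _.
  have [->|lP] := eqVneq (l P) 0; first by rewrite mulr0 !scale0r.
  have dP : decomp (r P) (fun Q => (Q == P)%:R).
    have eP Q : ((Q == P)%:R != 0 :> R) = (Q == P).
      by rewrite pnatr_eq0; case: (Q == P).
    split.
    - by move=> Q; rewrite ler0n.
    - by move=> Q; rewrite eP => /eqP->; apply/cv/cl.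
    - by move=> Q S; rewrite !eP => /eqP-> /eqP->; rewrite subxx.
    - rewrite (bigD1 P)//= eqxx scale1r big1 ?addr0// => Q /negbTE->.
      by rewrite scale0r.
  have [Cr _ _] := valE _ (cv _ (cl _ lP)).
  rewrite (A_dec k _ _ k0 Cr dP) (bigD1 P)//= eqxx mulr1 big1 ?addr0.
    by rewrite scalerA mulrC.
  by move=> Q /negbTE->; rewrite mulr0 scale0r.
Qed.

End Radial.

(** * Tangent cones and invariance of dimension *)

Section Tangent.
Variable R : realFieldType.

(** The projection along the diagonal to the boundary of the positive orthant, which meets every
    line of that direction exactly once. *)
Definition shift_min m (j0 : 'I_m) (w : 'rV[R]_m) : 'rV[R]_m :=
  w - w 0 [arg min_(i < j0) w 0 i]%O *: const_mx 1.

Definition bd_orthant m (x : 'rV[R]_m) :=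
  (forall j, 0 <= x 0 j) /\ exists j, x 0 j = 0.

Lemma shift_min_in m j0 (w : 'rV[R]_m) : bd_orthant (shift_min j0 w).
Proof.
rewrite /shift_min; case: arg_minP => // i _ imin; split=> [j|].
  by rewrite !mxE mulr1 subr_ge0; apply: imin.
by exists i; rewrite !mxE mulr1 subrr.
Qed.

Lemma shift_min_uniq m j0 (w : 'rV[R]_m) c :
  bd_orthant (w - c *: const_mx 1) -> shift_min j0 w = w - c *: const_mx 1.
Proof.
case=> wc [j]; rewrite /shift_min; case: arg_minP => // i _ imin.
rewrite !mxE mulr1 => /eqP; rewrite subr_eq0 => /eqP wj.
congr (_ - _ *: _); apply/le_anti; rewrite -{1}wj imin//=.
by have := wc i; rewrite !mxE mulr1 subr_ge0.
Qed.

Lemma hpl_shift_min m (j0 : 'I_m) : hpl (fun=> True) (shift_min j0).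
Proof.
pose h (u : 'I_m * 'I_m) : 'cV[R]_m := delta_mx u.2 0 - delta_mx u.1 0.
have hP x i j : ((i, j) \in pos h x) = (x 0 i <= x 0 j).
  by rewrite inE /h /= evBr !ev_coord subr_ge0.
exists ('I_m * 'I_m)%type, h, (fun P : {set _} =>
  if [pick i | [forall j, (i, j) \in P]] is Some i
  then 1%:M - delta_mx i 0 *m (const_mx 1 : 'rV_m) else 0) => x y _ xy; split=> //.
case: pickP => [i /forallP xi|].
  have yi j : y 0 i <= y 0 j by rewrite -hP (subsetP xy).
  have -> : y *m (1%:M - delta_mx i 0 *m (const_mx 1 : 'rV_m)) = y - y 0 i *: const_mx 1.
    rewrite mulmxBr mulmx1 mulmxA; congr (_ - _).
    have -> : y *m delta_mx i 0 = (y 0 i)%:M :> 'M_1.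
      by apply/rowP => k; rewrite ord1 [LHS]ev_coord mxE eqxx mulr1n.
    by rewrite mul_scalar_mx.
  apply: shift_min_uniq; split=> [j|]; first by rewrite !mxE mulr1 subr_ge0.
  by exists i; rewrite !mxE mulr1 subrr.
move=> /(_ [arg min_(i < j0) x 0 i]%O)/negbT/forallP[] j; rewrite hP.
by case: arg_minP => // i _; apply.
Qed.

Lemma tcone_bd_orthant m (q w : 'rV[R]_m) : bd_orthant q ->
  tcone (@bd_orthant m) q w <->
  (forall i, q 0 i = 0 -> 0 <= w 0 i) /\ exists2 i, q 0 i = 0 & w 0 i = 0.
Proof.
move=> [q0 _].
have [t1 t10 small] : exists2 t1 : R, 0 < t1 & forall t, 0 < t <= t1 ->
    forall i, 0 < q 0 i -> 0 < (q + t *: w) 0 i.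
  apply: (@finite_small R _ (fun i t => 0 < q 0 i -> 0 < (q + t *: w) 0 i)) => i.
  have [qi|qi] := ltP 0 (q 0 i); last by exists 1 => // t _; rewrite ltNge qi.
  have w1 : 0 < 1 + `|w 0 i| by have := normr_ge0 (w 0 i); lra.
  exists (q 0 i / (1 + `|w 0 i|)); first by rewrite divr_gt0.
  move=> t /andP[t0]; rewrite ler_pdivlMr// => tq _; rewrite !mxE.
  have : - (t * `|w 0 i|) <= t * w 0 i.
    by rewrite -mulrN ler_pM2l// lerNl ler_normr lexx orbT.
  by move=> ?; nra.
split=> [[s s0 qw]|[w0 [i qi wi]]].
  have tP : 0 < Num.min s t1 by rewrite lt_min s0.
  have [|qs [i qi]] := qw (Num.min s t1); first by rewrite tP ge_min lexx.
  split=> [j qj|].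
    by have := qs j; rewrite !mxE qj add0r pmulr_rge0.
  have qi0 : q 0 i = 0.
    apply/eqP; apply: contraT => qi0.
    have := small (Num.min s t1); rewrite tP ge_min lexx orbT => /(_ isT i).
    by rewrite qi ltxx lt0r qi0 q0 => /(_ isT).
  exists i => //; move: qi; rewrite !mxE qi0 add0r => /eqP.
  by rewrite mulf_eq0 gt_eqF//= => /eqP.
exists t1 => // t tt1; split=> [j|].
  have [qj|qj|qj] := ltgtP 0 (q 0 j).
  - by apply/ltW/small.
  - by have := q0 j; rewrite leNgt qj.
  - by rewrite !mxE -qj add0r mulr_ge0 ?w0//; case/andP: tt1 => /ltW.
by exists i; rewrite !mxE qi wi mulr0 addr0.
Qed.

(** The tangent cone at q constrains only the coordinates vanishing at q, by the same condition as
    [bd_orthant]. It therefore also meets every diagonal line exactly once, where the minimum over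
    these coordinates is 0. *)
Lemma shift_min_tcone m (j0 : 'I_m) (q : 'rV[R]_m) : bd_orthant q ->
  (forall w w', tcone (@bd_orthant m) q w -> tcone (@bd_orthant m) q w' ->
     shift_min j0 w = shift_min j0 w' -> w = w') /\
  forall x, bd_orthant x ->
     exists2 w, tcone (@bd_orthant m) q w & shift_min j0 w = x.
Proof.
move=> bq; split=> [w w'|x bx].
  move=> /(tcone_bd_orthant _ bq)[w0 [i qi wi]].
  move=> /(tcone_bd_orthant _ bq)[w'0 [i' qi' wi']].
  rewrite /shift_min; set c := w 0 _; set c' := w' 0 _ => e.
  have ej j : w 0 j - c = w' 0 j - c'.
    by have /rowP/(_ j) := e; rewrite !mxE !mulr1.
  have cc' : c = c'.
    have := ej i; have := ej i'; have := w0 i' qi'; have := w'0 i qi.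
    by rewrite wi wi' => *; apply/le_anti/andP; split; lra.
  by apply/rowP => j; have := ej j; rewrite cc' => /addIr.
have [x0 _] := bx; have [_ [i1 qi1]] := bq.
have [i /eqP qi imin] := @arg_minP _ _ _ i1 (fun i => q 0 i == 0) (fun i => x 0 i)
  (introT eqP qi1).
exists (x - x 0 i *: const_mx 1).
  apply/tcone_bd_orthant => //; split=> [j qj|].
    by rewrite !mxE mulr1 subr_ge0 imin// qj.
  by exists i; rewrite // !mxE mulr1 subrr.
by rewrite (@shift_min_uniq _ _ _ (- x 0 i)) scaleNr opprK subrK.
Qed.

(* The derivative at [p] of a homogeneous piecewise linear homeomorphism. *)
Lemma tangent_bijection a b (C : 'rV[R]_a -> Prop) (C' : 'rV[R]_b -> Prop) A B p :
  hpl C A -> hpl C' B -> (forall x, C x -> C' (A x)) ->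
  (forall y, C' y -> C (B y)) -> (forall x, C x -> B (A x) = x) ->
  (forall y, C' y -> A (B y) = y) -> C p ->
  exists D, [/\ hpl (tcone C p) D,
    forall d, tcone C p d -> tcone C' (A p) (D d),
    forall d d', tcone C p d -> tcone C p d' -> D d = D d' -> d = d' &
    forall w, tcone C' (A p) w -> exists2 d, tcone C p d & D d = w].
Proof.
move=> hA hB CA CB AK BK Cp.
have [D [hD DE]] := hpl_tangent hA Cp; have [E [hE EE]] := hpl_tangent hB (CA _ Cp).
have DT d : tcone C p d -> tcone C' (A p) (D d).
  move=> Td; have [s s0 Cs] := Td; have [t t0 Dt] := DE _ Td.
  exists (Num.min s t); first by rewrite lt_min s0.
  move=> u; rewrite le_min => /and3P[u0 us ut].
  by rewrite -Dt ?u0//; apply/CA/Cs; rewrite u0.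
have ET w : tcone C' (A p) w -> tcone C p (E w).
  move=> Td; have [s s0 Cs] := Td; have [t t0 Dt] := EE _ Td.
  exists (Num.min s t); first by rewrite lt_min s0.
  move=> u; rewrite le_min => /and3P[u0 us ut].
  by rewrite -[p]AK// -Dt ?u0//; apply/CB/Cs; rewrite u0.
have inj k (p0 x y : 'rV[R]_k) (u : R) :
    0 < u -> p0 + u *: x = p0 + u *: y -> x = y.
  move=> u0 /addrI /(congr1 (fun z => u^-1 *: z)).
  by rewrite !scalerA mulVf ?gt_eqF// !scale1r.
exists D; split=> //.
  move=> d d' Td Td' e.
  have [s s0 Cs] := Td; have [t t0 Dt] := DE _ Td.
  have [s' s0' Cs'] := Td'; have [t' t0' Dt'] := DE _ Td'.
  pose u := Num.min (Num.min s t) (Num.min s' t').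
  have u0 : 0 < u by rewrite !lt_min s0 t0 s0' t0'.
  have /and4P[us ut us' ut'] : [&& u <= s, u <= t, u <= s' & u <= t'].
    by rewrite /u !ge_min !lexx ?orbT.
  apply: (inj _ p _ _ u u0); rewrite -[LHS]AK; last by apply: Cs; rewrite u0.
  rewrite Dt ?u0// e -Dt' ?u0// AK//; by apply: Cs'; rewrite u0.
move=> w Tw; exists (E w); first exact: ET.
have [s s0 Cs] := Tw; have [t t0 Et] := EE _ Tw; have [t' t0' Dt] := DE _ (ET _ Tw).
pose u := Num.min (Num.min s t) t'.
have u0 : 0 < u by rewrite !lt_min s0 t0 t0'.
have /and3P[us ut ut'] : [&& u <= s, u <= t & u <= t'].
  by rewrite /u !ge_min !lexx ?orbT.
apply: (inj _ (A p) _ _ u u0); rewrite -Dt ?u0//.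
rewrite -[in LHS](AK _ Cp) -Et ?u0// BK//; by apply: Cs; rewrite u0.
Qed.

(** The derivative of [A] leads to the tangent cone of [bd_orthant] at [A p], and [shift_min] from
    there back to [bd_orthant]. *)
Lemma bd_orthant_tangent a m (C : 'rV[R]_a -> Prop) (A : 'rV[R]_a -> 'rV[R]_m) B p :
  hpl C A -> hpl (@bd_orthant m) B -> (forall x, C x -> bd_orthant (A x)) ->
  (forall y, bd_orthant y -> C (B y)) -> (forall x, C x -> B (A x) = x) ->
  (forall y, bd_orthant y -> A (B y) = y) -> C p ->
  exists E, [/\ hpl (tcone C p) E, forall d, tcone C p d -> @bd_orthant m (E d),
    forall d d', tcone C p d -> tcone C p d' -> E d = E d' -> d = d' &
    forall y, bd_orthant y -> exists2 d, tcone C p d & E d = y].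
Proof.
move=> hA hB CA CB AK BK Cp.
have [_ [j0 _]] := CA _ Cp.
have [D [hD DT Dinj Dsurj]] := tangent_bijection hA hB CA CB AK BK Cp.
have [Sinj Ssurj] := shift_min_tcone j0 (CA _ Cp).
exists (shift_min j0 \o D); split=> /=.
- exact: hpl_comp hD (hpl_shift_min j0) _.
- by move=> d _; apply: shift_min_in.
- by move=> d d' Td Td' /Sinj e; apply: Dinj => //; apply: e; apply: DT.
- move=> y /Ssurj[w /Dsurj[d Td <-] <-]; by exists d.
Qed.

(** A point in the relative interior of the coordinate orthant [S], on no hyperplane of the list
    except those containing the whole coordinate subspace. The hyperplanes are avoided one by one,
    by perturbations too small to spoil what is already achieved. *)
Lemma generic_point a (I : finType) (h : I -> 'cV[R]_a) (S : {set 'I_a}) (s : seq I) :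
  exists x : 'rV[R]_a, [/\ forall j, j \in S -> 0 < x 0 j,
    forall j, j \notin S -> x 0 j = 0 &
    forall i, i \in s -> ev x (h i) != 0 \/
      forall y : 'rV[R]_a, (forall j, j \notin S -> y 0 j = 0) -> ev y (h i) = 0].
Proof.
elim: s => [|i s [x [xS xN xs]]].
  by exists (\row_j (j \in S)%:R); split=> [j jS|j /negbTE jS|//]; rewrite mxE jS.
have [x_i|x_i] := eqVneq (ev x (h i)) 0; last first.
  by exists x; split=> // k; rewrite inE => /predU1P[->|/xs//]; left.
have [all0|] := pselect (forall y : 'rV[R]_a,
    (forall j, j \notin S -> y 0 j = 0) -> ev y (h i) = 0).
  by exists x; split=> // k; rewrite inE => /predU1P[->|/xs//]; right.
move=> /asboolPn/existsp_asboolPn[y /asboolPn/imply_asboolPn[yN y_i]].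
have [t t0 [ht1 ht2]] : exists2 t : R, 0 < t &
    (forall j, j \in S -> 0 < (x + t *: y) 0 j) /\
    (forall k, ev x (h k) != 0 -> ev (x + t *: y) (h k) != 0).
  have [t1 t10 h1] := @pos_small R a _ (fun j : 'I_a => - delta_mx j 0) x y.
  have [t2 t20 h2] := @pos_small R a _ h x y.
  have [t3 t30 h3] := @pos_small R a _ (fun k => - h k) x y.
  pose t := Num.min t1 (Num.min t2 t3).
  have t0 : 0 < t by rewrite !lt_min t10 t20.
  have /and3P[l1 l2 l3] : [&& t <= t1, t <= t2 & t <= t3].
    by rewrite /t !ge_min !lexx ?orbT.
  exists t => //; split=> [j jS|k xk].
    have := h1 t; rewrite t0 l1 => /(_ isT)/setP/(_ j).
    rewrite !inE !evNr !ev_coord oppr_gt0 oppr_eq0 oppr_ge0.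
    have xj := xS _ jS; rewrite gt_eqF// [x 0 j < 0]ltNge (ltW xj) /=.
    by move=> /negbT; rewrite -ltNge.
  have := h2 t; rewrite t0 l2 => /(_ isT)/setP/(_ k).
  have := h3 t; rewrite t0 l3 => /(_ isT)/setP/(_ k).
  rewrite !inE !evNr oppr_gt0 oppr_ge0 oppr_eq0.
  move: xk; case: (ltgtP (ev x (h k)) 0) => // xk _ /= e1 e2.
    by apply/negP => /eqP e; move: e2; rewrite e lexx.
  by apply/negP => /eqP e; move: e1; rewrite e lexx.
exists (x + t *: y); split=> //.
  by move=> j jS; rewrite !mxE xN// yN// mulr0 addr0.
move=> k; rewrite inE => /predU1P[->|/xs[xk|]]; [left|left; exact: ht2|by right].
by rewrite evD x_i add0r evZ; apply: mulf_neq0; [rewrite gt_eqF|apply/eqP].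
Qed.

(** Near a generic point x the signs of the forms do not change, so the cone on the rows x + t e_j
    lies in one linear piece; injectivity of [A] there gives full rank. This yields the invariance
    of dimension used below. *)
Lemma hpl_open_piece a b (C : 'rV[R]_a -> Prop) (A : 'rV[R]_a -> 'rV[R]_b)
    (S : {set 'I_a}) : hpl C A ->
  (forall x y, C x -> C y -> A x = A y -> x = y) ->
  (forall x : 'rV[R]_a, (forall j, j \in S -> 0 < x 0 j) ->
     (forall j, j \notin S -> x 0 j = 0) -> C x) ->
  exists (X : 'M[R]_(#|S|, a)) (M : 'M[R]_(a, b)), row_free (X *m M) /\
    forall l : 'rV_#|S|, (forall i, 0 <= l 0 i) ->
      C (l *m X) /\ A (l *m X) = l *m X *m M.
Proof.
case=> I [h [M hM]] Ainj SC.
have [x [xS xN xg]] := generic_point h S (enum I).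
have Cx := SC _ xS xN.
pose e (j : 'I_#|S|) : 'rV[R]_a := delta_mx 0 (enum_val j).
have eN j k : k \notin S -> e j 0 k = 0.
  move=> kS; rewrite mxE eqxx /=; case: eqP => // ke.
  by move: kS; rewrite ke enum_valP.
have [t t0 ht] := finite_small (fun j => pos_small h x (e j)).
have pe j : pos h (x + t *: e j) = pos h x.
  rewrite (ht t _ j) ?t0 ?lexx//; apply/setP => i; rewrite !inE.
  have [|xi|z] := xg i; first by rewrite mem_enum.
    by rewrite (negbTE xi) orbF [RHS]le0r (negbTE xi).
  by rewrite !z ?lexx ?ltxx ?eqxx// => k kS; apply: eN.
pose X : 'M[R]_(#|S|, a) := \matrix_j (x + t *: e j).
exists X, (M (pos h x)).
have key (l : 'rV_#|S|) : (forall i, 0 <= l 0 i) ->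
    C (l *m X) /\ A (l *m X) = l *m X *m M (pos h x).
  move=> l0; apply: hM => //; rewrite mulmx_sum_row; apply: pos_sum => j _.
  by rewrite rowK; apply: posZ; rewrite // pe.
split=> //; apply: inj_row_free => l; rewrite mulmxA => lXM.
pose lp : 'rV[R]_#|S| := \row_j Num.max (l 0 j) 0.
pose ln : 'rV[R]_#|S| := \row_j Num.max (- l 0 j) 0.
have lp0 j : 0 <= lp 0 j by rewrite mxE le_max lexx orbT.
have ln0 j : 0 <= ln 0 j by rewrite mxE le_max lexx orbT.
have lE : l = lp - ln.
  by apply/rowP => j; rewrite !mxE !maxEle; case: ifP; case: ifP; lra.
have lX : l *m X = 0.
  rewrite lE mulmxBl; apply/eqP; rewrite subr_eq0; apply/eqP.
  have [Cp Ap] := key _ lp0; have [Cn An] := key _ ln0.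
  apply: Ainj => //; rewrite Ap An; apply/eqP.
  by rewrite -subr_eq0 -mulmxBl -mulmxBl -lE lXM.
(* A relation l among the rows reads t l_j = - L x_j with L the sum of the l_j; summation over j
   gives L = 0, because t and all x_j are positive. *)
pose L := \sum_j l 0 j.
have lX' : L *: x + t *: (\sum_j l 0 j *: e j) = 0.
  rewrite -[RHS]lX mulmx_sum_row /L scaler_suml scaler_sumr -big_split.
  by apply: eq_bigr => j _ /=; rewrite rowK scalerDr !scalerA mulrC.
have lj j : t * l 0 j = - L * x 0 (enum_val j).
  have /rowP/(_ (enum_val j)) := lX'; rewrite !mxE summxE (bigD1 j)//=.
  rewrite !mxE !eqxx mulr1 big1 ?addr0 => [|k kj]; last first.
    by rewrite !mxE (inj_eq enum_val_inj) eq_sym (negbTE kj) mulr0.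
  by move=> /eqP; rewrite addrC addr_eq0 => /eqP->; rewrite mulNr.
have L0 : L = 0.
  have : t * L = - L * \sum_(j < #|S|) x 0 (enum_val j).
    transitivity (\sum_j t * l 0 j); first by rewrite mulr_sumr.
    by rewrite mulr_sumr; apply: eq_bigr => j _; rewrite lj.
  have : 0 <= \sum_(j < #|S|) x 0 (enum_val j).
    by apply: sumr_ge0 => j _; apply/ltW/xS/enum_valP.
  set s := \sum_(_ < _) _ => s0 e0.
  have /eqP : (t + s) * L = 0 by rewrite mulrDl e0; ring.
  by rewrite mulf_eq0 => /orP[|/eqP//]; rewrite gt_eqF// ltr_wpDr.
apply/rowP => j; have /eqP := lj j; rewrite L0 oppr0 mul0r mulf_eq0 gt_eqF//=.
by move=> /eqP->; rewrite mxE.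
Qed.

End Tangent.

(** * Cones over complexes and links in spheres *)

Section ComplexCones.
Variable R : realType.

Definition supp (V : finType) (x : 'rV[R]_#|V|) : {set V} :=
  [set v | x 0 (enum_rank v) != 0].

(* The cone over the realization of [K], with apex at the origin. *)
Definition kcone (V : finType) (K : {set {set V}}) (x : 'rV[R]_#|V|) :=
  (forall j, 0 <= x 0 j) /\ supp x \in set0 |: K.

Lemma in_supp (V : finType) (x : 'rV[R]_#|V|) v :
  (v \in supp x) = (x 0 (enum_rank v) != 0).
Proof. by rewrite inE. Qed.

Lemma supp_eq0 (V : finType) (x : 'rV[R]_#|V|) v :
  v \notin supp x -> x 0 (enum_rank v) = 0.
Proof. by rewrite in_supp negbK => /eqP. Qed.

Lemma supp0 (V : finType) : supp (0 : 'rV[R]_#|V|) = set0.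
Proof. by apply/setP => v; rewrite !inE mxE eqxx. Qed.

Lemma supp_eq_set0 (V : finType) (x : 'rV[R]_#|V|) : (supp x == set0) = (x == 0).
Proof.
apply/eqP/eqP => [x0|->]; last exact: supp0.
apply/rowP => j; rewrite mxE -[j]enum_valK; apply: supp_eq0.
by rewrite x0 inE.
Qed.

Lemma row_vtx (V : finType) (x : 'rV[R]_#|V|) :
  x = \sum_v x 0 (enum_rank v) *: vtx R v.
Proof.
rewrite {1}[x]row_sum_delta (reindex (@enum_rank V)) //=.
by exists enum_val => v _; rewrite ?enum_rankK ?enum_valK.
Qed.

Lemma vtxE (V : finType) (v w : V) : vtx R v 0 (enum_rank w) = (w == v)%:R.
Proof. by rewrite mxE eqxx /= (inj_eq enum_rank_inj). Qed.

Lemma sum_vtxE (V : finType) (l : V -> R) v :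
  (\sum_w l w *: vtx R w) 0 (enum_rank v) = l v.
Proof.
rewrite summxE (bigD1 v)//= big1 => [|w wv].
  by rewrite addr0 mxE vtxE eqxx mulr1.
by rewrite mxE vtxE eq_sym (negbTE wv) mulr0.
Qed.

Lemma row_ext (V : finType) (x y : 'rV[R]_#|V|) :
  (forall v, x 0 (enum_rank v) = y 0 (enum_rank v)) -> x = y.
Proof. by move=> xy; apply/rowP => j; rewrite -[j]enum_valK. Qed.

Lemma gcone_vtx (V : finType) (s : {set V}) x :
  gcone [seq vtx R v | v <- enum s] x <->
  (forall j, 0 <= x 0 j) /\ supp x \subset s.
Proof.
split=> [/gconeP[l [l0 ->]]|[x0 xs]].
  split=> [j|].
    rewrite summxE sumr_ge0// => i _; rewrite mxE mulr_ge0//.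
    by have /mapP[w _ ->] := mem_nth 0 (ltn_ord i); rewrite mxE ler0n.
  apply/subsetP => v; rewrite in_supp; apply: contraR => vs.
  rewrite summxE big1// => i _; rewrite mxE.
  have /mapP[w ws ->] := mem_nth 0 (ltn_ord i); rewrite vtxE.
  case: eqP => [e|]; last by rewrite mulr0.
  by move: vs; rewrite e -mem_enum ws.
have -> : x = \sum_(v <- enum s) x 0 (enum_rank v) *: vtx R v.
  rewrite [LHS]row_vtx big_enum /= [RHS]big_mkcond /=; apply: eq_bigr => v _.
  case: ifP => // /negbT vs; rewrite supp_eq0 ?scale0r//.
  by apply: contraNN vs; apply: (subsetP xs).
elim: (enum s) => [|v t IH] /=; first by rewrite big_nil.
by exists (x 0 (enum_rank v)); rewrite ?x0// big_cons addrAC subrr add0r.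
Qed.

Lemma hull_gcone n (s : seq 'rV[R]_n) x : (forall p, p \in s -> csum p = 1) ->
  hull s x <-> gcone s x /\ csum x = 1.
Proof.
move=> s1; have sn i : (i < size s)%N -> csum s`_i = 1.
  by move=> /(mem_nth 0) /s1.
have cs (l : 'I_(size s) -> R) : csum (\sum_i l i *: s`_i) = \sum_i l i.
  by rewrite csum_sum; apply: eq_bigr => i _; rewrite csumZ sn// mulr1.
split=> [[l [l0 l1 ->]]|[/gconeP[l [l0 ->]]]].
  by split; [apply: gcone_gen | rewrite cs].
by rewrite cs => l1; exists l.
Qed.

Lemma csum_vtx (V : finType) (v : V) : csum (vtx R v) = 1.
Proof.
rewrite /csum (bigD1 (enum_rank v))//= vtxE eqxx big1 ?addr0// => j jv.
by rewrite mxE eqxx /= (negbTE jv).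
Qed.

Lemma realizationP (V : finType) (K : {set {set V}}) x : is_complex K ->
  realization R K x <-> kcone K x /\ csum x = 1.
Proof.
move=> [K0 Ks].
have h (s : {set V}) : hull [seq vtx R v | v <- enum s] x <->
    ((forall j, 0 <= x 0 j) /\ supp x \subset s) /\ csum x = 1.
  rewrite hull_gcone => [|p /mapP[v _ ->]]; last exact: csum_vtx.
  split=> -[h1 h2]; split=> //.
    exact: (gcone_vtx s x).1.
  exact: (gcone_vtx s x).2.
split=> [[s sK /h[[x0 xs] x1]]|[[x0]]].
  split=> //; split=> //; rewrite !inE.
  by case: eqP => //= /eqP sx; apply: Ks sK xs sx.
rewrite !inE supp_eq_set0 => /orP[/eqP->|xK x1].
  by rewrite csum0 => /eqP; rewrite eq_sym oner_eq0.
by exists (supp x) => //; apply/h.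
Qed.

Lemma bary_complex (V : finType) (K : {set {set V}}) : is_complex (bary K).
Proof.
split=> [|s t]; first by rewrite inE eqxx.
rewrite !inE => /and3P[s0 sK /forall_inP sc] ts -> /=.
rewrite (subset_trans ts sK); apply/forall_inP => u /(subsetP ts) us.
by apply/forall_inP => v /(subsetP ts) vs; have /forall_inP := sc _ us; apply.
Qed.

Lemma bd_simplex_complex m : is_complex (bd_simplex m).
Proof.
split=> [|s t]; first by rewrite inE eqxx.
rewrite !inE => /andP[s0 sT] ts -> /=.
by apply: contraNneq sT => tT; rewrite eqEsubset subsetT -tT.
Qed.

Lemma kcone_bd m (x : 'rV[R]_#|'I_m.+1|) :
  kcone (bd_simplex m) x <-> bd_orthant x.
Proof.
split=> -[x0 h]; split=> //.
  suff [v vx] : exists v, v \notin supp x by exists (enum_rank v); apply: supp_eq0.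
  have xT : supp x != setT.
    apply: contraTneq h => ->; rewrite !inE eqxx andbF orbF.
    by apply/negP => /eqP/setP/(_ ord0); rewrite !inE.
  move: xT; rewrite -subTset => /subsetPn[v _ vx]; by exists v.
case: h => j xj; rewrite !inE; case: eqP => //= _.
by apply/negP => /eqP/setP/(_ (enum_val j)); rewrite !inE enum_valK xj eqxx.
Qed.

Lemma kcone_scale (V : finType) (K : {set {set V}}) x c : 0 < c ->
  kcone K x -> kcone K (c *: x).
Proof.
move=> c0 [x0 xK]; split=> [j|]; first by rewrite mxE mulr_ge0// ltW.
rewrite (_ : supp _ = supp x)//; apply/setP => v.
by rewrite !inE mxE mulf_eq0 gt_eqF.
Qed.

(** For small t > 0 the coordinates positive at p stay positive, so the support of p + t d is the
    union of both supports and only the coordinates off [supp p] restrict the sign of d. *)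
Lemma tcone_kcone (V : finType) (K : {set {set V}}) p d : kcone K p ->
  tcone (kcone K) p d <->
  (forall v, v \notin supp p -> 0 <= d 0 (enum_rank v)) /\
  supp p :|: supp d \in set0 |: K.
Proof.
move=> [p0 pK].
have [t1 t10 small] : exists2 t1 : R, 0 < t1 & forall t, 0 < t <= t1 ->
    forall i, 0 < p 0 i -> 0 < (p + t *: d) 0 i.
  apply: (@finite_small R _ (fun i t => 0 < p 0 i -> 0 < (p + t *: d) 0 i)) => i.
  have [qi|qi] := ltP 0 (p 0 i); last by exists 1 => // t _; rewrite ltNge qi.
  have w1 : 0 < 1 + `|d 0 i| by have := normr_ge0 (d 0 i); lra.
  exists (p 0 i / (1 + `|d 0 i|)); first by rewrite divr_gt0.
  move=> t /andP[t0]; rewrite ler_pdivlMr// => tq _; rewrite !mxE.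
  have : - (t * `|d 0 i|) <= t * d 0 i.
    by rewrite -mulrN ler_pM2l// lerNl ler_normr lexx orbT.
  by move=> ?; nra.
have suppE t : 0 < t <= t1 -> supp (p + t *: d) = supp p :|: supp d.
  move=> t01; have /andP[t0 _] := t01; apply/setP => v; rewrite in_setU !in_supp.
  have [pv|pv] := eqVneq (p 0 (enum_rank v)) 0 => /=.
    by rewrite !mxE pv add0r mulf_eq0 gt_eqF.
  by rewrite gt_eqF// small// lt0r pv p0.
split=> [[s s0 h]|[d0 dK]].
  pose t := Num.min s t1.
  have t0 : 0 < t by rewrite lt_min s0.
  have [|q0 qK] := h t; first by rewrite t0 ge_min lexx.
  rewrite suppE in qK; last by rewrite t0 ge_min lexx orbT.
  split=> // v vp; have := q0 (enum_rank v).
  by rewrite !mxE supp_eq0// add0r pmulr_rge0.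
exists t1 => // t tt; split; last by rewrite suppE.
move=> j; have [pj|pj|pj] := ltgtP 0 (p 0 j); first by apply/ltW/small.
  by have := p0 j; rewrite leNgt pj.
rewrite !mxE -pj add0r mulr_ge0//; first by case/andP: tt => /ltW.
by rewrite -[j]enum_valK d0// in_supp enum_valK -pj eqxx.
Qed.

Lemma affine_comb n m (s : seq 'rV[R]_n) (f : 'rV[R]_n -> 'rV[R]_m) :
  affine_on (hull s) f -> forall l : 'I_(size s) -> R, (forall i, 0 <= l i) ->
  \sum_i l i = 1 -> f (\sum_i l i *: s`_i) = \sum_i l i *: f s`_i.
Proof.
elim: s => [|p s IH] fa l l0 l1.
  by move: l1; rewrite big_ord0 => /eqP; rewrite eq_sym oner_eq0.
have sub x : hull s x -> hull (p :: s) x.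
  move=> [k [k0 k1 ->]].
  exists (fun i => if unlift ord0 i is Some j then k j else 0); split.
  - by move=> i; case: unliftP.
  - rewrite big_ord_recl unlift_none add0r -k1.
    by apply: eq_bigr => i _; rewrite liftK.
  - rewrite big_ord_recl unlift_none scale0r add0r.
    by apply: eq_bigr => i _; rewrite liftK.
have hp : hull (p :: s) p.
  exists (fun i => (i == ord0)%:R); split.
  - by move=> i; rewrite ler0n.
  - by rewrite big_ord_recl eqxx big1 ?addr0// => i _; rewrite lift_eqF.
  - by rewrite big_ord_recl eqxx scale1r big1 ?addr0// => i _; rewrite lift_eqF scale0r.
have fs : affine_on (hull s) f.
  by move=> x y t /sub xs /sub ys; apply: fa.
move: l1; rewrite !big_ord_recl /= => l1; set q := l ord0.
have [q1|q1] := eqVneq q 1.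
  have z i : l (lift ord0 i) = 0.
    have /eqP : \sum_(i < size s) l (lift ord0 i) = 0.
      by move: l1; rewrite -/q q1 => /(canRL (addKr _)); rewrite addNr.
    by rewrite psumr_eq0// => /allP/(_ i); rewrite mem_index_enum => /(_ isT)/eqP.
  by rewrite q1 !scale1r !big1 ?addr0// => i _; rewrite z scale0r.
have q0 : 0 <= q by apply: l0.
have qlt : 0 < 1 - q.
  rewrite subr_gt0 lt_neqAle q1 /= -l1 lerDl sumr_ge0//.
pose k i := l (lift ord0 i) / (1 - q).
have k1 : \sum_(i < size s) k i = 1.
  rewrite -mulr_suml (_ : \sum_i _ = 1 - q) ?divff ?gt_eqF//.
  by rewrite -l1 addrAC subrr add0r.
have k0 i : 0 <= k i by rewrite divr_ge0// ltW.
have e m' (u : 'I_(size s) -> 'rV[R]_m') : \sum_i l (lift ord0 i) *: u i =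
    (1 - q) *: \sum_i k i *: u i.
  rewrite scaler_sumr; apply: eq_bigr => i _.
  by rewrite scalerA mulrC divfK ?gt_eqF.
rewrite !e fa//; last 2 first.
- by apply: sub; exists k.
- by rewrite q0 -subr_ge0 ltW.
by rewrite IH.
Qed.

End ComplexCones.

(** * Homogeneous isomorphisms of cones over complexes, and barycentric subdivision *)

Section Spheres.
Variable R : realType.

Definition hiso a b (C : 'rV[R]_a -> Prop) (C' : 'rV[R]_b -> Prop) :=
  exists A B, [/\ hpl C A, hpl C' B, forall x, C x -> C' (A x),
    forall y, C' y -> C (B y) &
    (forall x, C x -> B (A x) = x) /\ forall y, C' y -> A (B y) = y].

Lemma vpl_hiso a b (C : 'rV[R]_a -> Prop) (C' : 'rV[R]_b -> Prop) A :
  vpl C A -> (forall x, C x -> C' (A x)) ->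
  (forall x y, C x -> C y -> A x = A y -> x = y) ->
  (forall y, C' y -> exists2 x, C x & A x = y) -> hiso C C'.
Proof.
move=> vA CA Ainj Asurj.
have /choice[B hB] y : exists x, C' y -> C x /\ A x = y.
  have [/Asurj[x Cx xy]|nC] := pselect (C' y); first by exists x.
  by exists 0.
have CB y : C' y -> C (B y) by case/hB.
have BK y : C' y -> A (B y) = y by case/hB.
have AK x : C x -> B (A x) = x.
  by move=> Cx; apply: Ainj => //; [apply/CB/CA | apply/BK/CA].
exists A, B; split=> //; first exact: vpl_hpl.
by apply/vpl_hpl/(vpl_inv vA).
Qed.

Lemma hiso_comp a b c (C : 'rV[R]_a -> Prop) (C' : 'rV[R]_b -> Prop)
    (C'' : 'rV[R]_c -> Prop) : hiso C C' -> hiso C' C'' -> hiso C C''.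
Proof.
move=> [A [B [hA hB CA CB [AK BK]]]] [A' [B' [hA' hB' CA' CB' [AK' BK']]]].
exists (A' \o A), (B \o B'); split.
- exact: hpl_comp hA hA' CA.
- exact: hpl_comp hB' hB CB'.
- by move=> x /CA /CA'.
- by move=> y /CB' /CB.
- split=> [x Cx|y Cy] /=; first by rewrite AK' ?AK//; apply: CA.
  by rewrite BK ?BK'//; apply: CB'.
Qed.

Lemma kcone_csum_gt0 (V : finType) (K : {set {set V}}) (x : 'rV[R]_#|V|) :
  kcone K x -> x != 0 -> 0 < csum x.
Proof.
move=> [x0 _] xn; rewrite lt0r sumr_ge0// andbT.
by apply: contraNneq xn => /csum_eq0->.
Qed.

Lemma kcone0 (V : finType) (K : {set {set V}}) : kcone K (0 : 'rV[R]_#|V|).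
Proof. by split=> [j|]; rewrite ?mxE// supp0 !inE eqxx. Qed.

Lemma kcone_normalize (V : finType) (K : {set {set V}}) (x : 'rV[R]_#|V|) :
  is_complex K -> kcone K x -> x != 0 -> realization R K ((csum x)^-1 *: x).
Proof.
move=> cK Kx x0; have c0 := kcone_csum_gt0 Kx x0.
apply/realizationP => //; split; first by apply: kcone_scale; rewrite ?invr_gt0.
by rewrite csumZ mulVf// gt_eqF.
Qed.

(** The homogeneous extension of f. All points of a realization have coordinate sum 1, so the cone
    over a polytope on which f is affine is generated by the same points, and the extension is
    linear there. *)
Lemma kcone_hiso (V W : finType) (K : {set {set V}}) (L : {set {set W}}) :
  is_complex K -> is_complex L ->
  pl_homeo (realization R K) (realization R L) ->
  hiso (@kcone R V K) (@kcone R W L).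
Proof.
move=> cK cL [f [[S [KS Sf]] [fun_f inj_f surj_f]]].
pose A (x : 'rV[R]_#|V|) : 'rV[R]_#|W| := csum x *: f ((csum x)^-1 *: x).
have A0 : A 0 = 0 by rewrite /A csum0 scale0r.
have Kf x : realization R K x -> realization R L (f x) by move=> /fun_f.
have SK s x : s \in S -> hull s x -> realization R K x.
  by move=> sS sx; rewrite KS; exists s.
have hull_in (s : seq 'rV[R]_#|V|) p : p \in s -> hull s p.
  move=> ps; have ip : (index p s < size s)%N by rewrite index_mem.
  exists (fun i => (i == Ordinal ip)%:R); split.
  - by move=> i; rewrite ler0n.
  - by rewrite (bigD1 (Ordinal ip))//= eqxx big1 ?addr0// => i /negbTE->.
  - rewrite (bigD1 (Ordinal ip))//= eqxx scale1r nth_index// big1 ?addr0//.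
    by move=> i /negbTE->; rewrite scale0r.
have S1 s p : s \in S -> p \in s -> csum p = 1.
  by move=> sS /hull_in /(SK _ _ sS) /(realizationP _ cK)[].
have csL x : realization R K x -> csum (f x) = 1.
  by move=> /Kf /(realizationP _ cL)[].
have csA x : kcone K x -> csum (A x) = csum x.
  move=> Kx; have [->|x0] := eqVneq x 0; first by rewrite A0 !csum0.
  by rewrite csumZ csL ?mulr1//; apply: kcone_normalize.
have A_comb s (l : 'I_(size s) -> R) : s \in S -> (forall i, 0 <= l i) ->
    A (\sum_i l i *: s`_i) = \sum_i l i *: f s`_i.
  move=> sS l0.
  have cs : csum (\sum_i l i *: s`_i) = \sum_i l i.
    rewrite csum_sum; apply: eq_bigr => i _.
    by rewrite csumZ (S1 s) ?mulr1// mem_nth.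
  have [c0|c0] := eqVneq (\sum_i l i) 0.
    have z i : l i = 0.
      move/eqP: c0; rewrite psumr_eq0// => /allP/(_ i).
      by rewrite mem_index_enum => /(_ isT)/eqP.
    by rewrite !big1 ?A0// => i _; rewrite z scale0r.
  have cp : 0 < \sum_i l i by rewrite lt0r c0 sumr_ge0.
  rewrite /A cs scaler_sumr.
  have -> : \sum_i (\sum_j l j)^-1 *: (l i *: s`_i) =
      \sum_i ((\sum_j l j)^-1 * l i) *: s`_i.
    by apply: eq_bigr => i _; rewrite scalerA.
  rewrite (affine_comb (Sf s sS)).
  - rewrite scaler_sumr; apply: eq_bigr => i _.
    by rewrite scalerA mulrA mulfV// mul1r.
  - by move=> i; rewrite mulr_ge0// invr_ge0 ltW.
  - by rewrite -mulr_sumr mulVf.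
(* The empty list generates the origin, which no member of S may cover when the complex is empty. *)
have Kgcone x : kcone K x <-> exists2 G, G \in [::] :: S & gcone G x.
  split=> [Kx|[G]].
    have [->|x0] := eqVneq x 0; first by exists [::]; rewrite ?mem_head.
    have := kcone_normalize cK Kx x0; rewrite KS => -[s sS [l [l0 l1 e]]].
    exists s; first by rewrite inE sS orbT.
    have c0 := kcone_csum_gt0 Kx x0.
    apply/gconeP; exists (fun i => csum x * l i); split=> [i|].
      by rewrite mulr_ge0// ltW.
    rewrite -[LHS](scalerKV (lt0r_neq0 c0)) e scaler_sumr.
    by apply: eq_bigr => i _; rewrite scalerA.
  rewrite inE => /predU1P[->->|GS]; first exact: kcone0.
  move=> /gconeP[l [l0 ->]].
  have [c0|c0] := eqVneq (\sum_i l i) 0.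
    have z i : l i = 0.
      move/eqP: c0; rewrite psumr_eq0// => /allP/(_ i).
      by rewrite mem_index_enum => /(_ isT)/eqP.
    by rewrite big1 => [|i _]; [exact: kcone0 | rewrite z scale0r].
  have cp : 0 < \sum_i l i by rewrite lt0r c0 sumr_ge0.
  rewrite -[X in kcone _ X](scalerKV c0); apply: kcone_scale => //.
  suff /(SK _ _ GS)/(realizationP _ cK)[] :
    hull G ((\sum_i l i)^-1 *: \sum_i l i *: G`_i) by [].
  exists (fun i => (\sum_i l i)^-1 * l i); split.
  - by move=> i; rewrite mulr_ge0// invr_ge0 ltW.
  - by rewrite -mulr_sumr mulVf.
  - by rewrite scaler_sumr; apply: eq_bigr => i _; rewrite scalerA.
apply: (@vpl_hiso _ _ _ _ A).
- exists ([::] :: S); split=> // G.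
  rewrite inE => /predU1P[->|GS]; first by exists 0 => x ->; rewrite mul0mx.
  have [|M hM] := @linear_extension R _ _ G (fun i => f G`_i).
    move=> l e; pose lp i := Num.max (l i) 0; pose ln i := Num.max (- l i) 0.
    have lp0 i : 0 <= lp i by rewrite le_max lexx orbT.
    have ln0 i : 0 <= ln i by rewrite le_max lexx orbT.
    have lE i : l i = lp i - ln i.
      by rewrite /lp /ln !maxEle; case: ifP; case: ifP; lra.
    have spl m (u : 'I_(size G) -> 'rV[R]_m) :
        \sum_i l i *: u i = \sum_i lp i *: u i - \sum_i ln i *: u i.
      by rewrite -sumrB; apply: eq_bigr => i _; rewrite lE scalerBl.
    rewrite spl -!A_comb//; move: e; rewrite spl => /eqP; rewrite subr_eq0.
    by move=> /eqP->; rewrite subrr.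
  exists M => x /gconeP[l [l0 ->]]; rewrite A_comb// mulmx_suml.
  by apply: eq_bigr => i _; rewrite hM scalemxAl.
- move=> x Kx; have [->|x0] := eqVneq x 0; first by rewrite A0; apply: kcone0.
  rewrite /A; apply: kcone_scale; first exact: kcone_csum_gt0 Kx x0.
  by have /Kf/(realizationP _ cL)[] := kcone_normalize cK Kx x0.
- move=> x y Kx Ky xy; have cxy : csum x = csum y by rewrite -csA// xy csA.
  have [x0|x0] := eqVneq x 0.
    rewrite x0; apply/esym/csum_eq0; first by case: Ky.
    by rewrite -cxy x0 csum0.
  have cx := kcone_csum_gt0 Kx x0.
  have y0 : y != 0.
    by apply: contraTneq cx => y0; rewrite cxy y0 csum0 ltxx.
  have /inj_f e : f ((csum x)^-1 *: x) = f ((csum y)^-1 *: y).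
    have := congr1 (fun z => (csum x)^-1 *: z) xy.
    by rewrite /A -cxy !scalerA mulVf ?gt_eqF// !scale1r.
  have := e (classical_sets.mem_set (kcone_normalize cK Kx x0))
            (classical_sets.mem_set (kcone_normalize cK Ky y0)).
  rewrite -cxy => /(congr1 (fun z => csum x *: z)).
  by rewrite !scalerA mulfV ?gt_eqF// !scale1r.
- move=> y Ly; have [->|y0] := eqVneq y 0; first by exists 0 => //; apply: kcone0.
  have cy := kcone_csum_gt0 Ly y0.
  have [x Kx fx] := surj_f _ (kcone_normalize cL Ly y0).
  have [kx x1] := (realizationP _ cK).1 Kx.
  exists (csum y *: x); first exact: kcone_scale.
  rewrite /A csumZ x1 mulr1 scalerA mulVf ?gt_eqF// scale1r fx.
  by rewrite scalerA mulfV ?gt_eqF// scale1r.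
Qed.

Section Barycentric.
Variables (V : finType) (Y : {set {set V}}).
Hypothesis cY : is_complex Y.

(** A vertex s of the subdivision goes to the sum of the vertices of s instead of their average; it
    spans the same ray, which is enough for an isomorphism of cones. *)
Definition bary_mx : 'M[R]_(#|{: {set V}}|, #|V|) :=
  \matrix_(i, j) (enum_val j \in (enum_val i : {set V}))%:R.

Lemma bary_mxE (x : 'rV[R]_#|{: {set V}}|) v :
  (x *m bary_mx) 0 (enum_rank v) =
  \sum_(s : {set V} | v \in s) x 0 (enum_rank s).
Proof.
rewrite mxE (reindex (@enum_rank {set V})) /=; last first.
  by exists enum_val => s _; rewrite ?enum_rankK ?enum_valK.
rewrite [RHS]big_mkcond; apply: eq_bigr => s _.
by rewrite mxE !enum_rankK; case: ifP; rewrite ?mulr1 ?mulr0.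
Qed.

Lemma vtx_bary (s : {set V}) v : (vtx R s *m bary_mx) 0 (enum_rank v) = (v \in s)%:R.
Proof.
rewrite bary_mxE; case: (boolP (v \in s)) => vs.
  rewrite (bigD1 s)//= vtxE eqxx big1 ?addr0// => t /andP[_ ts].
  by rewrite vtxE (negbTE ts).
by rewrite big1// => t vt; rewrite vtxE; case: eqP => // e; rewrite -e vt in vs.
Qed.

Lemma chainP (x : 'rV[R]_#|{: {set V}}|) : kcone (bary Y) x ->
  [/\ forall s, 0 <= x 0 (enum_rank s), forall s, s \in supp x -> s \in Y &
    forall s t, s \in supp x -> t \in supp x -> (s \subset t) || (t \subset s)].
Proof.
move=> [x0 xY]; split=> [s|s|s t]; first exact: x0.
  move: xY; rewrite in_setU1 => /predU1P[->|]; first by rewrite inE.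
  by rewrite inE => /and3P[_ /subsetP xY _] /xY.
move: xY; rewrite in_setU1 => /predU1P[->|]; first by rewrite inE.
by rewrite inE => /and3P[_ _ /forall_inP xc] /xc /forall_inP; apply.
Qed.

Lemma kcone_bary_of (x : 'rV[R]_#|{: {set V}}|) :
  (forall s, 0 <= x 0 (enum_rank s)) -> (forall s, s \in supp x -> s \in Y) ->
  (forall s t, s \in supp x -> t \in supp x -> (s \subset t) || (t \subset s)) ->
  kcone (bary Y) x.
Proof.
move=> x0 xY xc; split=> [j|]; first by rewrite -[j]enum_valK.
rewrite in_setU1 inE; case: eqP => //= _; apply/andP; split.
  by apply/subsetP.
by apply/forall_inP => s sx; apply/forall_inP => t tx; apply: xc.
Qed.

(** The image determines the top of the chain carrying x, as its support, and the coefficient there,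
    as its least nonzero coordinate: that coordinate occurs at a vertex lying in no smaller member
    of the chain. Peeling off tops then proves injectivity. *)
Lemma bary_top (x : 'rV[R]_#|{: {set V}}|) : kcone (bary Y) x -> x != 0 ->
  let s := supp (x *m bary_mx) in
  [/\ s \in supp x, forall t, t \in supp x -> t \subset s,
    forall v, v \in s -> x 0 (enum_rank s) <= (x *m bary_mx) 0 (enum_rank v) &
    exists2 v, v \in s & x 0 (enum_rank s) = (x *m bary_mx) 0 (enum_rank v)].
Proof.
move=> Kx x0; have [xge xY xc] := chainP Kx.
have [s0 s0x] : exists s, s \in supp x.
  by apply/set0Pn; rewrite supp_eq_set0.
have [s sx smax] := arg_maxnP (fun s : {set V} => #|s|) s0x.
have sub t : t \in supp x -> t \subset s.
  move=> tx; have /orP[//|st] := xc _ _ tx sx.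
  suff /eqP<- : s == t by [].
  by rewrite eqEcard st; apply: smax.
have sum_s v : v \in s -> (x *m bary_mx) 0 (enum_rank v) =
    x 0 (enum_rank s) + \sum_(t : {set V} | (v \in t) && (t != s)) x 0 (enum_rank t).
  by move=> vs; rewrite bary_mxE (bigD1 s).
have xs0 : 0 < x 0 (enum_rank s) by rewrite lt0r xge andbT -in_supp.
have sE : supp (x *m bary_mx) = s.
  apply/setP => v; rewrite in_supp; have [vs|vs] := boolP (v \in s).
    by rewrite sum_s// gt_eqF// ltr_wpDr// sumr_ge0.
  rewrite bary_mxE big1 ?eqxx// => t vt; apply/supp_eq0.
  by apply: contraNN vs => /sub/subsetP/(_ v vt).
rewrite /= sE; split=> //.
  by move=> v vs; rewrite sum_s// lerDl sumr_ge0.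
have sn0 : s != set0.
  by apply: contraTneq (xY _ sx) => ->; case: cY.
have [/existsP[t1 /andP[t1x t1s]]|] := boolP [exists t, (t \in supp x) && (t != s)].
  have t1P : (t1 \in supp x) && (t1 != s) by rewrite t1x.
  have [t /andP[tx ts] tmax] := @arg_maxnP _ t1 (fun t => (t \in supp x) && (t != s))
     (fun s : {set V} => #|s|) t1P.
  have : t \proper s by rewrite properEneq ts sub.
  move=> /properP[_ [v vs vt]]; exists v => //; rewrite sum_s// big1 ?addr0//.
  move=> u /andP[vu us]; apply: supp_eq0; apply: contraNN vt => ux.
  have /orP[/subsetP->//|tu] := xc _ _ ux tx.
  suff /eqP-> : t == u by [].
  by rewrite eqEcard tu; apply: tmax; rewrite ux.
rewrite negb_exists => /forallP xs1; have [v vs] := set0Pn _ sn0.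
exists v => //; rewrite sum_s// big1 ?addr0// => t /andP[_ ts].
by apply: supp_eq0; have := xs1 t; rewrite ts andbT.
Qed.

Lemma bary_inj (x y : 'rV[R]_#|{: {set V}}|) : kcone (bary Y) x -> kcone (bary Y) y ->
  x *m bary_mx = y *m bary_mx -> x = y.
Proof.
have [k] := ubnP #|supp x|; elim: k => // k IH in x y *.
move=> xk Kx Ky xy; have [x0|x0] := eqVneq x 0.
  have [->//|y0] := eqVneq y 0.
  have [sy _ _ _] := bary_top Ky y0; move: sy; rewrite -xy x0 mul0mx supp0.
  have [_ yY _] := chainP Ky; move=> /yY; by case: cY => /negbTE->.
have [y0|y0] := eqVneq y 0.
  have [sy _ _ _] := bary_top Kx x0; move: sy; rewrite xy y0 mul0mx supp0.
  have [_ yY _] := chainP Kx; move=> /yY; by case: cY => /negbTE->.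
have [sx xsub xle [v vs xv]] := bary_top Kx x0.
have [sy ysub yle [w ws yw]] := bary_top Ky y0; move: sx xsub xle vs xv.
rewrite xy; set s := supp (y *m bary_mx) in sy ysub yle ws yw *.
move=> sx xsub xle vs xv.
have e : x 0 (enum_rank s) = y 0 (enum_rank s).
  by apply/le_anti; rewrite {1}yw xle// xv yle.
set c := x 0 (enum_rank s) in e.
have subE (z : 'rV[R]_#|{: {set V}}|) t : z 0 (enum_rank s) = c ->
    (z - c *: vtx R s) 0 (enum_rank t) = if t == s then 0 else z 0 (enum_rank t).
  move=> zs; rewrite !mxE (inj_eq enum_rank_inj) eqxx /=.
  by case: eqP => [->|_]; rewrite ?zs ?mulr1 ?subrr// mulr0 subr0.
have sub_supp (z : 'rV[R]_#|{: {set V}}|) t : z 0 (enum_rank s) = c ->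
    (t \in supp (z - c *: vtx R s)) = (t != s) && (t \in supp z).
  by move=> zs; rewrite !in_supp subE//; case: (t == s); rewrite ?eqxx.
have Ksub z : kcone (bary Y) z -> z 0 (enum_rank s) = c ->
    kcone (bary Y) (z - c *: vtx R s).
  move=> /chainP[z0 zY zc] zs; apply: kcone_bary_of.
  - by move=> t; rewrite subE//; case: ifP.
  - by move=> t; rewrite sub_supp// => /andP[_ /zY].
  - by move=> t u; rewrite !sub_supp// => /andP[_ tz] /andP[_ uz]; apply: zc.
apply: (addIr (- (c *: vtx R s))); apply: IH; try exact: Ksub.
- rewrite -ltnS; apply: leq_trans xk; rewrite ltnS; apply: proper_card.
  apply/properP; split.
    by apply/subsetP => t; rewrite sub_supp// => /andP[].
  by exists s; rewrite // sub_supp// eqxx.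
- by rewrite !mulmxBl xy.
Qed.

(** The layer decomposition of u: its least nonzero coordinate times the indicator of its support is
    removed repeatedly, and the supports met form a chain. *)
Lemma bary_surj (u : 'rV[R]_#|V|) : kcone Y u ->
  exists x, [/\ kcone (bary Y) x, x *m bary_mx = u &
    forall s, s \in supp x -> s \subset supp u].
Proof.
have [k] := ubnP #|supp u|; elim: k => // k IH in u *.
move=> uk [u0 uY]; have [->|un] := eqVneq u 0.
  exists 0; split=> [||s]; rewrite ?mul0mx ?supp0 ?inE//; exact: kcone0.
pose s := supp u.
have sY : s \in Y by move: uY; rewrite in_setU1 supp_eq_set0 (negbTE un).
have [v0 v0s] : exists v, v \in s by apply/set0Pn; rewrite supp_eq_set0.
have [v vs vmin] := arg_minP (fun v => u 0 (enum_rank v)) v0s.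
have {}vs : v \in s := vs.
set c := u 0 (enum_rank v) in vmin.
have c0 : 0 < c by rewrite lt0r u0 andbT -in_supp.
pose w : 'rV[R]_#|V| := u - c *: (vtx R s *m bary_mx).
have wE t : w 0 (enum_rank t) = if t \in s then u 0 (enum_rank t) - c else 0.
  have -> : w 0 (enum_rank t) = u 0 (enum_rank t)
      - c * (vtx R s *m bary_mx) 0 (enum_rank t) by rewrite 3!mxE.
  rewrite vtx_bary; case: ifP => ts; rewrite ?mulr1// mulr0 subr0.
  by rewrite supp_eq0// ts.
have ws : supp w \subset s.
  by apply/subsetP => t; rewrite in_supp wE; case: ifP; rewrite ?eqxx.
have wp : supp w \proper s.
  apply/properP; split=> //; exists v => //.
  by rewrite in_supp wE vs subrr eqxx.
have Kw : kcone Y w.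
  split=> [j|]; first by rewrite -[j]enum_valK wE; case: ifP => // ts; rewrite subr_ge0 vmin.
  rewrite in_setU1; case: eqP => //= /eqP w0.
  by case: cY => _ /(_ _ _ sY ws w0).
have [|x [Kx xw xs]] := IH w _ Kw.
  by rewrite -ltnS; apply: leq_trans uk; rewrite ltnS; apply: proper_card.
have sx : s \notin supp x.
  by apply/negP => /xs sw; move: wp; rewrite properE sw andbF.
have yE t : (x + c *: vtx R s) 0 (enum_rank t) =
    if t == s then c else x 0 (enum_rank t).
  rewrite 2!mxE vtxE; case: eqP => [->|_]; last by rewrite mulr0 addr0.
  by rewrite (supp_eq0 sx) mulr1 add0r.
have ys t : (t \in supp (x + c *: vtx R s)) = (t == s) || (t \in supp x).
  by rewrite !in_supp yE; case: (t =P s) => //= _; rewrite gt_eqF.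
have [x0 xY xc] := chainP Kx.
exists (x + c *: vtx R s); split.
- apply: kcone_bary_of.
  + by move=> t; rewrite yE; case: ifP => // _; apply: ltW.
  + by move=> t; rewrite ys => /predU1P[->//|/xY].
  + move=> t t'; rewrite !ys => /predU1P[->|tx] /predU1P[->|t'x].
    * by rewrite subxx.
    * by rewrite (subset_trans (xs _ t'x) ws) orbT.
    * by rewrite (subset_trans (xs _ tx) ws).
    * exact: xc.
- by rewrite mulmxDl xw -scalemxAl subrK.
- move=> t; rewrite ys => /predU1P[->|/xs tw]; first exact: subxx.
  exact: subset_trans tw ws.
Qed.

Lemma bary_hiso : hiso (@kcone R _ (bary Y)) (@kcone R V Y).
Proof.
apply: (@vpl_hiso _ _ _ _ (fun x => x *m bary_mx)) => //.
- exists [seq [seq vtx R s | s <- enum c] | c : {set {set V}} in set0 |: bary Y].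
  split=> [x|_ /imageP[c _ ->]]; last by exists bary_mx.
  split=> [Kx|[_ /imageP[c cB ->] /gcone_vtx[x0 xc]]].
    exists [seq vtx R s | s <- enum (supp x)]; last by apply/gcone_vtx; case: Kx.
    by apply/imageP; exists (supp x); case: Kx.
  split=> //; have [_ bs] := bary_complex Y.
  move: cB; rewrite !in_setU1 => /predU1P[c0|cB].
    by move: xc; rewrite c0 subset0 => ->.
  by case: (eqVneq (supp x) set0) => //= xn0; apply: bs cB xc xn0.
- move=> x Kx; have [->|x0] := eqVneq x 0; first by rewrite mul0mx; apply: kcone0.
  have [xge xY _] := chainP Kx; have [sx _ _ _] := bary_top Kx x0.
  split=> [j|]; last by rewrite in_setU1 (xY _ sx) orbT.
  by rewrite -[j]enum_valK bary_mxE sumr_ge0.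
- exact: bary_inj.
- by move=> u /bary_surj[x [Kx xu _]]; exists x.
Qed.

End Barycentric.
End Spheres.

(** * Purity and links of combinatorial spheres *)

Section SphereLinks.
Variable R : realType.
Variables (V : finType) (Y : {set {set V}}) (n : nat).
Hypothesis sY : combinatorial_sphere R Y n.

Lemma sphere_hiso : hiso (@kcone R V Y) (@bd_orthant R #|'I_n.+1|).
Proof.
have [cY h] := sY; have := kcone_hiso cY (bd_simplex_complex n) h.
by rewrite (_ : @kcone R _ (bd_simplex n) = @bd_orthant R _)//;
  apply: funext => x; apply/propext/kcone_bd.
Qed.

Definition ranks (s : {set V}) : {set 'I_#|V|} := [set enum_rank v | v in s].

Lemma card_ranks s : #|ranks s| = #|s|.
Proof. by rewrite card_imset//; apply: enum_rank_inj. Qed.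

Lemma mem_ranks s v : (enum_rank v \in ranks s) = (v \in s).
Proof. by rewrite mem_imset//; apply: enum_rank_inj. Qed.

Lemma sphere_card_le s : s \in Y -> (#|s| <= n)%N.
Proof.
have [[Y0 Yc] _] := sY; have [A [B [hA hB CA CB [AK BK]]]] := sphere_hiso.
move=> sIn; have [||X [M [XM hX]]] := hpl_open_piece (S := ranks s) hA.
- by move=> x y Kx Ky xy; rewrite -[x]AK// xy AK.
- move=> x xS xN; split=> [j|].
    have [/xS/ltW//|/xN->//] := boolP (j \in ranks s).
  rewrite in_setU1 (_ : supp x = s) ?sIn ?orbT//; apply/setP => v.
  rewrite in_supp -mem_ranks; case: (boolP (_ \in ranks s)) => [/xS/gt_eqF->//|/xN->].
  by rewrite eqxx.
have Crow i : bd_orthant (row i (X *m M)).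
  have [k|Cl Al] := hX (delta_mx 0 i); first by rewrite mxE ler0n.
  by rewrite rowE mulmxA -Al; apply: CA.
(* The sum of the rows of [X *m M] is in the boundary of the orthant, so some coordinate j of it is
   0. The rows being nonnegative, the whole column j vanishes; the independent rows live in the
   other n columns. *)
have [k|Cl Al] := hX (const_mx 1); first by rewrite mxE ler01.
have := CA _ Cl; rewrite Al -mulmxA => -[_ [j]]; rewrite mxE => /eqP.
rewrite psumr_eq0 => [|i _]; last first.
  by have [r0 _] := Crow i; rewrite mxE mul1r; have := r0 j; rewrite mxE.
move=> /allP z; have {}z i : (X *m M) i j = 0.
  by have := z i; rewrite mem_index_enum mxE mul1r => /(_ isT)/eqP.
have : row_free (col' j (X *m M)).
  apply: inj_row_free => l lX.
  have : l *m (X *m M) = 0.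
    apply/rowP => k; rewrite [RHS]mxE; case: (unliftP j k) => [k' ->|->].
      have /rowP/(_ k') := lX; rewrite [RHS]mxE => <-.
      by rewrite !mxE; apply: eq_bigr => i _; rewrite [in RHS]mxE.
    by rewrite mxE big1// => i _; rewrite z mulr0.
  by move/eqP: XM => XM l0; apply: (row_free_inj (introT eqP XM)); rewrite l0 mul0mx.
rewrite -card_ranks => /eqP {1}<-; apply: leq_trans (rank_leq_col _) _.
by rewrite card_ord.
Qed.

(** Let t be maximal over s and p its indicator. By maximality all tangent directions at p are
    supported in t, while the derivative of the inverse map embeds an open n-dimensional cone of
    directions of [bd_orthant] into them; hence n is at most [#|t|]. *)
Lemma sphere_pure s : s \in set0 |: Y ->
  exists2 t, t \in set0 |: Y & s \subset t /\ #|t| = n.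
Proof.
move=> sIn; have [[Y0 Yc] _] := sY; have [A [B [hA hB CA CB [AK BK]]]] := sphere_hiso.
have P0 : (s \in set0 |: Y) && (s \subset s) by rewrite sIn subxx.
have [t /andP[tY st] tmax] := @arg_maxnP _ s
  (fun t => (t \in set0 |: Y) && (s \subset t)) (fun t : {set V} => #|t|) P0.
exists t => //; split=> //; apply/eqP; rewrite eqn_leq; apply/andP; split.
  by move: tY; rewrite in_setU1 => /predU1P[->|/sphere_card_le//]; rewrite cards0.
pose p : 'rV[R]_#|V| := \sum_v (v \in t)%:R *: vtx R v.
have pE v : p 0 (enum_rank v) = (v \in t)%:R by rewrite sum_vtxE.
have pt : supp p = t.
  by apply/setP => v; rewrite in_supp pE pnatr_eq0 eqb0 negbK.
have Kp : kcone Y p.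
  by split; rewrite ?pt// => j; rewrite -[j]enum_valK pE ler0n.
have tP d : tcone (kcone Y) p d -> supp d \subset t.
  move=> /(tcone_kcone _ Kp)[_]; rewrite pt => tdY.
  have := tmax (t :|: supp d); rewrite tdY (subset_trans st (subsetUl _ _)) /=.
  move=> /(_ isT) le; have /eqP e : t == t :|: supp d by rewrite eqEcard subsetUl.
  by rewrite e subsetUr.
have [D [hD DT Dinj _]] := tangent_bijection hB hA CB CA BK AK (CA _ Kp).
rewrite AK// in DT.
have [_ [i qi]] := CA _ Kp.
have [//||X [M [XM hX]]] := hpl_open_piece (S := [set~ i]) hD.
  move=> x xS xN; apply/tcone_bd_orthant; first exact: CA.
  split=> [j _|]; last by exists i; rewrite // xN// !inE eqxx.
  have [->|ji] := eqVneq j i; first by rewrite xN// !inE eqxx.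
  by apply/ltW/xS; rewrite !inE.
have : (#|[set~ i]| <= #|t|)%N; last first.
  by rewrite cardsC1 !card_ord.
pose Q : 'M[R]_(#|V|, #|t|) := \matrix_(a, b) (a == enum_rank (enum_val b))%:R.
have QE (x : 'rV[R]_#|V|) b : (x *m Q) 0 b = x 0 (enum_rank (enum_val b)).
  rewrite mxE (bigD1 (enum_rank (enum_val b)))//= mxE eqxx mulr1 big1 ?addr0//.
  by move=> a ab; rewrite mxE (negbTE ab) mulr0.
have : row_free (X *m M *m Q).
  apply: inj_row_free => l; rewrite mulmxA => lQ.
  apply: (row_free_inj XM); rewrite mul0mx; apply: row_ext => v; rewrite [RHS]mxE.
  have [vt|vt] := boolP (v \in t).
    have /rowP/(_ (enum_rank_in vt v)) := lQ.
    by rewrite QE enum_rankK_in// => ->; rewrite mxE.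
  rewrite mxE big1// => k _; apply/eqP; rewrite mulf_eq0; apply/orP; right.
  have [k'|Cl Al] := hX (delta_mx 0 k); first by rewrite mxE ler0n.
  have := tP _ (DT _ Cl); rewrite Al -mulmxA -rowE => /subsetP/(_ v).
  by rewrite in_supp mxE (negbTE vt); case: eqP => // _ /(_ isT).
by move=> /eqP <-; apply: rank_leq_col.
Qed.

Lemma sphere_link p : kcone (bary Y) p ->
  exists E, [/\ hpl (tcone (kcone (bary Y)) p) E,
    forall d, tcone (kcone (bary Y)) p d -> @bd_orthant R #|'I_n.+1| (E d),
    forall d d', tcone (kcone (bary Y)) p d -> tcone (kcone (bary Y)) p d' ->
      E d = E d' -> d = d' &
    forall y, bd_orthant y -> exists2 d, tcone (kcone (bary Y)) p d & E d = y].
Proof.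
move=> Kp; have [cY _] := sY.
have [A [B [hA hB CA CB [AK BK]]]] := hiso_comp (bary_hiso R cY) sphere_hiso.
exact: bd_orthant_tangent hA hB CA CB AK BK Kp.
Qed.

(** A linear chart of the coordinate orthant on the positions c with signs s; the simplices of the
    links are to be mapped by such charts into the space of directions. *)
Definition signed_emb k (m : nat) (s : 'I_k -> bool) (c : 'I_k -> 'I_m)
    (l : 'rV[R]_k) : 'rV[R]_m :=
  \sum_j l 0 j *: ((-1) ^+ s j *: delta_mx 0 (c j)).

Lemma signed_embE k m s (c : 'I_k -> 'I_m) l j : injective c ->
  signed_emb s c l 0 (c j) = (-1) ^+ s j * l 0 j.
Proof.
move=> cI; rewrite summxE (bigD1 j)//= big1 ?addr0 => [|i ij].
  by rewrite !mxE !eqxx mulr1 mulrC.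
by rewrite !mxE (inj_eq cI) [j == i]eq_sym (negbTE ij) !mulr0.
Qed.

Lemma signed_emb0 k m s (c : 'I_k -> 'I_m) l i : i \notin codom c ->
  signed_emb s c l 0 i = 0.
Proof.
move=> ic; rewrite summxE big1// => j _; rewrite !mxE.
case: (i =P c j) => [e|]; last by rewrite ?andbF !mulr0.
by rewrite e codom_f in ic.
Qed.

Lemma norm1_signed_emb k m s (c : 'I_k -> 'I_m) (l : 'rV_k) : injective c ->
  (forall j, 0 <= l 0 j) -> norm1 (signed_emb s c l) = csum l.
Proof.
move=> cI l0; rewrite /norm1 (bigID (mem [set c j | j : 'I_k])) /=.
rewrite [X in _ + X]big1 ?addr0 => [|i ic]; last first.
  rewrite signed_emb0 ?normr0//; apply: contraNN ic => /codomP[j ->].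
  exact: imset_f.
rewrite big_imset /=; last by move=> i j _ _; apply: cI.
apply: eq_bigr => j _.
by rewrite signed_embE// normrM normrX normrN1 expr1n mul1r ger0_norm.
Qed.

Definition std_face k (l : 'rV[R]_k) := (forall j, 0 <= l 0 j) /\ csum l = 1.

Lemma hull_enum n' (T : finType) (c : {set T}) (g : T -> 'rV[R]_n') x :
  hull [seq g P | P <- enum c] x <-> exists l : T -> R,
    [/\ forall P, 0 <= l P, \sum_P l P = 1, forall P, P \notin c -> l P = 0 &
      x = \sum_P l P *: g P].
Proof.
have sz : size [seq g P | P <- enum c] = #|c| by rewrite size_map -cardE.
split=> [[l [l0 l1 ->]]|[l [l0 l1 lc ->]]].
  pose f P : R := if [pick j : 'I_#|c| | enum_val j == P] is Some j
     then l (cast_ord (esym sz) j) else 0.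
  have fE j : f (enum_val j) = l (cast_ord (esym sz) j).
    rewrite /f; case: pickP => [j' /eqP/enum_val_inj->//|/(_ j)].
    by rewrite eqxx.
  have fc P : P \notin c -> f P = 0.
    by rewrite /f; case: pickP => // j /eqP<-; rewrite enum_valP.
  have sumE m (u : T -> 'rV[R]_m) : \sum_P f P *: u P =
      \sum_(j < #|c|) l (cast_ord (esym sz) j) *: u (enum_val j).
    rewrite (bigID (mem c))/= [X in _ + X]big1 ?addr0 => [|P Pc]; last first.
      by rewrite fc ?scale0r.
    by rewrite big_enum_val /=; apply: eq_bigr => j _; rewrite fE.
  exists f; split=> //.
  - by move=> P; rewrite /f; case: pickP.
  - rewrite -l1 (bigID (mem c))/= [X in _ + X]big1 ?addr0 => [|P Pc]; last first.
      by rewrite fc.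
    rewrite big_enum_val /= [RHS](reindex (cast_ord (esym sz))) /=.
      by apply: eq_bigr => j _; rewrite fE.
    by apply: onW_bij; exists (cast_ord sz) => j; rewrite ?cast_ordK ?cast_ordKV.
  rewrite sumE (reindex (cast_ord (esym sz))) /=; last first.
    by apply: onW_bij; exists (cast_ord sz) => j; rewrite ?cast_ordK ?cast_ordKV.
  apply: eq_bigr => j _; congr (_ *: _).
  by rewrite (nth_map (enum_val j)) -?cardE//= -enum_val_nth.
exists (fun j => l (enum_val (cast_ord sz j))); split=> //.
  rewrite -l1 [RHS](bigID (mem c))/= [X in _ = _ + X]big1 ?addr0 => [|P /lc//].
  rewrite [RHS]big_enum_val /= [LHS](reindex (cast_ord (esym sz))) /=.
    by apply: eq_bigr => j _; rewrite cast_ordKV.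
  by apply: onW_bij; exists (cast_ord sz) => j; rewrite ?cast_ordK ?cast_ordKV.
rewrite (bigID (mem c))/= [X in _ + X = _]big1 ?addr0 => [|P /lc->]; last first.
  by rewrite scale0r.
rewrite [LHS]big_enum_val /= [RHS](reindex (cast_ord (esym sz))) /=; last first.
  by apply: onW_bij; exists (cast_ord sz) => j; rewrite ?cast_ordK ?cast_ordKV.
apply: eq_bigr => j _; rewrite cast_ordKV; congr (_ *: _).
by rewrite (nth_map (enum_val j)) -?cardE//= -enum_val_nth.
Qed.

Lemma sphere_link_pl p : kcone (bary Y) p ->
  exists F, [/\
    forall x, tcone (kcone (bary Y)) p x -> norm1 x = 1 ->
      realization R (bd_simplex n) (F x),
    forall x y, tcone (kcone (bary Y)) p x -> tcone (kcone (bary Y)) p y ->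
      norm1 x = 1 -> norm1 y = 1 -> F x = F y -> x = y,
    forall y, realization R (bd_simplex n) y ->
      exists x, [/\ tcone (kcone (bary Y)) p x, norm1 x = 1 & F x = y] &
    forall k (s : 'I_k -> bool) (c : 'I_k -> 'I_#|{: {set V}}|), injective c ->
      (forall l : 'rV_k, (forall j, 0 <= l 0 j) ->
         tcone (kcone (bary Y)) p (signed_emb s c l)) ->
      pl_on (@std_face k) (F \o signed_emb s c)].
Proof.
move=> Kp; have [E [hE ET Einj Esurj]] := sphere_link Kp.
have [T [r [chains [F [F1 F2 F3 F4 F5]]]]] :=
  radial_homeo hE ET Einj Esurj (fun y by_ => by_.1).
have rP y : realization R (bd_simplex n) y <-> bd_orthant y /\ csum y = 1.
  rewrite realizationP; last exact: bd_simplex_complex.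
  by split=> -[h ?]; split=> //; apply/kcone_bd.
exists F; split=> //.
- by move=> x Tx x1; apply/rP/F1.
- by move=> y /rP[]; apply: F3.
move=> k s c cI lT.
pose pre (x : 'rV[R]_#|{: {set V}}|) : 'rV[R]_k := \row_j ((-1) ^+ s j * x 0 (c j)).
have preK l : pre (signed_emb s c l) = l.
  by apply/rowP => j; rewrite mxE signed_embE// mulrA -expr2 sqrr_sign mul1r.
have pre_sum (l : T -> R) : pre (\sum_P l P *: r P) = \sum_P l P *: pre (r P).
  apply/rowP => j; rewrite mxE !summxE mulr_sumr; apply: eq_bigr => P _.
  by rewrite !mxE mulrCA.
have emb_sum (l : T -> R) (g : T -> 'rV[R]_k) :
    signed_emb s c (\sum_P l P *: g P) = \sum_P l P *: signed_emb s c (g P).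
  rewrite /signed_emb; under [RHS]eq_bigr do rewrite scaler_sumr.
  rewrite exchange_big /=; apply: eq_bigr => j _.
  rewrite summxE scaler_suml; apply: eq_bigr => P _.
  by rewrite [(l P *: g P) 0 j]mxE -scalerA.
have norm1_emb (l : 'rV_k) := @norm1_signed_emb _ _ s c l cI.
(* The rays in the signed orthant. By the sign clause of [radial_homeo], a point of the orthant is
   decomposed along such rays only, so the chains made of them cover the standard face, and the map
   is affine on each. *)
pose inface P := signed_emb s c (pre (r P)) = r P /\ forall j, 0 <= pre (r P) 0 j.
pose S := [seq [seq pre (r P) | P <- enum (ch : {set T})] |
  ch : {set T} <- enum chains & [forall P in ch, `[< inface P >]]].
have SP q : q \in S -> exists2 ch, ch \in chains &
    (forall P, P \in ch -> inface P) /\ q = [seq pre (r P) | P <- enum ch].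
  move=> /mapP[ch]; rewrite mem_filter mem_enum => /andP[/forall_inP hc chc] ->.
  by exists ch => //; split=> // P /hc /asboolP.
exists S; split.
  apply: funext => l; apply/propext; split=> [[l0 l1]|[q /SP[ch chc [chf ->]]]].
    pose x := signed_emb s c l.
    have x1 : norm1 x = 1 by rewrite norm1_emb.
    have [ch chc [l' [l'0 l'1 l'c xl sg]]] := F4 _ (lT _ l0) x1.
    exists [seq pre (r P) | P <- enum ch]; last first.
      apply/hull_enum; exists l'; split=> //.
      by rewrite -pre_sum -xl preK.
    apply/mapP; exists ch => //; rewrite mem_filter mem_enum chc andbT.
    apply/forall_inP => P Pch; apply/asboolP; split=> [|j].
      apply/rowP => i; have [/codomP[j ->]|ic] := boolP (i \in codom c).
        by rewrite signed_embE// mxE mulrA -expr2 sqrr_sign mul1r.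
      rewrite signed_emb0//; apply/esym/le_anti.
      have [h1 h2] := sg _ Pch i; have xi : x 0 i = 0 by rewrite /x signed_emb0.
      by rewrite h2 ?xi// h1 ?xi.
    have [h1 h2] := sg _ Pch (c j); rewrite mxE.
    have xc : x 0 (c j) = (-1) ^+ s j * l 0 j by rewrite /x signed_embE.
    move: h1 h2; rewrite xc; case: (s j); rewrite ?expr0 ?expr1 ?mulN1r ?mul1r.
      by move=> _; rewrite oppr_le0 oppr_ge0; apply.
    by move=> h1 _; apply: h1.
  move=> /hull_enum[l' [l'0 l'1 l'c ->]]; split=> [j|].
    rewrite summxE sumr_ge0// => P _; rewrite mxE.
    have [/chf[_ Pf]|/l'c->] := boolP (P \in ch); last by rewrite mul0r.
    by rewrite mulr_ge0.
  rewrite csum_sum -l'1; apply: eq_bigr => P _; rewrite csumZ.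
  have [Pch|/l'c->] := boolP (P \in ch); last by rewrite mul0r.
  have [e Pf] := chf _ Pch; rewrite -norm1_emb// e.
  by have [/(_ _ Pch)[_ ->] _] := F5 _ chc; rewrite mulr1.
move=> q /SP[ch chc [chf ->]].
have Fl (l : T -> R) : (forall P, 0 <= l P) -> \sum_P l P = 1 ->
    (forall P, P \notin ch -> l P = 0) ->
    F (signed_emb s c (\sum_P l P *: pre (r P))) = \sum_P l P *: F (r P).
  move=> l0 l1 lc; have [_ <-//] := F5 _ chc; congr F.
  rewrite emb_sum; apply: eq_bigr => P _.
  have [/chf[-> _]//|/lc->] := boolP (P \in ch); by rewrite !scale0r.
move=> x y t /hull_enum[l [l0 l1 lc ->]] /hull_enum[l' [l'0 l'1 l'c ->]] /andP[t0 t1] /=.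
rewrite [in RHS]Fl// [in RHS]Fl//.
have comb m (u : T -> 'rV[R]_m) :
    t *: (\sum_P l P *: u P) + (1 - t) *: (\sum_P l' P *: u P) =
    \sum_P (t * l P + (1 - t) * l' P) *: u P.
  rewrite !scaler_sumr -big_split; apply: eq_bigr => P _ /=.
  by rewrite !scalerA scalerDl.
rewrite !comb Fl//.
- by move=> P; rewrite addr_ge0// mulr_ge0// subr_ge0.
- rewrite big_split /= -!mulr_sumr l1 l'1; ring.
- by move=> P Pc; rewrite lc// l'c// !mulr0 addr0.
Qed.

End SphereLinks.

(** * Simplicial maps on realizations *)

Section RealizeMap.
Variable R : realType.

Lemma realize_mapE (V W : finType) (h : V -> W) (x : 'rV[R]_#|V|) w :
  realize_map h x 0 (enum_rank w) = \sum_(v | h v == w) x 0 (enum_rank v).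
Proof.
rewrite summxE [RHS]big_mkcond; apply: eq_bigr => v _.
by rewrite mxE vtxE eq_sym; case: eqP; rewrite ?mulr1 ?mulr0.
Qed.

Lemma realize_map_comb (V W I : finType) (h : V -> W) (l : I -> R) (c : I -> V) :
  realize_map h (\sum_k l k *: vtx R (c k)) = \sum_k l k *: vtx R (h (c k)).
Proof.
rewrite /realize_map.
have E v : (\sum_k l k *: vtx R (c k)) 0 (enum_rank v) *: vtx R (h v) =
    \sum_k (l k * (v == c k)%:R) *: vtx R (h v).
  rewrite summxE scaler_suml; apply: eq_bigr => k _.
  by rewrite mxE vtxE.
under eq_bigr do rewrite E.
rewrite exchange_big /=; apply: eq_bigr => k _.
rewrite (bigD1 (c k))//= eqxx mulr1 big1 ?addr0// => v /negbTE->.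
by rewrite mulr0 scale0r.
Qed.

Lemma csum_realize_map (V W : finType) (h : V -> W) (x : 'rV[R]_#|V|) :
  csum (realize_map h x) = csum x.
Proof.
rewrite {2}[x]row_vtx !csum_sum; apply: eq_bigr => v _.
by rewrite !csumZ !csum_vtx.
Qed.

Lemma realize_map_ge0 (V W : finType) (h : V -> W) (x : 'rV[R]_#|V|) :
  (forall j, 0 <= x 0 j) -> forall j, 0 <= realize_map h x 0 j.
Proof.
by move=> x0 j; rewrite -[j]enum_valK realize_mapE sumr_ge0.
Qed.

Lemma supp_realize_map (V W : finType) (h : V -> W) (x : 'rV[R]_#|V|) :
  (forall j, 0 <= x 0 j) -> supp (realize_map h x) = h @: supp x.
Proof.
move=> x0; apply/setP => w; rewrite in_supp realize_mapE psumr_eq0//.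
apply/idP/imsetP => [/allPn[v _]|[v vx ->]].
  by rewrite negb_imply => /andP[/eqP<- xv]; exists v; rewrite ?in_supp.
by apply/allPn; exists v; rewrite ?mem_index_enum// negb_imply eqxx -in_supp.
Qed.

Lemma realize_map_inj_coord (V W : finType) (h : V -> W) (x : 'rV[R]_#|V|) v :
  {in supp x &, injective h} -> v \in supp x ->
  realize_map h x 0 (enum_rank (h v)) = x 0 (enum_rank v).
Proof.
move=> hI vx; rewrite realize_mapE (bigD1 v)//= big1 ?addr0// => w /andP[/eqP e wv].
apply: supp_eq0; apply: contraNN wv => wx.
by apply/eqP/hI.
Qed.

Lemma realization_dual_face (V : finType) (Y : {set {set V}}) s x :
  is_complex Y -> s \in set0 |: Y -> realization R (dual_face Y s) x <->
  [/\ forall j, 0 <= x 0 j, csum x = 1 & supp x \in dual_face Y s].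
Proof.
move=> cY sY; rewrite realizationP; last exact: dual_face_complex.
split=> [[[x0 xD] x1]|[x0 x1 xD]]; last first.
  by split=> //; split=> //; rewrite in_setU1 xD orbT.
split=> //; move: xD; rewrite in_setU1 supp_eq_set0 => /predU1P[x00|//].
by move: x1; rewrite x00 csum0 => /eqP; rewrite eq_sym oner_eq0.
Qed.

Lemma realization_face_sub (V : finType) (Y : {set {set V}}) s t x :
  is_complex Y -> s \in set0 |: Y -> t \in set0 |: Y -> t \subset s ->
  realization R (dual_face Y s) x -> realization R (dual_face Y t) x.
Proof.
move=> cY sY tY ts [c cD cx]; exists c => //.
by apply: subsetP cD; rewrite sub_dual_face.
Qed.

Lemma realization_vtx (V : finType) (Y : {set {set V}}) s o :
  is_complex Y -> s \in set0 |: Y ->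
  realization R (dual_face Y s) (vtx R o) <-> is_vert Y o /\ s \subset unvert o.
Proof.
move=> cY sY; rewrite realization_dual_face//.
have -> : supp (vtx R o) = [set o].
  by apply/setP => o'; rewrite in_supp vtxE inE pnatr_eq0 eqb0 negbK.
rewrite vert_dual_face//; split=> [[_ _ /andP//]|[-> ->]].
by split=> // [j|]; [rewrite mxE ler0n | rewrite csum_vtx].
Qed.

End RealizeMap.

(** * Flags of a simple cell complex *)

Section SimpleComplex.
Variables (R : realType) (Z : simple_cell_complex R).
Implicit Types i j : 'I_(ncells Z).

Lemma simple_base_sphere (P : simple_cell R) :
  combinatorial_sphere R (simple_base P) (simple_dim P).
Proof. by case: P. Qed.

Lemma simple_base_complex (P : simple_cell R) : is_complex (simple_base P).
Proof. by case: (simple_base_sphere P). Qed.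
Hint Resolve simple_base_complex : core.

Lemma simple_base_pure (P : simple_cell R) : pure (simple_base P) (simple_dim P).
Proof.
split; first exact: sphere_card_le (simple_base_sphere P).
exact: sphere_pure (simple_base_sphere P).
Qed.

Lemma set0_base (P : simple_cell R) : set0 \in set0 |: simple_base P.
Proof. by rewrite setU11. Qed.
Hint Resolve set0_base : core.

Lemma bodyE (P : simple_cell R) :
  @body R (simple_kind R) P = realization R (dual_face (simple_base P) set0).
Proof. by rewrite /dual_face eqxx. Qed.

Lemma face_body (P : simple_cell R) s x : s \in set0 |: simple_base P ->
  realization R (dual_face (simple_base P) s) x -> @body R (simple_kind R) P x.
Proof.
move=> sY; rewrite bodyE; apply: (@realization_face_sub _ _ _ s) => //.
  exact: set0_base.
exact: sub0set.
Qed.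

Lemma chart_eq (K : cell_kind R) (C : cell_complex K) (i j : 'I_(ncells C))
    (x : points (cells i)) (y : points (cells j)) :
  chart x = chart y :> total_space C <-> glued (existT _ i x) (existT _ j y).
Proof.
rewrite /chart; split=> [/eqmodP//|h]; exact/eqmodP.
Qed.

Definition mkpoint (K : cell_kind R) (P : shape K) x (bx : body P x) : points P :=
  exist _ x (classical_sets.mem_set bx).

Lemma point_body (K : cell_kind R) (P : shape K) (p : points P) : body P (val p).
Proof. by case: p => x /= /classical_sets.set_mem. Qed.

(** The characteristic map of a cell on ambient vectors, with [None] outside the body: images from
    different cells can be compared without carrying membership proofs. *)
Definition zc (K : cell_kind R) (C : cell_complex K) (i : 'I_(ncells C)) x :
    option (total_space C) :=
  if pselect (body (cells i) x) is left b then Some (chart (mkpoint b)) else None.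

Arguments zc {K C} i x.

Lemma zcE (K : cell_kind R) (C : cell_complex K) (i : 'I_(ncells C))
    (p : points (cells i)) : zc i (val p) = Some (chart p).
Proof.
rewrite /zc; case: pselect => [b|[]]; last exact: point_body.
by congr (Some (chart _)); apply: val_inj.
Qed.

Lemma zc_body (K : cell_kind R) (C : cell_complex K) (i : 'I_(ncells C)) x :
  body (cells i) x -> exists2 p : points (cells i), val p = x & zc i x = Some (chart p).
Proof. by move=> b; exists (mkpoint b) => //; rewrite -zcE. Qed.

Lemma zc_some (K : cell_kind R) (C : cell_complex K) (i : 'I_(ncells C)) x z :
  zc i x = Some z -> exists2 p : points (cells i), val p = x & chart p = z.
Proof.
rewrite /zc; case: pselect => // b [<-]; by exists (mkpoint b).
Qed.

Lemma zc_inj (K : cell_kind R) (C : cell_complex K) (i : 'I_(ncells C)) x y :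
  body (cells i) x -> zc i x = zc i y -> x = y.
Proof.
move=> /zc_body[p <- ->] e; have [q <- /chart_eq/glued_inj->//] := zc_some (esym e).
Qed.

(** Replaces the point sets and maps of [glued_faces] by combinatorial data, of which there are
    finitely many for given i and j; this finiteness is what later yields closed sets. *)
Definition glueing i j s t (h : option {set simple_vertices (cells i)} ->
    option {set simple_vertices (cells j)}) :=
  [/\ s \in set0 |: simple_base (cells i), t \in set0 |: simple_base (cells j),
      simple_cell_iso (simple_base (cells i)) (simple_base (cells j))
        (dual_face (simple_base (cells i)) s) (dual_face (simple_base (cells j)) t) h &
      forall p, realization R (dual_face (simple_base (cells i)) s) p ->
        zc i p = zc j (realize_map h p)].

Lemma iso_realize (V W : finType) (X : {set {set V}}) (Y : {set {set W}}) s t h p :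
  is_complex X -> is_complex Y -> s \in set0 |: X -> t \in set0 |: Y ->
  simple_cell_iso X Y (dual_face X s) (dual_face Y t) h ->
  realization R (dual_face X s) p ->
  realization R (dual_face Y t) (realize_map h p).
Proof.
move=> cX cY sX tY hI /(realization_dual_face _ cX sX)[p0 p1 pD].
apply/realization_dual_face => //; split.
- exact: realize_map_ge0.
- by rewrite csum_realize_map.
- by rewrite supp_realize_map//; apply: iso_simplex hI _ pD.
Qed.

Lemma glue_at i j x y : body (cells i) x -> zc i x = zc j y ->
  exists s t h, [/\ @glueing i j s t h,
    realization R (dual_face (simple_base (cells i)) s) x & y = realize_map h x].
Proof.
move=> /zc_body[p <- ->] e; have [q <- qp] := zc_some (esym e).
have /chart_eq/(@glued_faces _ _ Z) := esym qp.
move=> [d [d' [F [G [phi [[_ Fp] [_ Gq] hI hg]]]]]].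
have [D [E [h [[DD eF] [EE eG] hiso ephi]]]] := hI.
have [s sY eD] := imsetP DD; have [t tY eE] := imsetP EE.
subst F G phi D E.
have glue (r : points (cells i)) : realization R (dual_face (simple_base (cells i)) s) (val r) ->
    zc i (val r) = zc j (realize_map h (val r)).
  move=> rD; have [r' r'E ->] : exists2 r' : points (cells j),
      val r' = realize_map h (val r) & zc j (realize_map h (val r)) = Some (chart r').
    by apply: zc_body; apply: (face_body tY); apply: iso_realize hiso rD.
  by rewrite zcE; congr Some; apply/chart_eq/hg.
exists s, t, h; split=> //.
  split=> // r rD; have [r' r'E _] := zc_body (face_body sY rD : body (cells i) r).
  by rewrite -r'E; apply: glue; rewrite r'E.
apply: (@zc_inj _ _ j); first exact: point_body.
by rewrite -glue// !zcE qp.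
Qed.

Lemma glueing_card i j s t h o : @glueing i j s t h ->
  is_vert (simple_base (cells i)) o -> s \subset unvert o ->
  [/\ is_vert (simple_base (cells j)) (h o), t \subset unvert (h o) &
    ((simple_dim (cells i)).+1 - #|unvert o| =
     (simple_dim (cells j)).+1 - #|unvert (h o)|)%N].
Proof.
move=> [sY tY hI _] vo so.
have [vh th] := iso_vert (simple_base_complex _) (simple_base_complex _) sY tY hI vo so.
split=> //; rewrite -(succ_dim_dual_face (simple_base_complex _) (simple_base_pure _)).
  rewrite -(succ_dim_dual_face (simple_base_complex _) (simple_base_pure _)).
    by rewrite (iso_succ_dim _ _ sY tY hI).
  exact: unvert_in.
exact: unvert_in.
Qed.

Lemma glueing_inj i j s t h o o' : @glueing i j s t h ->
  is_vert (simple_base (cells i)) o -> s \subset unvert o ->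
  is_vert (simple_base (cells i)) o' -> s \subset unvert o' ->
  h o = h o' -> o = o'.
Proof.
move=> [sY tY hI _] vo so vo' so'.
exact: (iso_inj (simple_base_complex _) sY hI).
Qed.

Lemma vert_card_le (P : simple_cell R) o : is_vert (simple_base P) o ->
  (#|unvert o| <= simple_dim P)%N.
Proof.
case: o => [s|_]; last by rewrite cards0.
exact: sphere_card_le (simple_base_sphere P) s.
Qed.

Section Flagged.
Variable n : nat.

Definition flagged := {i : 'I_(ncells Z) & {ffun 'I_n -> {set simple_vertices (cells i)}}}.

Definition good (a : flagged) :=
  (simple_dim (cells (tag a)) == n) && is_flag (simple_base (cells (tag a))) (tagged a).

Definition fvert (a : flagged) (k : 'I_n.+1) := flag_vert (tagged a) k.

Definition fpoint (a : flagged) (u : 'rV[R]_n.+1) :=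
  \sum_k u 0 k *: vtx R (fvert a k).

Definition fz (a : flagged) u := zc (tag a) (fpoint a u).

Lemma good_dim a : good a -> simple_dim (cells (tag a)) = n.
Proof. by case/andP=> /eqP. Qed.

Lemma good_flag a : good a -> is_flag (simple_base (cells (tag a))) (tagged a).
Proof. by case/andP. Qed.

Lemma fvert_is_vert a k : good a -> is_vert (simple_base (cells (tag a))) (fvert a k).
Proof. by move=> /good_flag ga; case: (flag_vertP k ga). Qed.

Lemma fvert_card a k : good a -> #|unvert (fvert a k)| = k.
Proof. by move=> /good_flag ga; case: (flag_vertP k ga). Qed.

Lemma fvert_inj a : good a -> injective (fvert a).
Proof. by move=> /good_flag ga; apply: flag_vert_inj ga. Qed.

Lemma fvert0 a : fvert a ord0 = None.
Proof. by rewrite /fvert /flag_vert unlift_none. Qed.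

Lemma fpointE a u k : good a -> fpoint a u 0 (enum_rank (fvert a k)) = u 0 k.
Proof.
move=> ga; rewrite summxE (bigD1 k)//= big1 ?addr0 => [|l lk].
  by rewrite mxE vtxE eqxx mulr1.
by rewrite mxE vtxE (inj_eq (fvert_inj ga)) eq_sym (negbTE lk) mulr0.
Qed.

Lemma supp_fpoint a u : good a -> supp (fpoint a u) = [set fvert a k | k in [set k | u 0 k != 0]].
Proof.
move=> ga; apply/setP => o; rewrite in_supp; apply/idP/imsetP => [|[k]]; last first.
  by rewrite inE => uk ->; rewrite fpointE.
case: (pickP (fun k => (u 0 k != 0) && (o == fvert a k))) => [k /andP[uk /eqP ok] _|no].
  by exists k; rewrite ?inE.
rewrite summxE big1 ?eqxx// => k _; rewrite mxE vtxE.
have := no k; have [->|/= _ ->] := eqVneq (u 0 k) 0; first by rewrite mul0r.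
by rewrite mulr0.
Qed.

Definition simplex (u : 'rV[R]_n.+1) := (forall k, 0 <= u 0 k) /\ csum u = 1.

Lemma simplex_neq0 u : simplex u -> exists k, u 0 k != 0.
Proof.
move=> [u0 u1]; apply/existsP; apply: contraT; rewrite negb_exists => /forallP h.
have : csum u = 0 by rewrite /csum big1// => k _; apply/eqP; rewrite -[_ == _]negbK.
by rewrite u1 => /eqP; rewrite oner_eq0.
Qed.

Lemma fpoint_face a u s : good a -> simplex u ->
  s \in set0 |: simple_base (cells (tag a)) ->
  (forall k, u 0 k != 0 -> s \subset unvert (fvert a k)) ->
  realization R (dual_face (simple_base (cells (tag a))) s) (fpoint a u).
Proof.
move=> ga su sY us; have [u0 u1] := su; apply/realization_dual_face => //; split.
- by move=> j; rewrite summxE sumr_ge0// => k _; rewrite mxE mulr_ge0// mxE ler0n.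
- rewrite csum_sum -u1; apply: eq_bigr => k _; by rewrite csumZ csum_vtx mulr1.
- rewrite supp_fpoint//; apply: flag_face => //; first exact: good_flag.
    by have [k uk] := simplex_neq0 su; apply/set0Pn; exists k; rewrite inE.
  by move=> k; rewrite inE; apply: us.
Qed.

Lemma fpoint_body a u : good a -> simplex u -> body (cells (tag a)) (fpoint a u).
Proof.
move=> ga su; apply: (face_body (set0_base _)); apply: fpoint_face => //.
  exact: set0_base.
by move=> k _; apply: sub0set.
Qed.

Lemma fz_some a u : good a -> simplex u -> exists2 p : points (cells (tag a)),
  val p = fpoint a u & fz a u = Some (chart p).
Proof. by move=> ga su; apply: zc_body; apply: fpoint_body. Qed.

Lemma face_supp (P : simple_cell R) s x o : s \in set0 |: simple_base P ->
  realization R (dual_face (simple_base P) s) x -> o \in supp x ->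
  is_vert (simple_base P) o /\ s \subset unvert o.
Proof.
move=> sY /(realization_dual_face _ (simple_base_complex P) sY)[_ _].
by move=> /(mem_dual_face (simple_base_complex P) _ sY)[_ cv _] /cv.
Qed.

Lemma fpoint_supp_face a u s k : good a ->
  s \in set0 |: simple_base (cells (tag a)) ->
  realization R (dual_face (simple_base (cells (tag a))) s) (fpoint a u) ->
  u 0 k != 0 -> s \subset unvert (fvert a k).
Proof.
move=> ga sY /(face_supp sY) h uk.
by have [|] := h (fvert a k); rewrite // in_supp fpointE.
Qed.

(** Face isomorphisms preserve the dimensions of faces. Between two n-dimensional cells they
    therefore preserve the cardinality of a vertex, that is, its rank in any flag; the bound by n
    undoes the truncated subtraction. *)
Lemma glueing_flag a b s t h k : good a -> good b ->
  @glueing (tag a) (tag b) s t h -> s \subset unvert (fvert a k) ->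
  is_vert (simple_base (cells (tag b))) (h (fvert a k)) /\
  #|unvert (h (fvert a k))| = k.
Proof.
move=> ga gb gl sk; have [vh _] := glueing_card gl (fvert_is_vert k ga) sk.
rewrite !good_dim// fvert_card// => e; split=> //.
have := vert_card_le vh; rewrite good_dim//; have := ltn_ord k; move: e.
by set c := #|_|; lia.
Qed.

(** The identifying isomorphism is injective and preserves ranks, so it matches the vertices of
    positive weight rank by rank. Barycentric coordinates are thus functions on [Z], independent of
    the flag. *)
Lemma fz_eq a b u u' : good a -> good b -> simplex u -> simplex u' ->
  fz a u = fz b u' -> u = u' /\ exists s t h,
    @glueing (tag a) (tag b) s t h /\
    forall k, u 0 k != 0 -> s \subset unvert (fvert a k) /\ h (fvert a k) = fvert b k.
Proof.
move=> ga gb su su' e.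
have [s [t [h [gl xs xe]]]] := glue_at (fpoint_body ga su) e.
have [sY tY _ _] := gl.
have us k : u 0 k != 0 -> s \subset unvert (fvert a k).
  exact: fpoint_supp_face.
have x0 := ((realization_dual_face _ (simple_base_complex _) sY).1 xs).
have suppE : supp (fpoint b u') = h @: supp (fpoint a u).
  by rewrite xe supp_realize_map//; case: x0.
have hk k : u 0 k != 0 -> h (fvert a k) = fvert b k /\ u' 0 k = u 0 k.
  move=> uk; have [vh ck] := glueing_flag ga gb gl (us _ uk).
  have ka : fvert a k \in supp (fpoint a u) by rewrite in_supp fpointE.
  have : h (fvert a k) \in supp (fpoint b u') by rewrite suppE imset_f.
  rewrite supp_fpoint// => /imsetP[l _ hl].
  have lk : l = k by apply: val_inj; rewrite /= -(fvert_card l gb) -hl.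
  rewrite lk in hl; split=> //.
  rewrite -(fpointE u' k gb) -hl xe realize_map_inj_coord ?fpointE//.
  move=> o o' /(face_supp sY xs)[vo so] /(face_supp sY xs)[vo' so'].
  exact: (glueing_inj gl).
split; last by exists s, t, h; split=> // k uk; split; [exact: us | case: (hk k uk)].
apply/rowP => k; have [uk|/hk[_ ->//]] := eqVneq (u 0 k) 0.
rewrite uk; apply/eqP; rewrite eq_sym; apply: contraT => u'k.
have : fvert b k \in supp (fpoint b u') by rewrite in_supp fpointE.
rewrite suppE => /imsetP[o]; rewrite supp_fpoint// => /imsetP[l].
rewrite inE => ul -> e'; have [hl _] := hk _ ul.
by move: e'; rewrite hl => /(fvert_inj gb) kl; rewrite -kl uk eqxx in ul.
Qed.

Lemma fz_glueing a b s t h u : good a -> good b -> @glueing (tag a) (tag b) s t h ->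
  simplex u -> (forall k, u 0 k != 0 ->
    s \subset unvert (fvert a k) /\ h (fvert a k) = fvert b k) ->
  fz a u = fz b u.
Proof.
move=> ga gb gl su hu; have [sY tY _ glp] := gl; rewrite /fz glp.
  rewrite /fpoint realize_map_comb; congr (zc _ _); apply: eq_bigr => k _.
  have [->|/hu[_ ->]//] := eqVneq (u 0 k) 0; by rewrite !scale0r.
by apply: fpoint_face => // k /hu[].
Qed.

(** An identification at one point holds on the whole face carrying it; this is why the image of a
    barycenter can encode the identification of a face. *)
Lemma fz_sub a b u u' v : good a -> good b -> simplex u -> simplex u' -> simplex v ->
  (forall k, v 0 k != 0 -> u 0 k != 0) -> fz a u = fz b u' -> fz a v = fz b v.
Proof.
move=> ga gb su su' sv vu /(fz_eq ga gb su su')[_ [s [t [h [gl hh]]]]].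
by apply: fz_glueing gl sv _ => // k /vu /hh.
Qed.

Lemma delta_simplex k : simplex (delta_mx 0 k).
Proof.
split=> [j|]; first by rewrite mxE ler0n.
rewrite /csum (bigD1 k)//= mxE !eqxx big1 ?addr0// => j /negbTE jk.
by rewrite mxE eqxx jk.
Qed.

Lemma delta_neq0 k l : ((delta_mx 0 k : 'rV[R]_n.+1) 0 l != 0) = (l == k).
Proof. by rewrite mxE eqxx /= pnatr_eq0 eqb0 negbK. Qed.

Lemma fpoint_delta a k : fpoint a (delta_mx 0 k) = vtx R (fvert a k).
Proof.
rewrite /fpoint (bigD1 k)//= mxE !eqxx scale1r big1 ?addr0// => l /negbTE lk.
by rewrite mxE eqxx lk scale0r.
Qed.

Lemma flag_point i x : simple_dim (cells i) = n -> body (cells i) x ->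
  exists a, [/\ good a, tag a = i & exists2 u, simplex u & zc i x = fz a u].
Proof.
rewrite bodyE => dn xb; have := (realization_dual_face _ (simple_base_complex _) (set0_base _)).1 xb.
move=> [x0 x1 xD]; have pn := simple_base_pure (cells i); rewrite dn in pn.
have [f ff fx] := flag_through (simple_base_complex _) pn (set0_base _) xD.
pose a : flagged := Tagged _ f; exists a.
have ga : good a by rewrite /good /= dn eqxx.
split=> //; exists (\row_k x 0 (enum_rank (fvert a k))).
  split=> [k|]; first by rewrite mxE.
  rewrite -x1 {2}[x]row_vtx csum_sum.
  under [RHS]eq_bigr do rewrite csumZ csum_vtx mulr1.
  rewrite (bigID (mem [set fvert a k | k : 'I_n.+1])) /= [X in _ = _ + X]big1 ?addr0.
    rewrite big_imset /=; last by move=> k l _ _; apply: (fvert_inj ga).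
    by apply: eq_bigr => k _; rewrite mxE.
  move=> o no; apply: supp_eq0; apply: contraNN no => /fx[k <-].
  exact: imset_f.
rewrite /fz /=; congr (zc _ _); apply: row_ext => o.
have [/imsetP[k _ ->]|no] := boolP (o \in [set fvert a k | k : 'I_n.+1]).
  by rewrite (fpointE _ _ ga) mxE.
have ox : o \notin supp x by apply: contraNN no => /fx[k <-]; apply: imset_f.
have op : o \notin supp (fpoint a (\row_k x 0 (enum_rank (fvert a k)))).
  rewrite supp_fpoint//; apply: contraNN no => /imsetP[k _ ->]; exact: imset_f.
by rewrite !supp_eq0.
Qed.

End Flagged.

End SimpleComplex.

Arguments zc {R K C} i x.
Arguments glueing {R Z} i j s t h.

(** * Apices, facets and neighbouring cells in a pseudo-manifold *)

Section PseudoManifold.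
Variables (R : realType) (n : nat) (Z : simple_cell_complex R).
Hypothesis hZ : simple_cell_pseudomanifold n Z.
Implicit Types i j : 'I_(ncells Z).

Lemma realize_map_vtx (V W : finType) (h : V -> W) v :
  realize_map h (vtx R v) = vtx R (h v).
Proof.
have := @realize_map_comb R V W 'I_1 h (fun=> 1) (fun=> v).
by rewrite !big_ord1 !scale1r.
Qed.

Definition face_set i (s : {set simple_vertices (cells i)}) :
    classical_sets.set (total_space Z) :=
  fun z => exists2 p : points (cells i),
    realization R (dual_face (simple_base (cells i)) s) (val p) & z = chart p.

Lemma is_cellP d c : @is_cell _ _ Z d c <-> exists i (s : {set simple_vertices (cells i)}),
  [/\ s \in set0 |: simple_base (cells i),
      ((simple_dim (cells i)).+1 - #|s| = d.+1)%N & c = face_set s].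
Proof.
split=> [[i [F [[D [DD Dd eF]] ->]]]|[i [s [sY sd ->]]]].
  have [s sY eD] := imsetP DD; subst F D; exists i, s; split=> //.
  by rewrite -(succ_dim_dual_face (simple_base_complex _) (simple_base_pure _)).
exists i, (realization R (dual_face (simple_base (cells i)) s)); split=> //.
exists (dual_face (simple_base (cells i)) s); split=> //; first exact: imset_f.
by rewrite (succ_dim_dual_face (simple_base_complex _) (simple_base_pure _)).
Qed.

Lemma face_set_zc i s z : s \in set0 |: simple_base (cells i) -> @face_set i s z <->
  exists2 x, realization R (dual_face (simple_base (cells i)) s) x & zc i x = Some z.
Proof.
move=> sY; split=> [[p pD ->]|[x xD /zc_some[p e <-]]].
  by exists (val p); rewrite ?zcE.
by exists p => //; rewrite e.
Qed.

Lemma glue_vert i j o y : is_vert (simple_base (cells i)) o ->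
  zc i (vtx R o) = zc j y ->
  exists s t h, [/\ @glueing _ _ i j s t h, s \subset unvert o & y = vtx R (h o)].
Proof.
move=> vo e; have ob : body (cells i) (vtx R o).
  by rewrite bodyE; apply/(realization_vtx _ _ (simple_base_complex _) (set0_base _)); split=> //; apply: finset.sub0set.
have [s [t [h [gl xs ->]]]] := glue_at ob e; exists s, t, h.
have [sY _ _ _] := gl; split=> //; last by rewrite realize_map_vtx.
by have [_ ->] := (realization_vtx R o (simple_base_complex _) sY).1 xs.
Qed.

(** The cell i of which c is a face lies in some n-dimensional cell. Comparing dimensions at its
    apex shows that i has dimension at most n, so the n-dimensional face c is all of it. *)
Lemma n_cell c : @is_cell _ _ Z n c ->
  exists i, simple_dim (cells i) = n /\ c = face_set (set0 : {set simple_vertices (cells i)}).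
Proof.
have [H1 _ _] := hZ; move=> /is_cellP[i [s [sY sd ->]]].
have wh : @is_cell _ _ Z (simple_dim (cells i)) (face_set (set0 : {set simple_vertices (cells i)})).
  by apply/is_cellP; exists i, set0; rewrite setU11 cards0 subn0.
have [_ /is_cellP[k [r [rY rd ->]]] sub] := H1 _ _ wh.
have ob : realization R (dual_face (simple_base (cells i)) set0) (vtx R None).
  by apply/(realization_vtx _ _ (simple_base_complex _) (set0_base _)); split=> //; apply: finset.sub0set.
have [p pE pz] := zc_body (face_body (set0_base _) ob : body (cells i) _).
have /(face_set_zc _ rY)[y yD ye] : face_set r (chart p).
  by apply: sub; exists p => //; rewrite pE.
have [s' [t' [h [gl s'0 yE]]]] := @glue_vert i k None y isT (etrans pz (esym ye)).
have [vh th ch] := glueing_card gl (isT : is_vert _ None) s'0.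
have : r \subset unvert (h None).
  by move: yD; rewrite yE => /(realization_vtx _ _ (simple_base_complex _) rY)[].
move=> /subset_leq_card; rewrite cards0 subn0 in ch => rh.
have s0 : #|s| = 0%N by lia.
exists i; split; first by lia.
by rewrite (cards0_eq s0).
Qed.

Lemma flag_cover z : exists (a : flagged Z n) u, [/\ good a, simplex u & fz a u = Some z].
Proof.
have [H1 _ _] := hZ.
have [i [p pz]] : exists i (p : points (cells i)), chart p = z.
  by elim/quotW: z => -[i p]; exists i, p.
have wh : @is_cell _ _ Z (simple_dim (cells i)) (face_set (set0 : {set simple_vertices (cells i)})).
  by apply/is_cellP; exists i, set0; rewrite setU11 cards0 subn0.
have [c /n_cell[j [dj ->]] sub] := H1 _ _ wh.
have [q _ zq] : face_set (set0 : {set simple_vertices (cells j)}) z.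
  by apply: sub; exists p; rewrite -?pz//; rewrite -bodyE; apply: point_body.
have [a [ga _ [u su e]]] := flag_point dj (point_body q).
by exists a, u; split=> //; rewrite -e zcE zq.
Qed.

Definition mkflagged j (f : {ffun 'I_n -> {set simple_vertices (cells j)}}) :
  flagged Z n := Tagged (fun j => {ffun 'I_n -> {set simple_vertices (cells j)}}) f.

(** The gluing maps the part of the flag from rank k0 on to a chain, which extends to a full flag of
    the other cell; preservation of ranks puts its members in the right places. *)
Lemma flag_transport (a : flagged Z n) j s t h k0 : good a -> simple_dim (cells j) = n ->
  glueing (tag a) j s t h -> s \subset unvert (fvert a k0) ->
  exists f, good (@mkflagged j f) /\
    forall k : 'I_n.+1, (k0 <= k)%N -> h (fvert a k) = flag_vert f k.
Proof.
move=> ga dj gl sk; have [sY tY hI _] := gl.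
have sk' (k : 'I_n.+1) : (k0 <= k)%N -> s \subset unvert (fvert a k).
  by move=> /(flag_vert_sub (good_flag ga)); apply: subset_trans sk.
have cD : h @: [set fvert a k | k in [set k : 'I_n.+1 | (k0 <= k)%N]]%SET \in
    dual_face (simple_base (cells j)) t.
  apply: (iso_simplex hI); apply: flag_face => //; [exact: simple_base_complex|exact: good_flag| |].
    by apply/set0Pn; exists k0; rewrite inE.
  by move=> k; rewrite inE; apply: sk'.
have pn := simple_base_pure (cells j); rewrite dj in pn.
have [f ff fx] := flag_through (simple_base_complex _) pn tY cD.
pose b := mkflagged f; have gb : good b by rewrite /good /= dj eqxx.
exists f; split=> // k kk.
have [|l fl] := fx (h (fvert a k)); first by apply: imset_f; apply: imset_f; rewrite inE.
have [_ ck] := glueing_flag ga gb (gl : glueing (tag a) (tag b) s t h) (sk' _ kk).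
rewrite -fl; congr flag_vert; apply: val_inj => /=.
by rewrite -ck -fl; have [_ ->] := flag_vertP l ff.
Qed.

Notation e_ k := (delta_mx 0 k).

(** The apex lies in no proper face, so identified apices mean identified cells: the image of the
    apex names the n-cell. *)
Lemma apex_face_set (a b : flagged Z n) : good a -> good b ->
  fz a (e_ ord0) = fz b (e_ ord0) <->
  forall z, face_set (set0 : {set simple_vertices (cells (tag a))}) z ->
    face_set (set0 : {set simple_vertices (cells (tag b))}) z.
Proof.
move=> ga gb; split=> [|sub].
  move=> /(fz_eq ga gb (delta_simplex R _) (delta_simplex R _))[_ [s [t [h [gl hh]]]]].
  move=> z /(face_set_zc _ (set0_base _))[x xD xz].
  have [_ glp] : True /\ zc (tag a) x = zc (tag b) (realize_map h x).
    split=> //; have [sY _ _ ->//] := gl.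
    have [|s0 _] := hh ord0; first by rewrite delta_neq0.
    rewrite fvert0 /= subset0 in s0; by rewrite (eqP s0).
  apply/face_set_zc; first exact: set0_base.
  have [q qE _] := zc_some (etrans (esym glp) xz).
  exists (realize_map h x); last by rewrite -glp.
  by rewrite -bodyE -qE; apply: point_body.
have [p pE pz] := fz_some ga (delta_simplex R ord0).
have /(face_set_zc _ (set0_base _))[y yD ye] :
    face_set (set0 : {set simple_vertices (cells (tag b))}) (chart p).
  by apply: sub; exists p; rewrite // -bodyE; apply: point_body.
have e : zc (tag a) (vtx R None) = zc (tag b) y.
  by rewrite ye -pz /fz fpoint_delta fvert0.
have [s [t [h [gl s0 yE]]]] := @glue_vert _ _ None _ isT e.
have s0' : s \subset unvert (fvert a ord0) by rewrite fvert0.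
have [vh hc] := glueing_flag ga gb gl s0'; rewrite fvert0 in vh hc.
have hN : h None = None.
  by rewrite -(unvertK (simple_base_complex _) vh) (cards0_eq hc) /vert eqxx.
by rewrite pz -ye yE hN /fz fpoint_delta fvert0.
Qed.

Lemma facet_is_cell (a : flagged Z n) (k : 'I_n.+1) : good a -> k = 1%N :> nat ->
  exists2 d, d.+1 = n & @is_cell _ _ Z d (face_set (unvert (fvert a k))).
Proof.
move=> ga k1; exists n.-1; first by rewrite prednK//; have := ltn_ord k; rewrite k1.
apply/is_cellP; exists (tag a), (unvert (fvert a k)); split=> //.
  by apply: (unvert_in (simple_base_complex _)); apply: fvert_is_vert.
by rewrite fvert_card// good_dim// k1 subn1 prednK//; have := ltn_ord k; rewrite k1.
Qed.

Lemma facet_sub (a b : flagged Z n) (k : 'I_n.+1) : good a -> good b ->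
  fz a (e_ k) = fz b (e_ k) -> forall z, face_set (unvert (fvert a k)) z ->
  face_set (set0 : {set simple_vertices (cells (tag b))}) z.
Proof.
move=> ga gb /(fz_eq ga gb (delta_simplex R _) (delta_simplex R _))[_ [s [t [h [gl hh]]]]].
have kY : unvert (fvert a k) \in set0 |: simple_base (cells (tag a)).
  by apply: (unvert_in (simple_base_complex _)); apply: fvert_is_vert.
move=> z /(face_set_zc _ kY)[x xD xz].
have [sY _ _ glp] := gl.
have xs : realization R (dual_face (simple_base (cells (tag a))) s) x.
  apply: realization_face_sub xD => //; first exact: simple_base_complex.
  by have [|] := hh k; rewrite ?delta_neq0.
apply/face_set_zc; first exact: set0_base.
exists (realize_map h x); last by rewrite -glp.
have [q qE _] := zc_some (etrans (esym (glp _ xs)) xz).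
by rewrite -bodyE -qE; apply: point_body.
Qed.

Lemma facet_sub_self (a : flagged Z n) (k : 'I_n.+1) : good a ->
  forall z, face_set (unvert (fvert a k)) z ->
  face_set (set0 : {set simple_vertices (cells (tag a))}) z.
Proof. by move=> ga; apply: facet_sub. Qed.

Lemma whole_n_cell (a : flagged Z n) : good a ->
  @is_cell _ _ Z n (face_set (set0 : {set simple_vertices (cells (tag a))})).
Proof.
by move=> ga; apply/is_cellP; exists (tag a), set0; rewrite setU11 cards0 subn0 good_dim.
Qed.

Lemma apex_eq (a b : flagged Z n) : good a -> good b ->
  face_set (set0 : {set simple_vertices (cells (tag a))}) =
  face_set (set0 : {set simple_vertices (cells (tag b))}) <->
  fz a (e_ ord0) = fz b (e_ ord0).
Proof.
move=> ga gb; split=> [e|e]; first by apply/apex_face_set => //; rewrite e.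
apply: funext => z; apply/propext; split; first exact: (apex_face_set ga gb).1 e z.
exact: (apex_face_set gb ga).1 (esym e) z.
Qed.

(** A vertex of rank 1 is the center of a facet, and only two n-cells contain the facet; those of b
    and c, both different from that of a, must coincide. *)
Lemma facet_two (a b c : flagged Z n) (k : 'I_n.+1) : good a -> good b -> good c ->
  k = 1%N :> nat -> fz a (e_ k) = fz b (e_ k) -> fz a (e_ k) = fz c (e_ k) ->
  fz b (e_ ord0) <> fz a (e_ ord0) -> fz c (e_ ord0) <> fz a (e_ ord0) ->
  fz b (e_ ord0) = fz c (e_ ord0).
Proof.
move=> ga gb gc k1 ab ac nb nc; have [_ H2 _] := hZ.
have [d dn cd] := facet_is_cell ga k1.
have [A [B [nAB [_ _] [_ _] hAB]]] := H2 _ _ dn cd.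
have := hAB _ (whole_n_cell ga) (@facet_sub_self a k ga).
have := hAB _ (whole_n_cell gb) (facet_sub ga gb ab).
have := hAB _ (whole_n_cell gc) (facet_sub ga gc ac).
have nb' e := nb (esym ((apex_eq ga gb).1 e)).
have nc' e := nc (esym ((apex_eq ga gc).1 e)).
move=> [] eC [] eB [] eA; try (by apply/apex_eq => //; rewrite eB eC);
  by [case: nb'; rewrite eA eB | case: nc'; rewrite eA eC].
Qed.

Lemma facet_other (a : flagged Z n) (k : 'I_n.+1) : good a -> k = 1%N :> nat ->
  exists b : flagged Z n, [/\ good b, fz b (e_ ord0) <> fz a (e_ ord0) &
    forall u, simplex u -> u 0 ord0 = 0 -> fz b u = fz a u].
Proof.
move=> ga k1; have [_ H2 _] := hZ.
have [d dn cd] := facet_is_cell ga k1.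
have [B [nB cB subB]] : exists B, [/\
    face_set (set0 : {set simple_vertices (cells (tag a))}) <> B, @is_cell _ _ Z n B &
    classical_sets.subset (face_set (unvert (fvert a k))) B].
  have [A [B [nAB [cA sA] [cB sB] hAB]]] := H2 _ _ dn cd.
  case: (hAB _ (whole_n_cell ga) (@facet_sub_self a k ga)) => e.
    by exists B; rewrite e.
  by exists A; split=> //; rewrite e => /esym.
have [j [dj eB]] := n_cell cB; subst B.
have kY : unvert (fvert a k) \in set0 |: simple_base (cells (tag a)).
  by apply: (unvert_in (simple_base_complex _)); apply: fvert_is_vert.
have [z zE] : exists z, fz a (e_ k) = Some z.
  by have [p _ ->] := fz_some ga (delta_simplex R k); exists (chart p).
have : face_set (unvert (fvert a k)) z.
  apply/face_set_zc => //; exists (vtx R (fvert a k)); last by rewrite -fpoint_delta.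
  by apply/realization_vtx => //; [exact: simple_base_complex | split=> //; exact: fvert_is_vert].
move=> /subB /(face_set_zc _ (set0_base _))[y yD yz].
have e : zc (tag a) (vtx R (fvert a k)) = zc j y by rewrite yz -zE /fz fpoint_delta.
have [s [t [h [gl sk yE]]]] := glue_vert (fvert_is_vert k ga) e.
have [f [gb hf]] := flag_transport ga dj gl sk.
exists (mkflagged f); split=> //.
  by move=> /(apex_eq gb ga) /esym.
move=> u su u0; apply/esym.
apply: (fz_glueing ga gb (gl : glueing (tag a) (tag (mkflagged f)) s t h) su) => l ul.
have kl : (k <= l)%N.
  by rewrite k1 lt0n; apply: contraNneq ul => l0; rewrite -u0; apply/eqP; congr (u _ _); apply: val_inj.
split; last exact: hf.
by apply: subset_trans sk _; apply: (flag_vert_sub (good_flag ga)).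
Qed.

End PseudoManifold.

(** * The cubical complex over the flags *)

Section CubeToSimplex.
Variables (R : realType) (n : nat).
Implicit Types (t s : 'rV[R]_n) (u : 'rV[R]_n.+1).

Definition tailprod t (m : nat) := \prod_(l < n | (m <= l)%N) (1 - t 0 l).

(* The simplex as the cube with the faces t_j = 1 collapsed: these are sent to
   the vertices of rank greater than j. *)
Definition cube_to_simplex t : 'rV[R]_n.+1 :=
  \row_k if unlift ord0 k is Some j then t 0 j * tailprod t j.+1 else tailprod t 0.

Lemma tailprod_n t : tailprod t n = 1.
Proof. by rewrite /tailprod big1// => l; rewrite leqNgt ltn_ord. Qed.

Lemma tailprodS t (j : 'I_n) : tailprod t j = (1 - t 0 j) * tailprod t j.+1.
Proof.
rewrite /tailprod (bigD1 j)//=; congr (_ * _); apply: eq_bigl => l.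
by rewrite ltn_neqAle andbC eq_sym.
Qed.

Lemma cube_to_simplex0 t : cube_to_simplex t 0 ord0 = tailprod t 0.
Proof. by rewrite mxE unlift_none. Qed.

Lemma cube_to_simplexS t j :
  cube_to_simplex t 0 (lift ord0 j) = t 0 j * tailprod t j.+1.
Proof. by rewrite mxE liftK. Qed.

(** For u the image of t this is the tail product at m, by telescoping; so t_j is recovered as a
    quotient of u by a partial sum wherever that sum is nonzero. *)
Definition headsum u (m : nat) := \sum_(k < n.+1 | (k <= m)%N) u 0 k.

Lemma headsum0 u : headsum u 0 = u 0 ord0.
Proof.
rewrite /headsum (bigD1 ord0)//= big1 ?addr0// => k /andP[k0 kn].
by case/negP: kn; rewrite -val_eqE /= -leqn0.
Qed.

Lemma headsumS u (j : 'I_n) : headsum u j.+1 = headsum u j + u 0 (lift ord0 j).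
Proof.
rewrite /headsum (bigD1 (lift ord0 j))//= addrC; congr (_ + _).
apply: eq_bigl => k; rewrite -val_eqE /= /bump /= add1n.
by rewrite andbC -ltn_neqAle ltnS.
Qed.

Lemma headsum_n u : headsum u n = csum u.
Proof. by apply: eq_bigl => k; rewrite -ltnS ltn_ord. Qed.

Lemma headsum_cube t m : (m <= n)%N -> headsum (cube_to_simplex t) m = tailprod t m.
Proof.
elim: m => [|m IH] mn; first by rewrite headsum0 cube_to_simplex0.
rewrite (headsumS _ (Ordinal mn)) /= cube_to_simplexS IH ?(ltnW mn)//=.
by rewrite (tailprodS _ (Ordinal mn)) /=; ring.
Qed.

Lemma tailprod_ge0 t m : cube t -> 0 <= tailprod t m.
Proof.
by move=> ct; apply: prodr_ge0 => l _; have /andP[_] := ct l; rewrite subr_ge0.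
Qed.

Lemma cube_to_simplex_simplex t : cube t -> simplex (cube_to_simplex t).
Proof.
move=> ct; split; last by rewrite -headsum_n headsum_cube// tailprod_n.
move=> k; case: (unliftP ord0 k) => [j ->|->].
  by rewrite cube_to_simplexS mulr_ge0 ?tailprod_ge0//; case/andP: (ct j).
by rewrite cube_to_simplex0 tailprod_ge0.
Qed.

(** A section of [cube_to_simplex]. Over the collapsed faces, where the denominator is 0, division
    by zero chooses the coordinate 0. *)
Definition simplex_to_cube u : 'rV[R]_n :=
  \row_j (u 0 (lift ord0 j) / headsum u j.+1).

Lemma headsum_ge0 u m : simplex u -> 0 <= headsum u m.
Proof. by move=> [u0 _]; apply: sumr_ge0. Qed.

Lemma simplex_to_cube_cube u : simplex u -> cube (simplex_to_cube u).
Proof.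
move=> su j; rewrite mxE; have u0 := su.1 (lift ord0 j).
have h0 := headsum_ge0 j su; have h1 := headsum_ge0 j.+1 su.
rewrite divr_ge0//=.
have [e|e] := eqVneq (headsum u j.+1) 0; first by rewrite e invr0 mulr0 ler01.
have hp : 0 < headsum u j.+1 by rewrite lt0r e.
by rewrite ler_pdivrMr// mul1r headsumS lerDr.
Qed.

Lemma tailprod_simplex u m : simplex u -> (m <= n)%N ->
  tailprod (simplex_to_cube u) m = headsum u m.
Proof.
move=> su mn; rewrite -(subKn mn); elim: (n - m)%N (leq_subr m n) => [|k IH] kn.
  by rewrite subn0 tailprod_n headsum_n; case: su.
have jn : (n - k.+1 < n)%N by lia.
have e : (n - k.+1).+1 = (n - k)%N by lia.
rewrite (tailprodS _ (Ordinal jn)) /= e IH ?(ltnW kn)//.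
have := headsumS u (Ordinal jn); rewrite /= e mxE /= e => hS.
have h0 := headsum_ge0 (n - k.+1) su; have u0 := su.1 (lift ord0 (Ordinal jn)).
have [z|z] := eqVneq (headsum u (n - k)) 0.
  by rewrite z mulr0; rewrite z in hS; lra.
by rewrite mulrBl mul1r divfK// hS; ring.
Qed.

Lemma simplex_to_cubeK u : simplex u -> cube_to_simplex (simplex_to_cube u) = u.
Proof.
move=> su; apply/rowP => k; case: (unliftP ord0 k) => [j ->|->].
  rewrite cube_to_simplexS tailprod_simplex// mxE.
  have [z|z] := eqVneq (headsum u j.+1) 0; last by rewrite divfK.
  rewrite z mulr0; have := headsumS u j; rewrite z.
  by have := headsum_ge0 j su; have := su.1 (lift ord0 j); lra.
by rewrite cube_to_simplex0 tailprod_simplex// headsum0.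
Qed.

(* These are the points sent to the complement of the codimension-2 skeleton. *)
Definition inner t := forall k : 'I_n, (0 < k)%N -> t 0 k < 1.

Lemma tailprod_inner t m : cube t -> inner t -> (0 < m)%N -> 0 < tailprod t m.
Proof.
move=> ct it m0; rewrite lt0r tailprod_ge0// andbT; apply/prodf_neq0 => l ml.
by rewrite subr_eq0 eq_sym lt_eqF// it// (leq_trans m0).
Qed.

Lemma inner_inj t t' : cube t -> cube t' -> inner t -> inner t' ->
  cube_to_simplex t = cube_to_simplex t' -> t = t'.
Proof.
move=> ct ct' it it' e; apply/rowP => j.
have Q : tailprod t j.+1 = tailprod t' j.+1 by rewrite -!headsum_cube// e.
have := cube_to_simplexS t j; rewrite e cube_to_simplexS Q => /mulIf -> //.
by rewrite gt_eqF// tailprod_inner.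
Qed.

(** It also contains vertices whose weight is killed by a later t_j = 1, and so exceeds the support
    of the image on the mirrors. The quantifier in the case of [ord0] covers n = 0, where there is
    no coordinate t_0. *)
Definition face_verts t : {set 'I_n.+1} := finset (fun k : 'I_n.+1 =>
  if unlift ord0 k is Some j then 0 < t 0 j
  else [forall j : 'I_n, (val j == 0%N) ==> (t 0 j < 1)]).

Lemma face_vertsS t j : (lift ord0 j \in face_verts t) = (0 < t 0 j).
Proof. by rewrite in_set liftK. Qed.

Lemma face_verts0 t : (ord0 \in face_verts t) =
  [forall j : 'I_n, (val j == 0%N) ==> (t 0 j < 1)].
Proof. by rewrite in_set unlift_none. Qed.

Lemma cube_to_simplex_supp t k : cube t -> cube_to_simplex t 0 k != 0 ->
  k \in face_verts t.
Proof.
move=> ct; case: (unliftP ord0 k) => [j ->|->].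
  rewrite cube_to_simplexS mulf_eq0 negb_or => /andP[tj _].
  by rewrite face_vertsS lt0r tj; case/andP: (ct j).
rewrite cube_to_simplex0 face_verts0 => /prodf_neq0 h; apply/forallP => j.
apply/implyP => /eqP j0; have := h j; rewrite j0 => /(_ isT).
by rewrite subr_eq0 eq_sym lt_neqAle => ->; case/andP: (ct j).
Qed.

Lemma inner_supp t k : cube t -> inner t ->
  (cube_to_simplex t 0 k != 0) = (k \in face_verts t).
Proof.
move=> ct it; apply/idP/idP; first exact: cube_to_simplex_supp.
case: (unliftP ord0 k) => [j ->|->].
  rewrite cube_to_simplexS face_vertsS => tj.
  by rewrite mulf_neq0 ?gt_eqF// tailprod_inner.
rewrite cube_to_simplex0 face_verts0 => /forallP h; apply/prodf_neq0 => l _.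
rewrite subr_eq0 eq_sym lt_eqF//; case: (posnP l) => [l0|/it//].
by have /implyP := h l; apply; apply/eqP.
Qed.

(** By [headsum_cube] the weights of the ranks 0 and 1 add up to the product of the 1 - t_l with l
    at least 1. The case n = 0, without rank 1, is apart. *)
Lemma inner_low t : cube t ->
  inner t <-> exists k : 'I_n.+1, (k <= 1)%N && (cube_to_simplex t 0 k != 0).
Proof.
move=> ct; split=> [it|[k /andP[k1 tk]] l l0].
  have : 0 < headsum (cube_to_simplex t) 1.
    have [n0|n0] := posnP n.
      have e : (headsum (cube_to_simplex t) 1 = headsum (cube_to_simplex t) n).
        by apply: eq_bigl => k; have := ltn_ord k; lia.
      by rewrite e headsum_n (cube_to_simplex_simplex ct).2 ltr01.
    by rewrite headsum_cube// tailprod_inner.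
  move=> h; apply/existsP; apply: contraTT h; rewrite negb_exists => /forallP h.
  rewrite /headsum big1 ?ltxx// => k k1; have := h k.
  by rewrite k1 /= negbK => /eqP.
rewrite lt_neqAle; have /andP[_ ->] := ct l; rewrite andbT.
apply: contraNneq tk => tl.
have z m : (m <= l)%N -> tailprod t m = 0.
  by move=> ml; apply/eqP/prodf_eq0; exists l => //; rewrite tl subrr.
case: (unliftP ord0 k) k1 => [j ->|-> _]; last by rewrite cube_to_simplex0 z.
rewrite /= /bump /= add1n ltnS leqn0 => /eqP j0.
by rewrite cube_to_simplexS j0 z ?mulr0.
Qed.

Lemma face_verts_neq0 t : exists k, k \in face_verts t.
Proof.
have [h|] := boolP (ord0 \in face_verts t); first by exists ord0.
rewrite face_verts0 negb_forall => /existsP[j]; rewrite negb_imply -leNgt.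
move=> /andP[_ tj]; exists (lift ord0 j); rewrite face_vertsS.
by apply: lt_le_trans tj.
Qed.

Definition barycenter t : 'rV[R]_n.+1 :=
  \row_k if k \in face_verts t then (#|face_verts t|%:R)^-1 else 0.

Lemma face_verts_gt0 t : 0 < #|face_verts t|%:R :> R.
Proof.
rewrite ltr0n card_gt0; apply/set0Pn; exact: face_verts_neq0.
Qed.

Lemma barycenter_simplex t : simplex (barycenter t).
Proof.
have h := face_verts_gt0 t; split=> [k|].
  by rewrite mxE; case: ifP => // _; rewrite invr_ge0 ltW.
rewrite /csum; under eq_bigr do rewrite mxE.
rewrite -big_mkcond /= big_const -[LHS]/(iter _ (+%R _) 0) iter_addr_0.
by rewrite -[X in X *+ _]mulr1 -mulrnAr mulVf// gt_eqF.
Qed.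

Lemma barycenter_neq0 t k : (barycenter t 0 k != 0) = (k \in face_verts t).
Proof.
rewrite mxE; case: ifP => _; last by rewrite eqxx.
by rewrite invr_eq0 gt_eqF// face_verts_gt0.
Qed.

End CubeToSimplex.

(** * The gluing of the cubes and the map to [Z] *)

Section MirrorComplex.
Variables (R : realType) (n : nat) (Z : simple_cell_complex R).

Definition mirror_index : finType :=
  {x : {i : 'I_(ncells Z) & {ffun 'I_n -> {set simple_vertices (cells i)}}} *
       {ffun 'I_n -> bool} | good x.1}.

Definition mirror_num := #|mirror_index|.

Definition mflag (i : 'I_mirror_num) : flagged Z n := (val (enum_val i)).1.
Definition msign (i : 'I_mirror_num) : {ffun 'I_n -> bool} := (val (enum_val i)).2.

Lemma mflag_good i : good (mflag i).
Proof. exact: (valP (enum_val i)). Qed.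

Lemma mirror_ex (a : flagged Z n) e : good a -> exists i, mflag i = a /\ msign i = e.
Proof.
move=> ga; pose x : mirror_index := exist _ (a, e) ga.
by exists (enum_rank x); rewrite /mflag /msign enum_rankK.
Qed.

(* The sign at k is forgotten on the mirror t_k = 1; there is no mirror for
   k = 0, where the cell is glued to the neighbouring one instead. *)
Definition mask (e : {ffun 'I_n -> bool}) (t : 'rV[R]_n) : {ffun 'I_n -> bool} :=
  [ffun k : 'I_n => ~~ ((0 < k)%N && (t 0 k == 1)) && e k].

(** A complete invariant of the gluing. It contains t itself, so no cube is glued to itself and all
    gluings of faces are by the identity map. *)
Definition minv (i : 'I_mirror_num) (t : 'rV[R]_n) :=
  (t, mask (msign i) t, fz (mflag i) (barycenter t)).

(** A gluing at t persists at s when s has fewer vertices in its face and lies on all mirrors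
    through t: less is then compared. This applies to s in the smallest face at t, and to t in the
    open star of s. *)
Lemma minv_mono i j (t s : 'rV[R]_n) :
  (forall k, k \in face_verts s -> k \in face_verts t) ->
  (forall k : 'I_n, (0 < k)%N -> t 0 k = 1 -> s 0 k = 1) ->
  minv i t = minv j t -> minv i s = minv j s.
Proof.
move=> st ts [em ez]; congr (_, _, _).
  apply/ffunP => k; have /ffunP/(_ k) := em; rewrite !ffunE.
  case: (boolP (0 < k)%N) => //= k0; case: (s 0 k =P 1) => //= sk.
  by case: (t 0 k =P 1) => //= /(ts _ k0)/sk.
apply: (fz_sub (mflag_good i) (mflag_good j) (barycenter_simplex _)
  (barycenter_simplex _) (barycenter_simplex _) _ ez).
by move=> k; rewrite !barycenter_neq0; apply: st.
Qed.

Let mcells : 'I_mirror_num -> shape (cube_kind R) := fun=> n.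

Definition mglued : rel (disjoint_cells mcells) := fun x y =>
  `[< minv (tag x) (val (tagged x)) = minv (tag y) (val (tagged y)) >].

Lemma mglued_refl : reflexive mglued.
Proof. by move=> x; apply/asboolP. Qed.

Lemma mglued_sym : symmetric mglued.
Proof. by move=> x y; apply/asboolP/asboolP => ->. Qed.

Lemma mglued_trans : transitive mglued.
Proof. by move=> x y z /asboolP e /asboolP e'; apply/asboolP; rewrite e. Qed.

Lemma mglued_inj i (x y : points (mcells i)) :
  mglued (existT _ i x) (existT _ i y) -> x = y.
Proof. by move=> /asboolP[e _ _]; apply: val_inj. Qed.

Lemma mglued_faces i j (x : points (mcells i)) (y : points (mcells j)) :
    mglued (existT _ i x) (existT _ j y) ->
    exists d e F G phi,
      [/\ is_face d F /\ F (val x), is_face e G /\ G (val y),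
          face_iso F G phi &
          forall (p : points (mcells i)) (p' : points (mcells j)),
            F (val p) -> val p' = phi (val p) ->
            mglued (existT _ i p) (existT _ j p')].
Proof.
move=> /asboolP/= exy; have ext : val y = val x by case: exy.
set t := val x in exy ext.
(* The smallest face of the cube containing t: exactly the coordinates equal to 0 or 1 are
   frozen. *)
pose a : {ffun 'I_n -> option bool} :=
  [ffun k => if t 0 k == 0 then Some false else if t 0 k == 1 then Some true else None].
have ct : cube t := point_body x.
have Ft : cube_face_set a t.
  split=> // k b; rewrite ffunE; case: eqP => [-> [<-]//|_].
  by case: eqP => [-> [<-]//|].
pose d := #|finset (fun i => a i == None)|.
have dE : #|[pred i | a i == None]| = d by apply: eq_card => k; rewrite !inE.
exists d, d, (cube_face_set a), (cube_face_set a), id; split.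
- by split=> //; exists a.
- by rewrite ext; split=> //; exists a.
- split; try by exists d, a.
    by move=> u v l _ _ _.
  by split=> [u //|u v _ _ //|u uF]; exists u.
- move=> p p' [cp pF] /= e; apply/asboolP; rewrite /= e.
  apply: minv_mono (etrans exy _); last by rewrite ext.
    move=> k; case: (unliftP ord0 k) => [l ->|->].
      rewrite !face_vertsS => pl; rewrite lt0r; have /andP[-> _] := ct l; rewrite andbT.
      apply: contraTneq pl => tl.
      by rewrite (pF l false) ?ltxx// ffunE tl eqxx.
    rewrite !face_verts0 => /forallP h; apply/forallP => l; apply/implyP => l0.
    have := h l; rewrite l0 /= lt_neqAle => /andP[pl _].
    rewrite lt_neqAle; have /andP[_ ->] := ct l; rewrite andbT.
    apply: contraNneq pl => tl; rewrite (pF l true)// ffunE tl eqxx.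
    by rewrite oner_eq0.
  by move=> k _ tk; rewrite (pF k true)// ffunE tk eqxx oner_eq0.
Qed.

Definition mirror_complex : cubic_cell_complex R :=
  @CellComplex R (cube_kind R) mirror_num mcells mglued mglued_refl mglued_sym
    mglued_trans mglued_inj mglued_faces.

Local Notation M := mirror_complex.

Lemma mchart_eq (i j : 'I_(ncells M)) (p : points (cells i)) (q : points (cells j)) :
  chart p = chart q :> total_space M <-> minv i (val p) = minv j (val q).
Proof.
rewrite chart_eq; split=> [/asboolP//|h]; exact/asboolP.
Qed.

Lemma total_space_ex (K : cell_kind R) (C : cell_complex K) (z : total_space C) :
  exists i (p : points (cells i)), chart p = z.
Proof. by elim/quotW: z => -[i p]; exists i, p. Qed.

Lemma mpoint (i : 'I_(ncells M)) (t : 'rV[R]_n) : cube t ->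
  exists p : points (cells i), val p = t.
Proof. by move=> ct; exists (mkpoint (ct : body (cells i) t)). Qed.

Lemma mpoint_cube (i : 'I_(ncells M)) (p : points (cells i)) : @cube R n (val p).
Proof. exact: point_body p. Qed.

(** Well-definedness: the image of t is carried by [face_verts t], whose identification in [Z] is
    part of the gluing invariant. *)
Lemma collapse_ex (x : total_space M) : exists z : total_space Z,
  forall (i : 'I_(ncells M)) (p : points (cells i)), chart p = x ->
    fz (mflag i) (cube_to_simplex (val p)) = Some z.
Proof.
have [i [p <-]] := total_space_ex x.
have sp := cube_to_simplex_simplex (mpoint_cube p).
have [q _ qz] := fz_some (mflag_good i) sp.
exists (chart q) => j p' /esym/mchart_eq[e _ ez].
have -> : val p' = val p by apply: esym.
rewrite -qz.
apply/esym/(fz_sub (mflag_good i) (mflag_good j) (barycenter_simplex _)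
  (barycenter_simplex _) sp _ ez).
by move=> k kp; rewrite barycenter_neq0; apply: cube_to_simplex_supp (mpoint_cube p) kp.
Qed.

Definition collapse (x : total_space M) : total_space Z := sval (cid (collapse_ex x)).

Lemma collapseE (i : 'I_(ncells M)) (p : points (cells i)) :
  fz (mflag i) (cube_to_simplex (val p)) = Some (collapse (chart p)).
Proof. by rewrite /collapse; case: cid => z /= ->. Qed.

Lemma collapse_fpoint (i : 'I_(ncells M)) (p : points (cells i)) : exists2 q : points (cells (tag (mflag i))),
  val q = fpoint (mflag i) (cube_to_simplex (val p)) & collapse (chart p) = chart q.
Proof.
have [q qE] := fz_some (mflag_good i) (cube_to_simplex_simplex (mpoint_cube p)).
by rewrite collapseE => -[e]; exists q.
Qed.

Hypothesis hZ : simple_cell_pseudomanifold n Z.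

(** The rank of a vertex is the codimension of its smallest face, so a point is in a cell of
    codimension at least 2 exactly when it has no weight on the ranks 0 and 1; its carrier then lies
    in the face dual to the flag member of size 2. *)
Lemma codim2P (a : flagged Z n) u z : good a -> simplex u -> fz a u = Some z ->
  codim2_skeleton Z n z <-> forall k : 'I_n.+1, (k <= 1)%N -> u 0 k = 0.
Proof.
move=> ga su az; split=> [[d [c [dn /is_cellP[i [s [sY sd ->]]]]]]|u01].
  move=> /(face_set_zc _ sY)[x xD xz] k k1; apply/eqP; apply: contraT => uk.
  have [s' [t' [h [gl fs xE]]]] := glue_at (fpoint_body ga su) (etrans az (esym xz)).
  have [s'Y _ _ _] := gl.
  have sk := fpoint_supp_face ga s'Y fs uk.
  have [vh _] := glueing_card gl (fvert_is_vert k ga) sk.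
  rewrite good_dim// fvert_card// => e.
  have : h (fvert a k) \in supp x.
    have [f0 _ _] := (realization_dual_face _ (simple_base_complex _) s'Y).1 fs.
    rewrite xE supp_realize_map//.
    by apply: imset_f; rewrite in_supp fpointE.
  move=> /(face_supp sY xD)[_ /subset_leq_card]; lia.
have [k uk] := simplex_neq0 su.
have k2 : (2 <= k)%N.
  by rewrite ltnNge; apply: contraNN uk => /u01->.
have n2 : (2 < n.+1)%N by apply: leq_ltn_trans k2 (ltn_ord k).
pose k0 : 'I_n.+1 := Ordinal n2.
have kY : unvert (fvert a k0) \in set0 |: simple_base (cells (tag a)).
  by apply: (unvert_in (simple_base_complex _)); apply: fvert_is_vert.
exists (n - 2)%N, (face_set (unvert (fvert a k0))); split; first lia.
  apply/is_cellP; exists (tag a), (unvert (fvert a k0)); split=> //.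
  by rewrite fvert_card// good_dim//=; lia.
apply/face_set_zc => //; exists (fpoint a u) => //.
apply: fpoint_face => // l ul; apply: (flag_vert_sub (good_flag ga)) => /=.
by rewrite ltnNge; apply: contraNN ul => /u01->.
Qed.

Lemma codim2_collapse (i : 'I_(ncells M)) (p : points (cells i)) :
  ~ codim2_skeleton Z n (collapse (chart p)) <-> @inner R n (val p).
Proof.
have sp := cube_to_simplex_simplex (mpoint_cube p).
have cE := codim2P (mflag_good i) sp (collapseE p).
split=> [nc|/(inner_low (mpoint_cube p))[k /andP[k1 uk]] /cE h].
  apply/(inner_low (mpoint_cube p)); apply: contrapT => no; apply/nc/cE => k k1.
  by apply/eqP; apply: contraT => uk; case: no; exists k; rewrite k1.
by rewrite h ?eqxx in uk.
Qed.

Definition sheet (e : {ffun 'I_n -> bool}) : classical_sets.set (total_space M) :=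
  fun x => exists (i : 'I_(ncells M)) (p : points (cells i)),
    [/\ chart p = x, msign i = e & @inner R n (val p)].

Lemma mask_inner e t : @inner R n t -> mask e t = e.
Proof.
move=> it; apply/ffunP => k; rewrite ffunE.
by case: (boolP (0 < k)%N) => //= k0; rewrite lt_eqF ?it.
Qed.

Lemma sheetP e (i : 'I_(ncells M)) (p : points (cells i)) :
  sheet e (chart p) <-> msign i = e /\ @inner R n (val p).
Proof.
split=> [[j [q [/mchart_eq[et em _] eq iq]]]|[ei ip]]; last by exists i, p.
have ip : @inner R n (val p) := eq_ind _ (@inner R n) iq _ et.
by split=> //; rewrite -eq -(mask_inner (msign j) iq) -(mask_inner (msign i) ip).
Qed.

Lemma sheet_inj e x y : sheet e x -> sheet e y -> collapse x = collapse y -> x = y.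
Proof.
move=> [i [p [ex pe ip]]] [j [q [ey qe iq]]]; rewrite -ex -ey => e0.
have {e0} := congr1 (@Some (total_space Z)) e0.
have cp := mpoint_cube p; have cq := mpoint_cube q.
have sp := cube_to_simplex_simplex cp; have sq := cube_to_simplex_simplex cq.
rewrite -!collapseE => ez; have [eX _] := fz_eq (mflag_good i) (mflag_good j) sp sq ez.
have et := inner_inj cp cq ip iq eX.
apply/mchart_eq; rewrite /minv -et pe qe; congr (_, _, _).
rewrite -et in ez; apply: (fz_sub (mflag_good i) (mflag_good j) sp sp
  (barycenter_simplex _) _ ez).
by move=> k; rewrite barycenter_neq0 inner_supp.
Qed.

Lemma collapse_surj e z : exists (i : 'I_(ncells M)) (p : points (cells i)),
  msign i = e /\ collapse (chart p) = z.
Proof.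
have [a [u [ga su az]]] := flag_cover hZ z.
have [i [ia ie]] := mirror_ex e ga.
have [p pt] := mpoint i (simplex_to_cube_cube su).
exists i, p; split=> //; apply: Some_inj.
by rewrite -collapseE pt simplex_to_cubeK// ia.
Qed.

End MirrorComplex.

Section FlagEmbedding.
Variables (R : realType) (V : finType) (n : nat).
Implicit Types (f : {ffun 'I_n -> {set V}}) (l : 'rV[R]_n) (s : 'I_n -> bool).

Definition flag_emb f s l := signed_emb s (fun k => enum_rank (f k)) l.

Lemma flag_rank_inj (Y : {set {set V}}) f : is_flag Y f -> injective (fun k => enum_rank (f k)).
Proof.
move=> /flagP[_ fc _] k k' /enum_rank_inj e; apply: val_inj => /=.
by have := fc k'; rewrite -e fc => -[].
Qed.

Lemma flag_emb_coord (Y : {set {set V}}) f s l k : is_flag Y f ->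
  flag_emb f s l 0 (enum_rank (f k)) = (-1) ^+ s k * l 0 k.
Proof.
by move=> ff; rewrite /flag_emb (signed_embE s l k (flag_rank_inj ff)).
Qed.

Lemma flag_emb_out f s l P : (forall k, f k <> P) -> flag_emb f s l 0 (enum_rank P) = 0.
Proof.
move=> h; apply: signed_emb0; apply/codomP => -[k /enum_rank_inj e].
by case: (h k).
Qed.

Lemma flag_emb_supp (Y : {set {set V}}) f s l P : is_flag Y f ->
  reflect (exists2 k, l 0 k != 0 & f k = P) (P \in supp (flag_emb f s l)).
Proof.
move=> ff; rewrite in_supp; apply: (iffP idP) => [|[k lk <-]]; last first.
  by rewrite (flag_emb_coord s l k ff) mulf_eq0 signr_eq0.
case: (pickP (fun k => f k == P)) => [k /eqP <-|no].
  by rewrite (flag_emb_coord s l k ff) mulf_eq0 signr_eq0 => lk; exists k.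
by rewrite flag_emb_out ?eqxx// => k /eqP; rewrite no.
Qed.

Lemma flag_chain (Y : {set {set V}}) f (c : {set {set V}}) : is_flag Y f ->
  (forall P, P \in c -> exists k, f k = P) -> c \in set0 |: bary Y.
Proof.
move=> /flagP[fY _ fm] cf; rewrite in_setU1; have [//|c0] := eqVneq c set0.
rewrite inE c0 /=; apply/andP; split.
  by apply/subsetP => P /cf[k <-].
apply/forall_inP => P /cf[k <-]; apply/forall_inP => Q /cf[k' <-].
by case: (leqP k k') => kk; [rewrite fm | rewrite orbC fm// ltnW].
Qed.

Lemma flag_eq_card (Y : {set {set V}}) f f' k k' : is_flag Y f -> is_flag Y f' ->
  f k = f' k' -> k = k'.
Proof.
move=> /flagP[_ fc _] /flagP[_ fc' _] e; apply: val_inj => /=.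
by have := fc k; rewrite e fc' => -[].
Qed.

End FlagEmbedding.

(** * Directions at a vertex of the cubical complex *)

Section MirrorLink.
Variables (R : realType) (n : nat) (Z : simple_cell_complex R).
Hypothesis hZ : simple_cell_pseudomanifold n Z.

(** Flags with identified apices have their whole cells glued by one isomorphism, so identifying the
    vertices of positive weight is enough. *)
Lemma fz_vertices (a b : flagged Z n) u : good a -> good b -> simplex u ->
  fz a (delta_mx 0 ord0) = fz b (delta_mx 0 ord0) ->
  (forall k, u 0 k != 0 -> fz a (delta_mx 0 k) = fz b (delta_mx 0 k)) -> fz a u = fz b u.
Proof.
move=> ga gb su /(fz_eq ga gb (delta_simplex R _) (delta_simplex R _))[_].
move=> [s [t [h [gl hh]]]] uk; have [sY tY _ glp] := gl.
have [|s0 _] := hh ord0; first by rewrite delta_neq0.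
have {}s0 : s = set0 by apply/eqP; rewrite -subset0; rewrite fvert0 in s0.
apply: (fz_glueing ga gb gl su) => k /uk; rewrite /fz !fpoint_delta => e.
have sk : s \subset unvert (fvert a k) by rewrite s0 sub0set.
split=> //; rewrite glp ?realize_map_vtx in e; last first.
  apply/(realization_vtx _ _ (simple_base_complex _) sY).
  by split=> //; apply: fvert_is_vert.
have [vh _] := glueing_flag ga gb gl sk.
have ob : body (cells (tag b)) (vtx R (h (fvert a k))).
  by rewrite bodyE; apply/(realization_vtx _ _ (simple_base_complex _) (set0_base _)); split=> //; apply: sub0set.
have /rowP/(_ (enum_rank (fvert b k))) := zc_inj ob e.
rewrite !vtxE eqxx => /eqP; rewrite eqr_nat eqb1 => /eqP->//.
Qed.

Lemma fz_same_tag (j : 'I_(ncells Z)) (f f' : {ffun 'I_n -> {set simple_vertices (cells j)}}) k :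
  good (mkflagged f) -> good (mkflagged f') ->
  fz (mkflagged f) (delta_mx 0 k) = fz (mkflagged f') (delta_mx 0 k) <->
  flag_vert f k = flag_vert f' k.
Proof.
move=> gf gf'; rewrite /fz !fpoint_delta; split=> [e|e]; last by rewrite /fvert /= e.
have ob : body (cells j) (vtx R (flag_vert f k)).
  rewrite bodyE; apply/(realization_vtx _ _ (simple_base_complex _) (set0_base _)); split=> //; last exact: sub0set.
  exact: (fvert_is_vert k gf).
have /rowP/(_ (enum_rank (flag_vert f' k))) := zc_inj ob e.
by rewrite !vtxE eqxx => /eqP; rewrite eqr_nat eqb1 => /eqP->.
Qed.

Lemma fz_same_point (j : 'I_(ncells Z)) (f f' : {ffun 'I_n -> {set simple_vertices (cells j)}}) (u : 'rV[R]_n.+1) :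
  (forall k, u 0 (lift ord0 k) != 0 -> f k = f' k) ->
  fz (mkflagged f) u = fz (mkflagged f') u.
Proof.
move=> h; congr zc; apply: eq_bigr => k _.
have [->|] := eqVneq (u 0 k) 0; first by rewrite !scale0r.
by case: (unliftP ord0 k) => [k' ->|->] uk; rewrite /fvert /flag_vert ?liftK ?unlift_none// h.
Qed.

Variables (v : {ffun 'I_n -> bool}) (i0 : 'I_(mirror_num n Z)).
Let t0 : 'rV[R]_n := cube_vertex R v.
Let a0 := mflag i0.
Let V := simple_vertices (cells (tag a0)).
Let Y : {set {set V}} := simple_base (cells (tag a0)).
Let fl : {ffun 'I_n -> {set V}} := tagged a0.

Definition same_vertex (i : 'I_(mirror_num n Z)) := minv i t0 = minv i0 t0.

Let in_face k : (lift ord0 k \in face_verts t0) = v k.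
Proof. by rewrite face_vertsS /t0 mxE ltr0n lt0b. Qed.

Let out_face0 : ord0 \notin face_verts t0 -> exists2 k : 'I_n, k = 0%N :> nat & v k.
Proof.
rewrite face_verts0 negb_forall => /existsP[k]; rewrite negb_imply => /andP[/eqP k0].
rewrite mxE; case vk: (v k); last by rewrite ltr01.
by move=> _; exists k.
Qed.

Let in_face0 (k : 'I_n) : k = 0%N :> nat -> (ord0 \in face_verts t0) = ~~ v k.
Proof.
move=> k0; rewrite face_verts0; apply/forallP/idP => [/(_ k)|vk k'].
  by rewrite mxE /= k0 eqxx /=; case: (v k); rewrite ?ltxx.
apply/implyP => /eqP k0'; have -> : k' = k by apply: val_inj; rewrite /= k0.
by rewrite mxE (negbTE vk) ltr01.
Qed.

(** Transports the flag of the cube i into the fixed cell of [a0]. If the vertex lies on t_0 = 1,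
    the cube may belong to the neighbouring n-cell, and the two flags are compared only on the
    common facet u_0 = 0. *)
Definition link_flag (i : 'I_(mirror_num n Z)) (f : {ffun 'I_n -> {set V}}) :=
  [/\ good (@mkflagged R n Z (tag a0) f), forall k, v k -> f k = fl k &
    forall u, simplex u -> (ord0 \notin face_verts t0 -> u 0 ord0 = 0) ->
      fz (@mkflagged R n Z (tag a0) f) u = fz (mflag i) u].

Lemma link_flag_ex i : same_vertex i -> exists f, link_flag i f.
Proof.
move=> [_ ez]; have gi := mflag_good i; have g0 := mflag_good i0.
have [_ [s [t [h [gl hh]]]]] := fz_eq gi g0 (barycenter_simplex _) (barycenter_simplex _) ez.
(* The lowest rank in the face: 0 if the apex belongs to it, otherwise 1, since then t_0 = 1. *)
have [k0 k0F k0P] : exists2 k0, k0 \in face_verts t0 &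
    (forall k : 'I_n.+1, (0 < k)%N -> (k0 <= k)%N) /\ (ord0 \in face_verts t0 -> k0 = ord0).
  have [h0|h0] := boolP (ord0 \in face_verts t0); first by exists ord0.
  have [k k0 vk] := out_face0 h0; exists (lift ord0 k); rewrite ?in_face//.
  by split=> // k'; rewrite /= /bump /= k0 addn0.
have [sk _] := hh k0 ltac:(by rewrite barycenter_neq0).
have [f [gf hf]] := flag_transport gi (good_dim g0) gl sk.
exists f; split=> //.
  move=> k vk; have := hh (lift ord0 k); rewrite barycenter_neq0 in_face => /(_ vk)[_].
  rewrite hf ?k0P.1// /fvert /flag_vert liftK => -[]//.
move=> u su u0; apply/esym; apply: (fz_glueing gi gf gl su) => k uk.
have kk : (k0 <= k)%N.
  case: (posnP k) => [k00|/k0P.1//]; rewrite k0P.2//.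
  apply: contraNT uk => /u0 e; have -> : k = ord0 by apply: val_inj.
  by rewrite e.
split; last exact: hf.
exact: subset_trans sk (flag_vert_sub (good_flag gi) kk).
Qed.

(* The coordinate of a direction at [f k] is negative on the far side of the
   k-th mirror; for k = 0 the far side is the neighbouring n-cell. *)
Definition link_sign i (k : 'I_n) := v k &&
  (if (0 < k)%N then msign i k
   else `[< fz (mflag i) (delta_mx 0 ord0) <> fz a0 (delta_mx 0 ord0) >]).

(** The point of the link with barycentric coordinates l with respect to the edge midpoints, whence
    the factor 1/2; the sign points from the vertex into the cube. *)
Definition mid_coord (l : 'rV[R]_n) : 'rV[R]_n := \row_k (t0 0 k + (-1) ^+ v k / 2 * l 0 k).
Definition link_coord (t : 'rV[R]_n) : 'rV[R]_n := \row_k (2 * (-1) ^+ v k * (t 0 k - t0 0 k)).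

Lemma mid_coordK l : link_coord (mid_coord l) = l.
Proof. by apply/rowP => k; rewrite !mxE; case: (v k); field. Qed.

Lemma link_coordK t : mid_coord (link_coord t) = t.
Proof. by apply/rowP => k; rewrite !mxE; case: (v k); field. Qed.

Lemma mid_pos l k : @std_face R n l -> (0 < mid_coord l 0 k) = v k || (l 0 k != 0).
Proof.
move=> [l0 l1]; have le1 : l 0 k <= 1.
  by rewrite -l1 /csum (bigD1 k)//= lerDl sumr_ge0.
rewrite !mxE; case: (v k) => /=; rewrite ?expr1 ?expr0.
  by apply/idP; lra.
by rewrite add0r mul1r pmulr_rgt0 ?invr_gt0 ?ltr0n// lt0r l0 andbT.
Qed.

Lemma mid_eq1 l k : @std_face R n l -> (mid_coord l 0 k == 1) = v k && (l 0 k == 0).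
Proof.
move=> [l0 l1]; have le1 : l 0 k <= 1.
  by rewrite -l1 /csum (bigD1 k)//= lerDl sumr_ge0.
have := l0 k; rewrite !mxE; case: (v k) => /=; rewrite ?expr1 ?expr0 => lk.
  apply/eqP/eqP; lra.
by apply/eqP; lra.
Qed.

Lemma mid_cube l : @std_face R n l -> cube (mid_coord l).
Proof.
move=> [l0 l1] k; have le1 : l 0 k <= 1.
  by rewrite -l1 /csum (bigD1 k)//= lerDl sumr_ge0.
by have := l0 k; rewrite !mxE; case: (v k) => /=; rewrite ?expr1 ?expr0 => lk; apply/andP; split; lra.
Qed.

Lemma mid_face0 l (k : 'I_n) : @std_face R n l -> k = 0%N :> nat ->
  (ord0 \in face_verts (mid_coord l)) = ~~ (v k && (l 0 k == 0)).
Proof.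
move=> sl k0; rewrite -mid_eq1// face_verts0; have le1 := (andP (mid_cube sl k)).2.
apply/forallP/idP => [/(_ k)|h k'].
  by rewrite lt_neqAle /= k0 eqxx /= => /andP[].
apply/implyP => /eqP k0'; have -> : k' = k by apply: val_inj; rewrite /= k0.
by rewrite lt_neqAle h le1.
Qed.

Lemma same_vertex_sign i j (k : 'I_n) : same_vertex i -> same_vertex j -> ~~ ((0 < k)%N && v k) -> msign i k = msign j k.
Proof.
move=> [ei _] [ej _] h; have := congr1 (fun e : {ffun 'I_n -> bool} => e k) (etrans ei (esym ej)).
rewrite !ffunE !mxE; have -> : ((0 < k)%N && ((v k)%:R == 1 :> R)) = false.
  have [vk|vk] := boolP (v k); last by rewrite eq_sym oner_eq0 andbF.
  by rewrite eqxx andbT; move: h; rewrite vk andbT => /negbTE.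
by [].
Qed.

Lemma link_flag_vert i f k : link_flag i f ->
  fz (mflag i) (delta_mx 0 (lift ord0 k)) = fz (@mkflagged R n Z (tag a0) f) (delta_mx 0 (lift ord0 k)).
Proof.
move=> [_ _ h]; rewrite h//; first exact: delta_simplex.
by move=> _; rewrite mxE.
Qed.

Lemma link_flag_eq i j f g k : link_flag i f -> link_flag j g ->
  fz (mflag i) (delta_mx 0 (lift ord0 k)) = fz (mflag j) (delta_mx 0 (lift ord0 k)) <-> f k = g k.
Proof.
move=> fi gj; rewrite (link_flag_vert k fi) (link_flag_vert k gj).
have [gf _ _] := fi; have [gg _ _] := gj.
rewrite fz_same_tag// /flag_vert liftK; split=> [[]|->]//.
Qed.

(** The dictionary between link points and directions is well defined and faithful. Flags, signs and
    the choice of n-cell are read off the nonzero coordinates of the direction; where l_k = 0,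
    either the gluing at the vertex already fixes them or the gluing at the point does not see
    them. *)
Lemma link_dir_eq i j f g l l' : same_vertex i -> same_vertex j -> link_flag i f -> link_flag j g ->
  @std_face R n l -> @std_face R n l' ->
  flag_emb f (link_sign i) l = flag_emb g (link_sign j) l' <->
  minv i (mid_coord l) = minv j (mid_coord l').
Proof.
move=> ni nj fi gj sl sl'; have [gf fc fz_f] := fi; have [gg gc fz_g] := gj.
have ff := good_flag gf : is_flag Y f; have fg := good_flag gg : is_flag Y g.
have gi := mflag_good i; have gj' := mflag_good j.
split=> [e|[em es ez]]; last first.
  have el : l' = l by rewrite -(mid_coordK l) em mid_coordK.
  subst l'; apply: eq_bigr => k _.
  have [->|lk] := eqVneq (l 0 k) 0; first by rewrite !scale0r.
  have vert u : u \in face_verts (mid_coord l) -> fz (mflag i) (delta_mx 0 u) = fz (mflag j) (delta_mx 0 u).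
    move=> uF; apply: (fz_sub gi gj' (barycenter_simplex _) (barycenter_simplex _) (delta_simplex _ _) _ ez).
    by move=> u'; rewrite delta_neq0 barycenter_neq0 => /eqP->.
  have -> : f k = g k.
    by apply/(link_flag_eq _ fi gj)/vert; rewrite face_vertsS mid_pos// lk orbT.
  suff -> : link_sign i k = link_sign j k by [].
  rewrite /link_sign; case: (boolP (v k)) => //= vk.
  have t1 : mid_coord l 0 k == 1 = false by rewrite mid_eq1// vk (negbTE lk).
  case: posnP => [k0|kp]; last first.
    by have /ffunP/(_ k) := es; rewrite !ffunE kp t1.
  by rewrite vert// (mid_face0 sl k0) (negbTE lk) andbF.
(* A nonzero coordinate sits at a simplex whose cardinality gives the rank k; its absolute value is
   l_k and its sign is [link_sign]. *)
have ABS i' j' f' g' (l1 l2 : 'rV[R]_n) k : is_flag Y f' -> is_flag Y g' ->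
    @std_face R n l1 -> @std_face R n l2 ->
    flag_emb f' (link_sign i') l1 = flag_emb g' (link_sign j') l2 -> l1 0 k != 0 ->
    [/\ f' k = g' k, l1 0 k = l2 0 k & link_sign i' k = link_sign j' k].
  move=> ff' fg' [p1 _] [p2 _] ee lk.
  have /(flag_emb_supp _ _ _ fg')[k' _ fk'] : f' k \in supp (flag_emb g' (link_sign j') l2).
    by rewrite -ee; apply/(flag_emb_supp _ _ _ ff'); exists k.
  have kk := flag_eq_card fg' ff' fk'; rewrite kk in fk'.
  have := congr1 (fun d : 'rV_ _ => d 0 (enum_rank (f' k))) ee.
  rewrite (flag_emb_coord _ _ _ ff') -fk' (flag_emb_coord _ _ _ fg').
  have := p1 k; have := p2 k; move: lk.
  case: (link_sign i' k); case: (link_sign j' k); rewrite ?expr0 ?expr1 ?mulN1r ?mul1r => lk h2 h1 h.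
  - by split=> //; apply: oppr_inj.
  - have /eqP z : l1 0 k = 0 by lra.
    by rewrite z in lk.
  - have /eqP z : l1 0 k = 0 by lra.
    by rewrite z in lk.
  - by [].
have el : l' = l.
  apply/rowP => k; have [z|lk] := eqVneq (l 0 k) 0; last by have [_ ->] := ABS i j f g l l' k ff fg sl sl' e lk.
  have [z'|lk'] := eqVneq (l' 0 k) 0; first by rewrite z z'.
  by have [_ ->] := ABS j i g f l' l k fg ff sl' sl (esym e) lk'.
subst l'; rewrite /minv; congr (_, _, _).
  apply/ffunP => k; rewrite !ffunE mid_eq1//.
  case: (posnP k) => [k0|kp] /=; first by apply: same_vertex_sign => //; rewrite k0.
  have [vk|vk] := boolP (v k) => /=; last by apply: same_vertex_sign => //; rewrite (negbTE vk) andbF.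
  have [//|lk /=] := eqVneq (l 0 k) 0.
  have [_ _] := ABS i j f g l l k ff fg sl sl e lk.
  by rewrite /link_sign vk kp.
have fgk k : lift ord0 k \in face_verts (mid_coord l) -> f k = g k.
  rewrite face_vertsS mid_pos// => /orP[vk|lk]; first by rewrite fc// gc.
  by have [] := ABS i j f g l l k ff fg sl sl e lk.
have sb := barycenter_simplex (mid_coord l).
(* If the apex is in the face of the vertex or carries no weight, [link_flag] moves both points into
   the cell of [a0], where the relevant flag members agree. *)
have [h0|h0] := boolP ((ord0 \in face_verts t0) || (ord0 \notin face_verts (mid_coord l))).
  have c0 : ord0 \notin face_verts t0 -> barycenter (mid_coord l) 0 ord0 = 0.
    by move=> n0; apply/eqP; move: h0; rewrite (negbTE n0) /= -barycenter_neq0 negbK.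
  rewrite -fz_f// -fz_g//; apply: fz_same_point => k.
  by rewrite barycenter_neq0; apply: fgk.
(* Otherwise the direction leaves the facet t_0 = 1. Equal signs put both cells on the same side of
   it, and the far side is unique by [facet_two]. *)
rewrite negb_or negbK in h0; have /andP[n0 m0] := h0.
have [k k0 vk] := out_face0 n0.
have lk : l 0 k != 0 by move: m0; rewrite (mid_face0 sl k0) vk.
have [_ _ sk] := ABS i j f g l l k ff fg sl sl e lk.
have gA := mflag_good i0.
have aE i' f' : link_flag i' f' -> fz a0 (delta_mx 0 (lift ord0 k)) = fz (mflag i') (delta_mx 0 (lift ord0 k)).
  move=> fi'; rewrite (link_flag_vert k fi') /fz !fpoint_delta.
  by rewrite /fvert /flag_vert liftK /=; have [_ -> ] := fi'; rewrite ?vk.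
apply: (fz_vertices gi gj' sb) => [|k'].
  move: sk; rewrite /link_sign vk k0 /=.
  case: asboolP => hi; case: asboolP => // hj _.
    have k1 : lift ord0 k = 1%N :> nat by rewrite /= /bump /= k0.
    exact: (facet_two hZ gA gi gj' k1 (aE _ _ fi) (aE _ _ gj) hi hj).
  by have /contrapT-> := hi; have /contrapT-> := hj.
rewrite barycenter_neq0; case: (unliftP ord0 k') => [k'' ->|->] h.
  by apply/(link_flag_eq _ fi gj)/fgk.
have := sk; rewrite /link_sign vk k0 /=.
case: asboolP => hi; case: asboolP => // hj _.
  have k1 : lift ord0 k = 1%N :> nat by rewrite /= /bump /= k0.
  exact: (facet_two hZ gA gi gj' k1 (aE _ _ fi) (aE _ _ gj) hi hj).
by have /contrapT-> := hi; have /contrapT-> := hj.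
Qed.

Definition link_base : 'rV[R]_#|{: {set V}}| := flag_emb fl (fun=> false) t0.

Let fl_flag : is_flag Y fl. Proof. exact: good_flag (mflag_good i0). Qed.

Lemma link_base_supp P : P \in supp link_base <-> exists2 k, v k & fl k = P.
Proof.
split=> [/(flag_emb_supp _ _ _ fl_flag)|] [k vk <-].
  by exists k => //; move: vk; rewrite mxE pnatr_eq0 eqb0 negbK.
by apply/(flag_emb_supp _ _ _ fl_flag); exists k => //; rewrite mxE pnatr_eq0 eqb0 negbK.
Qed.

Lemma link_base_kcone : kcone (bary Y) link_base.
Proof.
split; last by apply: (flag_chain fl_flag) => P /link_base_supp[k _ <-]; exists k.
move=> j; rewrite summxE; apply: sumr_ge0 => k _.
by rewrite !mxE expr0 mul1r mulr_ge0// ler0n.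
Qed.

Lemma link_dir_tcone i f (l : 'rV[R]_n) : link_flag i f -> (forall k, 0 <= l 0 k) ->
  tcone (kcone (bary Y)) link_base (flag_emb f (link_sign i) l).
Proof.
move=> [gf fc _] l0; have ff := good_flag gf : is_flag Y f.
apply/(tcone_kcone _ link_base_kcone); split=> [P nP|].
  case: (pickP (fun k => f k == P)) => [k /eqP fk|no]; last first.
    by rewrite flag_emb_out// => k /eqP; rewrite no.
  rewrite -fk (flag_emb_coord _ _ _ ff); have [vk|vk] := boolP (v k).
    by case/negP: nP; apply/link_base_supp; exists k; rewrite -?fc.
  by rewrite /link_sign (negbTE vk) mul1r.
apply: (flag_chain ff) => P; rewrite inE => /orP[/link_base_supp[k vk <-]|].
  by exists k; rewrite fc.
by move=> /(flag_emb_supp _ _ _ ff)[k _ <-]; exists k.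
Qed.

Lemma link_dir_surj d : tcone (kcone (bary Y)) link_base d -> exists i f (l : 'rV[R]_n),
  [/\ same_vertex i, link_flag i f, forall k, 0 <= l 0 k & d = flag_emb f (link_sign i) l].
Proof.
move=> /(tcone_kcone _ link_base_kcone)[dpos dch].
have cY := simple_base_complex (cells (tag a0)) : is_complex Y.
have g0 := mflag_good i0 : good a0.
have pY := simple_base_pure (cells (tag a0)); rewrite (good_dim g0) in pY.
set C := supp link_base :|: supp d in dch.
have [CY CC] : C \subset Y /\ chainb C.
  move: dch; rewrite in_setU1 => /predU1P[->|].
    by split; [exact: sub0set | apply/chainbP => s t; rewrite inE].
  by rewrite inE => /and3P[].
have [f ff fx] := flag_extend cY pY CY CC.
have gf : good (@mkflagged R n Z (tag a0) f) by rewrite /good /= (good_dim g0) eqxx.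
have fc k : v k -> f k = fl k.
  move=> vk; have [|k' e] := fx (fl k).
    by rewrite inE; apply/orP; left; apply/link_base_supp; exists k.
  by rewrite -e -(flag_eq_card ff fl_flag e).
have apex : fz (@mkflagged R n Z (tag a0) f) (delta_mx 0 ord0) = fz a0 (delta_mx 0 ord0).
  by rewrite /fz !fpoint_delta !fvert0.
(* A negative coordinate at k = 0 cannot come from a mirror; it is realized by the neighbouring
   n-cell across the facet. *)
pose flip := [exists k : 'I_n, [&& val k == 0%N, v k & d 0 (enum_rank (f k)) < 0]].
have [b [gb bE bu]] : exists b : flagged Z n, [/\ good b,
    flip = `[< fz b (delta_mx 0 ord0) <> fz a0 (delta_mx 0 ord0) >] &
    forall u, simplex u -> (ord0 \notin face_verts t0 -> u 0 ord0 = 0) ->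
      fz (@mkflagged R n Z (tag a0) f) u = fz b u].
  have [hf|hf] := boolP flip; last first.
    exists (mkflagged f); split=> //; rewrite apex; apply/esym/asboolP.
    by case.
  have /existsP[k /and3P[/eqP k0 vk _]] := hf.
  have k1 : lift ord0 k = 1%N :> nat by rewrite /= /bump /= k0.
  have [b [gb bn bu]] := facet_other hZ gf k1.
  exists b; split=> // [|u su u0].
    by apply/esym/asboolP; rewrite -apex.
  by rewrite bu// u0// (in_face0 k0) vk.
(* On the mirrors through the vertex the sign is free and follows d; elsewhere it is copied from
   [i0] so that the cube is glued at the vertex. *)
pose e : {ffun 'I_n -> bool} := [ffun k : 'I_n =>
  if (0 < k)%N && v k then d 0 (enum_rank (f k)) < 0 else msign i0 k].
have [i [ib ie]] := mirror_ex e gb.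
have lf : link_flag i f by split=> // u su u0; rewrite ib bu.
have fzb : fz a0 (barycenter t0) = fz (@mkflagged R n Z (tag a0) f) (barycenter t0).
  rewrite /fz; congr zc; apply: eq_bigr => k _.
  have [->|] := eqVneq (barycenter t0 0 k) 0; first by rewrite !scale0r.
  rewrite barycenter_neq0 /fvert /flag_vert; case: (unliftP ord0 k) => [k' ->|->//].
  by rewrite in_face => /fc/= ->.
exists i, f, (\row_k `|d 0 (enum_rank (f k))|); split=> //.
- rewrite /same_vertex /minv; congr (_, _, _).
    apply/ffunP => k; rewrite !ffunE ie ffunE mxE.
    case: (0 < k)%N => //=; case: (v k) => //=; rewrite ?eqxx//.
  rewrite fzb ib bu//; first exact: barycenter_simplex.
  by move=> h; apply/eqP; rewrite -[_ == _]negbK barycenter_neq0.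
- by move=> k; rewrite mxE.
apply/rowP => P'; rewrite -[P']enum_valK; set P := enum_val P'.
case: (pickP (fun k => f k == P)) => [k /eqP <-|no]; last first.
  rewrite flag_emb_out ?supp_eq0// => [|k /eqP]; last by rewrite no.
  apply/negP => PS; have [k /eqP] := fx P ltac:(by rewrite inE PS orbT).
  by rewrite no.
rewrite (flag_emb_coord _ _ _ ff) mxE; set x := d 0 _.
have -> : link_sign i k = (x < 0).
  rewrite /link_sign; have [vk|vk] /= := boolP (v k).
    case: posnP => [k0|kp]; last by rewrite ie ffunE kp vk.
    rewrite ib -bE; apply/existsP/idP => [[k' /and3P[/eqP k'0 _ h]]|h].
      by rewrite /x; have <- : k' = k by apply: val_inj; rewrite k'0 /= k0.
    by exists k; rewrite /= k0 vk.
  apply/esym/negbTE; rewrite -leNgt; apply: dpos; apply/negP => /link_base_supp[k' vk' e'].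
  by case/negP: vk; rewrite -(flag_eq_card fl_flag ff e').
case: (ltrP x 0) => h; first by rewrite expr1 mulN1r (ltr0_norm h) opprK.
by rewrite expr0 mul1r (ger0_norm h).
Qed.

End MirrorLink.

From mathcomp Require Import all_classical all_reals all_analysis.
Import Defs numFieldNormedType.Exports.
Local Open Scope quotient_scope.
Local Open Scope classical_set_scope.
Local Open Scope ring_scope.

(** * The topology of cell complexes *)

Section Topology.
Variable R : realType.

Lemma rV_continuous (T : topologicalType) m (f : T -> 'rV[R]_m) :
  (forall j, continuous (fun x => f x 0 j)) -> continuous f.
Proof.
move=> fc x; apply/cvg_ballP => e e0; rewrite near_simpl.
have h (j : 'I_m) : \forall y \near x, ball (f x 0 j) e (f y 0 j).
  by have /cvg_ballP/(_ _ e0) := fc j x.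
have hh := @filter_forall _ _ _ (nbhs x) (nbhs_filter x) h.
apply: filterS hh => y hy.
by split=> // i j; rewrite ord1.
Qed.

Lemma coord_cont m (j : 'I_m) : continuous (fun x : 'rV[R]_m => x 0 j).
Proof. exact: coord_continuous. Qed.

Lemma open_total (K : cell_kind R) (C : cell_complex K) (A : set (total_space C)) :
  open A <-> forall i, exists2 U : set 'rV[R]_(ambient (cells i)), open U &
    forall p : points (cells i), A (chart p) <-> U (val p).
Proof.
rewrite -[open A]/(open (\pi_({eq_quot glued_equiv C}) @^-1` A)).
split=> [/sigT_openP h i|h].
  have [U oU UE] := h i; exists U => // p.
  by rewrite -[U (val p)]/((set_val @^-1` U) p) UE.
apply/sigT_openP => i; have [U oU UE] := h i; exists U => //.
by apply/seteqP; split=> p /=; rewrite -[set_val p]/(val p) => /UE.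
Qed.

Lemma closed_iff (T : topologicalType) (A B : set T) :
  (forall x, A x <-> B x) -> closed B -> closed A.
Proof. by move=> AB; rewrite (_ : A = B)//; apply/seteqP; split=> x /AB. Qed.

Lemma closed_nonneg (T : topologicalType) (f : T -> R) : continuous f ->
  closed [set x | 0 <= f x].
Proof.
by move=> fc; apply: (preimage_closed (f := f) _ (@closed_ge _ 0)) => y _; apply: fc.
Qed.

Lemma closed_eqv (T : topologicalType) (f : T -> R) c : continuous f ->
  closed [set x | f x = c].
Proof.
by move=> fc; apply: (preimage_closed (f := f) _ (@closed_eq _ c)) => y _; apply: fc.
Qed.

Lemma closed_all (T : topologicalType) (I : Type) (P : I -> T -> Prop) :
  (forall i, closed [set x | P i x]) -> closed [set x | forall i, P i x].
Proof.
move=> h; rewrite (_ : mkset _ = \bigcap_i [set x | P i x]).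
  by apply: closed_bigI.
by apply/seteqP; split=> x /= hx i; [move=> _; apply: hx|apply: (hx i)].
Qed.

Lemma closed_some (T : topologicalType) (I : finType) (P : I -> T -> Prop) :
  (forall i, closed [set x | P i x]) -> closed [set x | exists i, P i x].
Proof.
move=> h; rewrite (_ : mkset _ = \bigcup_i [set x | P i x]).
  by apply: closed_bigcup => [|i _]; [exact: finite_finset|apply: h].
by apply/seteqP; split=> x /= [i]; [move=> hx; exists i|move=> _ hx; exists i].
Qed.

Lemma sum_continuous (T : topologicalType) (I : Type) (s : seq I) (P : pred I) (f : I -> T -> R) :
  (forall i, continuous (f i)) -> continuous (fun x => \sum_(i <- s | P i) f i x).
Proof.
move=> fc; elim: s => [|i s IH].
  rewrite (_ : (fun x => _) = cst 0); first exact: cst_continuous.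
  by apply/funext => y; rewrite big_nil.
rewrite (_ : (fun x => _) = (fun x => if P i then f i x else 0) \+
    (fun x => \sum_(j <- s | P j) f j x)); last first.
  by apply/funext => y /=; rewrite big_cons; case: ifP => //; rewrite add0r.
move=> x; apply: cvgD; last exact: IH.
by case: (P i); [apply: fc|apply: cvg_cst].
Qed.

Lemma csum_continuous m : continuous (@csum R m).
Proof. by apply: sum_continuous => j; apply: coord_cont. Qed.

Lemma cube_compact m : compact (@cube R m).
Proof.
have := @rV_compact _ m (fun=> `[(0:R), 1]%classic) (fun=> @segment_compact _ _ _).
by rewrite (_ : mkset _ = @cube R m)//; apply/seteqP; split=> x /= h i;
  have := h i; rewrite /= in_itv.
Qed.

Lemma realization_closed (V : finType) (K : {set {set V}}) : is_complex K ->
  closed (realization R K).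
Proof.
move=> cK; rewrite (_ : realization R K = [set x | exists s : {set V},
    (s \in K /\ csum x = 1) /\
    forall j, 0 <= x 0 j /\ ((enum_val j \in s) \/ x 0 j = 0)]).
  apply: closed_some => s; have [sK|sK] := boolP (s \in K); last first.
    by apply: (closed_iff (B := set0)) closed0 => x; split=> // -[[]].
  apply: closedI; [|apply: closed_all => j; apply: closedI].
  - apply: (closed_iff (B := [set x : 'rV[R]_#|V| | csum x = 1])) => [x|]; first by split=> // -[].
    by apply: closed_eqv; apply: csum_continuous.
  - by apply: closed_nonneg; apply: coord_cont.
  - have [js|js] := boolP (enum_val j \in s).
      by apply: (closed_iff (B := setT)) closedT => x; split=> // _; left.
    apply: (closed_iff (B := [set x : 'rV[R]_#|V| | x 0 j = 0])) => [x|].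
      by split=> [[]//|]; right.
    by apply: closed_eqv; apply: coord_cont.
apply/seteqP; split=> x.
  move=> /(realizationP _ cK)[[x0 xK] x1]; exists (supp x); split.
    split=> //; move: xK; rewrite in_setU1 supp_eq_set0 => /predU1P[x00|//].
    by move: x1; rewrite x00 csum0 => /eqP; rewrite eq_sym oner_eq0.
  move=> j; split=> //; rewrite in_supp enum_valK.
  by case: eqP; [right|left].
move=> /= [s [[sK x1] h]]; apply/realizationP => //; split=> //; split.
  by move=> j; case: (h j).
have ss : supp x \subset s.
  apply/fintype.subsetP => v; rewrite in_supp; have [_] := h (enum_rank v).
  by rewrite enum_rankK => -[//|->]; rewrite eqxx.
rewrite in_setU1; case: eqP => //= /eqP x0.
exact: cK.2 sK ss x0.
Qed.

Lemma realization_compact (V : finType) (K : {set {set V}}) : is_complex K ->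
  compact (realization R K).
Proof.
move=> cK; apply: subclosed_compact (realization_closed cK) (@cube_compact _) _.
move=> x /(realizationP _ cK)[[x0 _] x1] j; rewrite x0 -x1 /csum (bigD1 j)//= lerDl.
exact: sumr_ge0.
Qed.

Lemma realize_map_continuous (V W : finType) (h : V -> W) :
  continuous (@realize_map R V W h).
Proof.
apply: rV_continuous => j.
have -> : (fun x : 'rV[R]_#|V| => realize_map h x 0 j) =
    fun x : 'rV[R]_#|V| => \sum_(v | h v == enum_val j) x 0 (enum_rank v).
  by apply/funext => x; rewrite -[j in LHS]enum_valK realize_mapE.
by apply: sum_continuous => v; apply: coord_cont.
Qed.

Section Charts.
Variable Z : simple_cell_complex R.
Implicit Types i j : 'I_(ncells Z).

(** A finite union, over the gluing data between the cells i and j, of continuous images of compact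
    sets. Closedness of faces and openness of the collapse on each sheet both come from this. *)
Lemma chart_preimage_closed i j (K : set 'rV[R]_(ambient (cells i))) :
  compact K -> K `<=` body (cells i) ->
  closed [set y : 'rV[R]_(ambient (cells j)) | exists2 x, K x & zc i x = zc j y].
Proof.
move=> cK Kb.
pose D (s : {set simple_vertices (cells i)}) := realization R (dual_face (simple_base (cells i)) s).
pose I := ({set simple_vertices (cells i)} * {set simple_vertices (cells j)} *
  {ffun option {set simple_vertices (cells i)} -> option {set simple_vertices (cells j)}})%type.
rewrite (_ : mkset _ = [set y | exists u : I, glueing i j u.1.1 u.1.2 u.2 /\
    (realize_map u.2 @` (K `&` D u.1.1)) y]).
  apply: closed_some => -[[s t] h] /=.
  have [gl|ngl] := pselect (glueing i j s t h); last first.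
    by apply: (closed_iff (B := set0)) closed0 => y; split=> // -[].
  apply: (closed_iff (B := realize_map h @` (K `&` D s))) => [y|].
    by split=> // -[].
  apply: compact_closed; first exact: norm_hausdorff.
  apply: continuous_compact; first by apply: continuous_subspaceT; apply: realize_map_continuous.
  apply: compact_closedI; [exact: cK|rewrite /D; apply: realization_closed].
  have [sY _ _ _] := gl; exact: (dual_face_complex (simple_base_complex _) sY).
apply/seteqP; split=> y /=.
  move=> [x Kx e]; have [s [t [h [gl xs yE]]]] := glue_at (Kb _ Kx) e.
  exists (s, t, finfun h) => /=.
  have -> : (finfun h : _ -> _) = h by apply/funext => o; rewrite ffunE.
  by split=> //; exists x.
move=> [[[s t] h] /= [gl [x [Kx xs] <-]]]; exists x => //.
by have [_ _ _ ->] := gl.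
Qed.

Lemma face_set_closed i (s : {set simple_vertices (cells i)}) :
  s \in finset.set0 |: simple_base (cells i) -> closed (face_set s).
Proof.
move=> sY; rewrite -openC; apply/open_total => j.
have cD := dual_face_complex (simple_base_complex _) sY.
have := @chart_preimage_closed i j (realization R (dual_face (simple_base (cells i)) s))
  (realization_compact cD) _.
move=> /(_ (fun x => @face_body R _ s x sY)); rewrite -openC => cO.
eexists; first exact: cO.
move=> p; split=> /=.
  by move=> np [x xs e]; apply: np; apply/face_set_zc => //; exists x; rewrite // e zcE.
by move=> np /(face_set_zc _ sY)[x xs e]; apply: np; exists x; rewrite // e zcE.
Qed.

Lemma codim2_closed n : closed (codim2_skeleton Z n).
Proof.
pose I := {i : 'I_(ncells Z) & {set simple_vertices (cells i)}}.
rewrite (_ : codim2_skeleton Z n = [set z | exists u : I,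
  (tagged u \in finset.set0 |: simple_base (cells (tag u)) /\
   ((simple_dim (cells (tag u))).+1 - #|tagged u| < n)%N /\
   (0 < (simple_dim (cells (tag u))).+1 - #|tagged u|)%N) /\ face_set (tagged u) z]).
  apply: closed_some => -[i s] /=.
  have [h|h] := pselect (s \in finset.set0 |: simple_base (cells i) /\
   ((simple_dim (cells i)).+1 - #|s| < n)%N /\ (0 < (simple_dim (cells i)).+1 - #|s|)%N).
    apply: (closed_iff (B := face_set s)) => [y|]; first by split=> // -[].
    by apply: face_set_closed; case: h.
  by apply: (closed_iff (B := set0)) closed0 => y; split=> // -[].
apply/seteqP; split=> z /=.
  move=> [d [c [dn /is_cellP[i [s [sY sd ->]]] zs]]].
  by exists (existT _ i s) => /=; rewrite sd.
move=> [[i s] /= [[sY [sn s0]] zs]].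
exists ((simple_dim (cells i)).+1 - #|s|).-1, (face_set s); split=> //.
  by rewrite prednK.
by apply/is_cellP; exists i, s; split=> //; rewrite prednK.
Qed.

End Charts.

End Topology.

Section Polynomials.
Variables (R : realType) (m : nat).

(** A class of continuous functions closed under directional derivatives, so that [cont_diff] of
    every order follows by induction. *)
Inductive polyfun : ('rV[R]_m -> R) -> Prop :=
| PolyCst c : polyfun (fun=> c)
| PolyCoord i : polyfun (fun x => x 0 i)
| PolyAdd f g : polyfun f -> polyfun g -> polyfun (fun x => f x + g x)
| PolyMul f g : polyfun f -> polyfun g -> polyfun (fun x => f x * g x).

Lemma polyfun_ext f g : (forall x, f x = g x) -> polyfun g -> polyfun f.
Proof. by move=> /funext->. Qed.

Lemma polyfun_continuous f : polyfun f -> continuous f.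
Proof.
elim=> [c|i|{}f g _ fc _ gc|{}f g _ fc _ gc] x.
- exact: cst_continuous.
- exact: coord_cont.
- exact: (cvgD (fc x) (gc x)).
- exact: (cvgM (fc x) (gc x)).
Qed.

Lemma polyfun_derive f (v : 'rV[R]_m) : polyfun f ->
  (forall x, derivable f x v) /\ polyfun (fun x => 'D_v f x).
Proof.
elim=> [c|i|{}f g pf [df Df] pg [dg Dg]|{}f g pf [df Df] pg [dg Dg]].
- split=> [x|]; first exact: derivable_cst.
  by apply: (polyfun_ext (g := fun=> 0)) => [x|]; [exact: derive_cst|exact: PolyCst].
- have dc (x : 'rV[R]_m) : derivable (fun x : 'rV[R]_m => x 0 i) x v /\
      'D_v (fun x : 'rV[R]_m => x 0 i) x = v 0 i.
    have d := @differentiable_coord R 1 m x 0 i.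
    split; first exact: diff_derivable.
    rewrite deriveE//; have @l : {linear 'rV[R]_m -> R}.
      by exists (fun N : 'rV[R]_m => N 0 i); do 2![eexists]; do ?[constructor];
        rewrite ?mxE// => ? *; rewrite ?mxE//; move=> ?; rewrite !mxE.
    by rewrite (_ : (fun _ => _) = l)// diff_lin//; apply: coord_continuous.
  split=> [x|]; first by case: (dc x).
  by apply: (polyfun_ext (g := fun=> v 0 i)) => [x|]; [case: (dc x)|exact: PolyCst].
- split=> [x|]; first exact: derivableD.
  apply: (polyfun_ext (g := fun x => 'D_v f x + 'D_v g x)) => [x|]; last exact: PolyAdd.
  exact: deriveD.
- split=> [x|]; first exact: derivableM.
  apply: (polyfun_ext (g := fun x => f x * 'D_v g x + g x * 'D_v f x)) => [x|].
    exact: deriveM.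
  by apply: PolyAdd; apply: PolyMul.
Qed.

Lemma polyfun_cont_diff k f : polyfun f -> cont_diff k f.
Proof.
elim: k f => [|k IH] f pf /=; first exact: polyfun_continuous.
split; first exact: polyfun_continuous.
by move=> j; have [df Df] := polyfun_derive (delta_mx 0 j) pf; split=> //; apply: IH.
Qed.

Lemma polyfun_sum (I : Type) (s : seq I) (P : pred I) (F : I -> 'rV[R]_m -> R) :
  (forall i, polyfun (F i)) -> polyfun (fun x => \sum_(i <- s | P i) F i x).
Proof.
move=> pF; elim: s => [|i s IH].
  by apply: (polyfun_ext (g := fun=> 0)) => [x|]; [rewrite big_nil|exact: PolyCst].
apply: (polyfun_ext (g := fun x => (if P i then F i x else 0) +
    \sum_(j <- s | P j) F j x)) => [x|].
  by rewrite big_cons; case: ifP => //; rewrite add0r.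
by apply: PolyAdd => //; case: (P i) => //; apply: PolyCst.
Qed.

Lemma polyfun_prod (I : Type) (s : seq I) (P : pred I) (F : I -> 'rV[R]_m -> R) :
  (forall i, polyfun (F i)) -> polyfun (fun x => \prod_(i <- s | P i) F i x).
Proof.
move=> pF; elim: s => [|i s IH].
  by apply: (polyfun_ext (g := fun=> 1)) => [x|]; [rewrite big_nil|exact: PolyCst].
apply: (polyfun_ext (g := fun x => (if P i then F i x else 1) *
    \prod_(j <- s | P j) F j x)) => [x|].
  by rewrite big_cons; case: ifP => //; rewrite mul1r.
by apply: PolyMul => //; case: (P i) => //; apply: PolyCst.
Qed.

End Polynomials.

Section CubeHull.
Variables (R : realType) (d : nat).

Lemma cube_hull : polytope_cover (@cube R d)
  [:: [seq cube_vertex R v | v <- enum [set: {ffun 'I_d -> bool}]%SET]].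
Proof.
apply/seteqP; split=> x /=.
  move=> cx; eexists; first exact: mem_head.
  apply/hull_enum.
  (* The weights are the terms of the expansion of the product of the x_i + (1 - x_i). *)
  pose w (v : {ffun 'I_d -> bool}) := \prod_i (if v i then x 0 i else 1 - x 0 i).
  have expand (F : 'I_d -> bool -> R) : \sum_(v : {ffun 'I_d -> bool}) \prod_i F i (v i) =
      \prod_i (F i true + F i false).
    rewrite -bigA_distr_bigA; apply: eq_bigr => i _.
    by rewrite big_bool.
  exists w; split.
  - move=> v; apply: prodr_ge0 => i _; have /andP[x0 x1] := cx i.
    by case: (v i); rewrite ?subr_ge0.
  - rewrite (expand (fun i b => if b then x 0 i else 1 - x 0 i)) big1// => i _.
    by rewrite addrC subrK.
  - by move=> v; rewrite !inE.
  - apply/rowP => j; rewrite summxE.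
    pose F i (b : bool) : R := (if b then x 0 i else 1 - x 0 i) * (if i == j then b%:R else 1).
    transitivity (\sum_(v : {ffun 'I_d -> bool}) \prod_i F i (v i)).
      rewrite expand (bigD1 j)//= /F eqxx mulr1 mulr0 addr0 big1 ?mulr1// => i /negbTE->.
      by rewrite !mulr1 addrC subrK.
    apply: eq_bigr => v _; rewrite !mxE big_split /=; congr (_ * _).
    rewrite (bigD1 j)//= eqxx big1 ?mulr1// => i /negbTE->//.
move=> [s]; rewrite inE => /eqP-> /hull_enum[l [l0 l1 _ ->]] j.
rewrite summxE; apply/andP; split.
  by apply: sumr_ge0 => v _; rewrite !mxE mulr_ge0// ler0n.
rewrite -l1; apply: ler_sum => v _; rewrite !mxE ler_piMr//.
by case: (v j); rewrite ?ler01.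
Qed.

End CubeHull.

(** * Smoothness of the collapse and the covering off the skeleton *)

Section Collapse.
Variables (R : realType) (n : nat) (Z : simple_cell_complex R).
Local Notation M := (mirror_complex n Z).

Lemma cube_to_simplex_poly (k : 'I_n.+1) :
  polyfun (fun t : 'rV[R]_n => cube_to_simplex t 0 k).
Proof.
have pt m : polyfun (fun t : 'rV[R]_n => tailprod t m).
  apply: polyfun_prod => l; apply: PolyAdd; first exact: PolyCst.
  apply: (polyfun_ext (g := fun x : 'rV[R]_n => (-1) * x 0 l)) => [x|].
    by rewrite mulN1r.
  by apply: PolyMul; [apply: PolyCst|apply: PolyCoord].
case: (unliftP ord0 k) => [j ->|->].
  apply: (polyfun_ext (g := fun t : 'rV[R]_n => t 0 j * tailprod t j.+1)) => [t|].
    exact: cube_to_simplexS.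
  by apply: PolyMul => //; apply: PolyCoord.
by apply: (polyfun_ext (g := fun t : 'rV[R]_n => tailprod t 0)) => [t|//];
  exact: cube_to_simplex0.
Qed.

Definition collapse_cell (i : 'I_(ncells M)) (t : 'rV[R]_n) :
    'rV[R]_(ambient (cells (tag (mflag i)))) :=
  fpoint (mflag i) (cube_to_simplex t).

Lemma collapse_cell_poly i j : polyfun (fun t => collapse_cell i t 0 j).
Proof.
apply: (polyfun_ext (g := fun t => \sum_k cube_to_simplex t 0 k *
    (vtx R (fvert (mflag i) k) 0 j))) => [t|].
  by rewrite summxE; apply: eq_bigr => k _; rewrite mxE.
apply: polyfun_sum => k; apply: PolyMul; first exact: cube_to_simplex_poly.
exact: PolyCst.
Qed.

Lemma collapse_cell_continuous i : continuous (collapse_cell i).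
Proof.
by apply: rV_continuous => j; apply: polyfun_continuous; apply: collapse_cell_poly.
Qed.

Lemma collapse_continuous : continuous (@collapse R n Z).
Proof.
apply/continuousP => A /open_total oA; apply/open_total => i.
have [U oU UE] := oA (tag (mflag i)).
exists (collapse_cell i @^-1` U).
  by move/continuousP: (@collapse_cell_continuous i); apply.
move=> p; rewrite /preimage /=; have [q qE ->] := collapse_fpoint p.
by rewrite UE qE.
Qed.

Lemma collapse_piecewise_smooth : piecewise_smooth (@collapse R n Z).
Proof.
split; first exact: collapse_continuous.
move=> i; eexists; split; first exact: cube_hull.
move=> s; rewrite inE => _; exists (tag (mflag i)), (collapse_cell i); split.
  by move=> j k; apply: polyfun_cont_diff; apply: collapse_cell_poly.
by move=> p _; have [q qE e] := collapse_fpoint p; exists q.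
Qed.

Hypothesis hZ : simple_cell_pseudomanifold n Z.

Lemma sheet_open e : open (@sheet R n Z e).
Proof.
apply/open_total => i; have [ie|ie] := eqVneq (msign i) e; last first.
  by exists set0; [exact: open0|move=> p; split=> // /sheetP[/eqP]; rewrite (negbTE ie)].
exists (@inner R n); last by move=> p; split=> [/sheetP[]//|ip]; apply/sheetP.
rewrite -closedC; apply: (closed_iff (B := [set t : 'rV[R]_n | exists k : 'I_n,
    (0 < k)%N /\ 0 <= t 0 k - 1])).
  move=> t; split=> [ni|[k [k0 tk]] it].
    apply: contrapT => no; apply: ni => k k0; rewrite ltNge; apply/negP => tk.
    by apply: no; exists k; rewrite subr_ge0.
  by have := it k k0; rewrite ltNge -subr_ge0 tk.
apply: closed_some => k; have [k0|k0] := boolP (0 < k)%N.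
  apply: (closed_iff (B := [set t : 'rV[R]_n | 0 <= t 0 k - 1])) => [t|].
    by split=> // -[].
  apply: closed_nonneg; apply: polyfun_continuous.
  by apply: PolyAdd; [apply: PolyCoord|apply: PolyCst].
by apply: (closed_iff (B := set0)) closed0 => t; split=> // -[].
Qed.

Lemma sheet_collapse e : set_bij (sheet e) (~` codim2_skeleton Z n) (@collapse R n Z).
Proof.
split.
- by move=> x [i [p [<- _ ip]]]; apply/codim2_collapse.
- by move=> x y; rewrite !inE; apply: sheet_inj.
- move=> z nz; have [i [p [ie pz]]] := collapse_surj hZ e z.
  by exists (chart p) => //; apply/sheetP; split=> //; apply/codim2_collapse; rewrite pz.
Qed.

(** In each chart the complement of the image is what the cubes of sign e map there from outside W;
    these parts of the cubes are compact, so it is closed. Injectivity on the sheet keeps it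
    disjoint from the image of W. *)
Lemma collapse_open e (W : set (total_space M)) : open W -> W `<=` sheet e ->
  open (@collapse R n Z @` W).
Proof.
move=> /open_total oW We; apply/open_total => j.
exists (~` [set y | exists i : 'I_(ncells M), msign i = e /\
  exists2 x, ([set collapse_cell i t | t in [set t | cube t /\
     forall p : points (cells i), val p = t -> ~ W (chart p)]]) x & zc (tag (mflag i)) x = zc j y]).
  rewrite openC; apply: closed_some => i.
  have [ie|ie] := eqVneq (msign i) e; last first.
    by apply: (closed_iff (B := set0)) closed0 => y; split=> // -[/eqP]; rewrite (negbTE ie).
  apply: (closed_iff (B := [set y | exists2 x, ([set collapse_cell i t | t in [set t | cube t /\
     forall p : points (cells i), val p = t -> ~ W (chart p)]]) x &
     zc (tag (mflag i)) x = zc j y])) => [y|]; first by split=> // -[].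
  apply: chart_preimage_closed.
    apply: continuous_compact.
      by apply: continuous_subspaceT; apply: collapse_cell_continuous.
    have [U oU UE] := oW i.
    rewrite (_ : mkset _ = @cube R n `&` ~` U).
      by apply: compact_closedI; [exact: cube_compact|rewrite closedC].
    apply/seteqP; split=> t /= [ct h]; split=> //.
      by have [p pE] := mpoint i ct; rewrite -pE => /UE; apply: h.
    by move=> p pE Wp; apply: h; rewrite -pE; apply/UE.
  move=> _ [t [ct _] <-]; apply: fpoint_body; first exact: mflag_good.
  exact: cube_to_simplex_simplex.
move=> y; split=> /=.
  move=> [w Ww wy] [i [ie [x [t [ct tW] <-]]]] e'.
  have [p pt] := mpoint i ct; apply: (tW p pt).
  have gp : collapse (chart p) = collapse w.
    apply: Some_inj; rewrite -collapseE pt -[LHS]/(zc _ (collapse_cell i t)) e' zcE.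
    by rewrite wy.
  have sw := We _ Ww.
  have sp : sheet e (chart p).
    apply/sheetP; split=> //; apply/codim2_collapse; rewrite gp.
    by case: (sheet_collapse e) => + _ _; apply.
  by rewrite (sheet_inj sp sw gp).
move=> no; have [i [p [ie pz]]] := collapse_surj hZ e (chart y).
exists (chart p) => //; apply: contrapT => nW; apply: no; exists i; split=> //.
exists (collapse_cell i (val p)); last by rewrite zcE -pz -collapseE.
exists (val p) => //; split; first exact: mpoint_cube.
by move=> p' /val_inj ->.
Qed.

(** The whole complement of the skeleton is evenly covered: each sign vector gives a global
    sheet. *)
Lemma collapse_covering : exists2 k : nat, (0 < k)%N &
  fold_covering (@collapse R n Z) (~` codim2_skeleton Z n) k.
Proof.
exists #|{: {ffun 'I_n -> bool}}|; first by apply/card_gt0P; exists [ffun=> true].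
move=> z nz; exists (~` codim2_skeleton Z n), (fun k => sheet (enum_val k)); split.
- by split=> //; rewrite openC; apply: codim2_closed.
- move=> i j ij; apply/seteqP; split=> // x [[a [p [<- pe ip]]] /sheetP[pj _]].
  by apply: ij; apply: enum_val_inj; rewrite -pe -pj.
- apply/seteqP; split=> x /=.
    have [i [p <-]] := total_space_ex x; move=> /codim2_collapse ip.
    by exists (enum_rank (msign i)) => //; rewrite enum_rankK; apply/sheetP.
  by move=> [k _ sx]; case: (sheet_collapse (enum_val k)) => + _ _; apply.
- move=> k; split.
  + exact: sheet_open.
  + exact: sheet_collapse.
  + by apply: continuous_subspaceT; apply: collapse_continuous.
  + by move=> W oW WV; apply: collapse_open oW WV.
Qed.

End Collapse.

Section AffineChange.
Variables (R : realType) (n : nat) (f g : 'rV[R]_n -> 'rV[R]_n).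
Hypothesis f_sum : forall m (l : 'I_m -> R) (x : 'I_m -> 'rV[R]_n),
  \sum_i l i = 1 -> f (\sum_i l i *: x i) = \sum_i l i *: f (x i).
Hypotheses (fK : cancel f g) (gK : cancel g f).

Let g_sum m (l : 'I_m -> R) (x : 'I_m -> 'rV[R]_n) :
  \sum_i l i = 1 -> g (\sum_i l i *: x i) = \sum_i l i *: g (x i).
Proof.
move=> l1; rewrite -[RHS]fK f_sum//; congr g.
by apply: eq_bigr => i _; rewrite gK.
Qed.

Let sum_cast (U : nmodType) m m' (e : m = m') (F : 'I_m' -> U) :
  \sum_(i < m) F (cast_ord e i) = \sum_(i < m') F i.
Proof. by case: m' / e F => F; apply: eq_bigr => i _; rewrite cast_ord_id. Qed.

Lemma hull_map (s : seq 'rV[R]_n) x : hull (map f s) x <-> hull s (g x).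
Proof.
have sz := size_map f s.
split=> [[l [l0 l1 ->]]|[l [l0 l1 gx]]].
  exists (fun i => l (cast_ord (esym sz) i)); split=> //.
    by rewrite sum_cast.
  rewrite g_sum// -(sum_cast (esym sz)).
  by apply: eq_bigr => i _; rewrite (nth_map 0) ?fK//=.
exists (fun i => l (cast_ord sz i)); split=> //.
  by rewrite sum_cast.
rewrite -[x]gK gx f_sum// -(sum_cast sz).
by apply: eq_bigr => i _; rewrite (nth_map 0)//= -sz.
Qed.

Lemma pl_on_map m (A : set 'rV[R]_n) (B : set 'rV[R]_n) (h : 'rV[R]_n -> 'rV[R]_m) :
  (forall x, B x <-> A (g x)) -> pl_on A h -> pl_on B (h \o g).
Proof.
move=> BA [S [AS hS]]; exists (map (map f) S); split.
  apply/seteqP; split=> [x /BA|x [_ /mapP[s sS ->] /hull_map h1]].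
    by rewrite AS => -[s sS h1]; exists (map f s); [exact: map_f | exact/hull_map].
  by apply/BA; rewrite AS; exists s.
move=> _ /mapP[s sS ->] x y t /hull_map xs /hull_map ys t01 /=.
rewrite -(hS s sS)//; congr h.
have := @g_sum 2 (fun i => if i == ord0 then t else 1 - t) (fun i => if i == ord0 then x else y).
by rewrite !big_ord_recl !big_ord0 /= !addr0 addrC subrK => /(_ erefl).
Qed.

End AffineChange.

(** * Links of the cubical complex are spheres *)

Section MirrorManifold.
Variables (R : realType) (n : nat) (Z : simple_cell_complex R).
Hypothesis hZ : simple_cell_pseudomanifold n Z.
Local Notation M := (mirror_complex n Z).

Lemma mid_coord_sum (v : {ffun 'I_n -> bool}) m (l : 'I_m -> R) (x : 'I_m -> 'rV[R]_n) :
  \sum_i l i = 1 -> mid_coord v (\sum_i l i *: x i) = \sum_i l i *: mid_coord v (x i).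
Proof.
move=> l1; apply/rowP => k; rewrite !mxE !summxE.
under [RHS]eq_bigr do rewrite !mxE mulrDr mulrCA.
by rewrite big_split /= -mulr_suml l1 mul1r -mulr_sumr; under [in LHS]eq_bigr do rewrite mxE.
Qed.

Lemma hull_midpoints (v : {ffun 'I_n -> bool}) (t : 'rV[R]_n) :
  hull (edge_midpoints R v) t <-> std_face (link_coord v t).
Proof.
have -> : edge_midpoints R v =
    map (mid_coord v) [seq (delta_mx 0 j : 'rV[R]_n) | j <- enum [set: 'I_n]%SET].
  rewrite -map_comp /edge_midpoints; have -> : enum [set: 'I_n]%SET = enum 'I_n.
    by rewrite enum_setT enumT.
  apply: eq_map => j; apply/rowP => k; rewrite !mxE eqxx /=.
  case: (k =P j) => _; last by rewrite mulr0 addr0.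
  by case: (v k); rewrite /= ?expr1 ?expr0 ?mulr1n ?mulr0n; [field | rewrite mul1r mulr1 add0r].
rewrite (hull_map (@mid_coord_sum v) (@mid_coordK R n v) (@link_coordK R n v)).
split=> [/hull_enum[l [l0 l1 _ ->]]|[l0 l1]].
  have e k : (\sum_P l P *: (delta_mx 0 P : 'rV[R]_n)) 0 k = l k.
    rewrite summxE (bigD1 k)//= big1 ?addr0 => [|j jk].
      by rewrite !mxE !eqxx mulr1.
    by rewrite !mxE [k == j]eq_sym (negbTE jk) andbF mulr0.
  split=> [j|]; first by rewrite e.
  by rewrite -l1; apply: eq_bigr => k _; rewrite e.
apply/hull_enum; exists (fun k => link_coord v t 0 k); split=> //.
  by move=> P; rewrite finset.in_setT.
exact: row_sum_delta.
Qed.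

Lemma cube_vertex_inj : injective (@cube_vertex R n).
Proof.
move=> v w /rowP e; apply/ffunP => k; have := e k; rewrite !mxE.
by move=> /eqP; rewrite eqr_nat; case: (v k); case: (w k).
Qed.

Lemma vertex_atP (x : total_space M) (i i0 : 'I_(ncells M)) (v v0 : {ffun 'I_n -> bool}) :
  @vertex_at R M x i0 v0 -> @vertex_at R M x i v <-> v = v0 /\ same_vertex v0 i0 i.
Proof.
move=> [p0 [p0E p0x]]; split=> [[p [pE px]]|[-> ni]].
  have /mchart_eq e : chart p = chart p0 :> total_space M by rewrite p0x.
  have ev : v = v0 by apply: cube_vertex_inj; rewrite -pE -p0E; case: e.
  by split=> //; rewrite /same_vertex -{1}ev -pE -p0E.
have [p pE] := mpoint i (point_body p0 : cube (val p0)).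
exists p; rewrite pE; split=> //; rewrite -p0x; apply/mchart_eq.
by rewrite pE p0E.
Qed.

Lemma mirror_link_sphere (x : total_space M) (i0 : 'I_(ncells M)) (v : {ffun 'I_n -> bool}) :
  @vertex_at R M x i0 v -> link_is_sphere n x.
Proof.
move=> xv; have vP := vertex_atP _ _ xv.
set Y := simple_base (cells (tag (mflag i0))).
have sY : combinatorial_sphere R Y n.
  have := simple_base_sphere (cells (tag (mflag i0))); by rewrite (good_dim (mflag_good i0)).
have [F [F1 F2 F3 F4]] := sphere_link_pl sY (link_base_kcone v i0).
pose T := @kcone R _ (bary Y); pose b := link_base v i0.
pose V := simple_vertices (cells (tag (mflag i0))).
(* The graph of the correspondence between link points and directions of norm 1: a bijection by
   [link_dir_eq] and [link_dir_surj]. *)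
pose rel (y : total_space M) (d : 'rV[R]_#|{: {set V}}|) :=
  exists (i : 'I_(ncells M)) (f : {ffun 'I_n -> {set V}}) l (p : points (cells i)),
  [/\ same_vertex v i0 i, link_flag v i f, std_face l,
      val p = mid_coord v l /\ chart p = y & d = flag_emb f (link_sign v i0 i) l].
have rel_fun y y' d d' : rel y d -> rel y' d' -> d = d' <-> y = y'.
  move=> [i [f [l [p [ni fi sl [pE <-] ->]]]]] [j [g [l' [q [nj gj sl' [qE <-] ->]]]]].
  by rewrite (link_dir_eq hZ ni nj fi gj sl sl') mchart_eq pE qE.
have linkP y : link x y <-> exists d, rel y d.
  split=> [[i [w [p [/vP[-> ni] /hull_midpoints sl ->]]]]|[_ [i [f [l [p [ni fi sl [pE <-] _]]]]]]].
    have [f fi] := link_flag_ex ni.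
    exists (flag_emb f (link_sign v i0 i) (link_coord v (val p))), i, f, (link_coord v (val p)), p.
    by split=> //; rewrite link_coordK.
  exists i, v, p; split=> //; first exact/vP.
  by apply/hull_midpoints; rewrite pE mid_coordK.
have rel_dir y d : rel y d -> tcone T b d /\ norm1 d = 1.
  move=> [i [f [l [p [ni fi [l0 l1] _ ->]]]]]; split; first exact: link_dir_tcone.
  have [gf _ _] := fi.
  by rewrite norm1_signed_emb//; apply: flag_rank_inj (good_flag gf).
pose D y := xget 0 (rel y).
have DE y d : rel y d -> D y = d.
  move=> yd; have yD : rel y (D y) by apply: xgetPex; exists d.
  exact/(rel_fun y y).
exists (F \o D); split.
  split=> [y /linkP[d yd]|y y' /set_mem/linkP[d yd] /set_mem/linkP[d' yd'] /=|u /F3[d [dT d1 dF]]].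
  - by have [dT d1] := rel_dir _ _ yd; rewrite /= (DE _ _ yd); apply: F1.
  - have [dT d1] := rel_dir _ _ yd; have [d'T d'1] := rel_dir _ _ yd'.
    rewrite (DE _ _ yd) (DE _ _ yd') => /F2 e; apply/(rel_fun _ _ _ _ yd yd').
    exact: e.
  have [i [f [l [ni fi l0 de]]]] := link_dir_surj hZ dT.
  have [gf _ _] := fi.
  have sl : std_face l.
    split=> //; rewrite -d1 de norm1_signed_emb//.
    exact: flag_rank_inj (good_flag gf).
  have [p pE] := mpoint (i : 'I_(ncells M)) (mid_cube v sl).
  have yd : rel (chart p) d by exists i, f, l, p.
  by exists (chart p); [apply/linkP; exists d | rewrite /= (DE _ _ yd)].
move=> i w /vP[-> ni]; have [f fi] := link_flag_ex ni; have [gf _ _] := fi.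
exists ((F \o flag_emb f (link_sign v i0 i)) \o link_coord v); split.
  apply: (pl_on_map (@mid_coord_sum v) (@mid_coordK R n v) (@link_coordK R n v) (hull_midpoints v)).
  apply: F4; first exact: flag_rank_inj (good_flag gf).
  by move=> l l0; apply: link_dir_tcone.
move=> p /hull_midpoints sl /=; congr F; apply: DE.
exists i, f, (link_coord v (val p)), p; split=> //.
by rewrite link_coordK.
Qed.

Lemma mirror_manifold : cubic_combinatorial_manifold M n.
Proof.
move=> x [i [F [[a [a0 ->]] e]]].
have [p [pc pa] px] : exists2 p : points (cells i), cube_face_set a (val p) & chart p = x.
  have : [set x] x by [].
  by rewrite e => -[p pF ->]; exists p.
pose v : {ffun 'I_n -> bool} := [ffun k => a k == Some true].
apply: (@mirror_link_sphere x i v); exists p; split=> //.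
apply/rowP => k; rewrite mxE ffunE.
have : a k != None.
  apply/negP => ak; have := card0_eq a0 k; by rewrite inE ak.
case ak : (a k) => [c|] // _; rewrite (pa _ _ ak).
by case: c ak.
Qed.

End MirrorManifold.

(** * Covering dimension *)

Section Lebesgue.
Variable R : realType.

Definition box m (x : 'rV[R]_m) (e : R) : set 'rV[R]_m :=
  [set y | forall k, `|x 0 k - y 0 k| < e].

(** Stated for a property G inherited by subsets rather than for a cover, so as to apply also to
    [small] below. *)
Lemma lebesgue_number m (K : set 'rV[R]_m) (G : set 'rV[R]_m -> Prop) :
  compact K -> (forall U V, U `<=` V -> G V -> G U) ->
  (forall x, K x -> exists2 U, nbhs x U & G U) ->
  exists N : nat, forall x, K x -> G (box x (N.+1%:R^-1)).
Proof.
move=> /compact_near_coveringP cK Gsub KG.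
have := cK nat \oo (fun N x => G (box x (N.+1%:R^-1))) _.
move=> /(_ _)[|N _ hN]; last by exists N; apply: hN => /=.
move=> x Kx; have [U /nbhs_ballP[e /= e0 eU] GU] := KG x Kx.
have e2 : 0 < e / 2 by rewrite divr_gt0.
exists (ball x (e / 2), [set N | N.+1%:R^-1 < e / 2]) => /=.
  by split; [exact: nbhsx_ballx | exact: near_infty_natSinv_lt (PosNum e2)].
move=> [x' N] /= [[_ xx'] Ne]; apply: Gsub GU => y xy; apply: eU; split=> // i j.
rewrite ord1 [e]splitr; apply: ball_triangle (xx' 0 j) _.
by rewrite -ball_normE /ball_ /=; apply: lt_trans Ne.
Qed.

(** Each grid point chooses a member of the cover containing a box around it, and its label is the
    first k for which this member misses the face x_k = 1 (d+1 if there is none). Sperner's lemma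
    gives a small simplex with all d+2 labels; its vertices chose different members, and all of
    these contain a common point. *)
Lemma cube_cover_order d s (W : 'I_s -> set 'rV[R]_d.+1) :
  (forall j, open (W j)) -> (forall x, cube x -> exists j, W j x) ->
  (forall j k x y, cube x -> cube y -> W j x -> W j y -> x 0 k = 0 -> y 0 k = 1 -> False) ->
  exists x, cube x /\ (d.+1 < #|[pred j | `[< W j x >]]|)%N.
Proof.
move=> Wo Wc Wk.
have [N hN] : exists N : nat, forall x, @cube R d.+1 x -> exists j, box x (N.+1%:R^-1) `<=` W j.
  apply: (lebesgue_number (G := fun U => exists j, U `<=` W j)) => [|U V UV [j Vj]|x /Wc[j Wj]].
  - exact: cube_compact.
  - by exists j; apply: subset_trans Vj.
  - by exists (W j); [exact: open_nbhs_nbhs | exists j].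
(* The mesh 1/(N+2) is less than the size 1/(N+1) of the boxes; truncation keeps all integer points
   in the cube. *)
pose c (b : {ffun 'I_d.+1 -> nat}) : 'rV[R]_d.+1 := \row_i ((minn (b i) N.+2)%:R / N.+2%:R).
have cc b : cube (c b).
  by move=> i; rewrite mxE divr_ge0//= ler_pdivrMr// mul1r ler_nat geq_minr.
have [J JP] := choice (fun b => hN _ (cc b)).
pose bad j (k : nat) := `[< forall y, cube y -> W j y -> y 0 (inord k : 'I_d.+1) <> 1 >].
pose lab b := find (bad (J b)) (iota 0 d.+1).
have WJ b : W (J b) (c b).
  by apply: JP => k; rewrite subrr normr0 invr_gt0 ltr0n.
have [||b|sp h] := @sperner d N.+1 lab.
- move=> b i bi; rewrite leqNgt; apply/negP => /(before_find 0%N).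
  rewrite nth_iota// add0n => /asboolP; apply => y cy Wy.
  rewrite inord_val; apply: (Wk (J b) i (c b) y) => //.
  by rewrite mxE bi min0n mul0r.
- move=> b i bi e; have : has (bad (J b)) (iota 0 d.+1).
    by rewrite has_find size_iota -/(lab b) e.
  move=> /(nth_find 0%N); rewrite -/(lab b) e nth_iota// add0n => /asboolP/(_ (c b) (cc b) (WJ b)).
  by rewrite inord_val mxE bi minnn divff.
- by rewrite -[X in (_ <= X)%N](size_iota 0) find_size.
exists (c (kvert sp 0)); split; first exact: cc.
have h' (k : 'I_d.+2) : exists l, (l <= d.+1)%N /\ lab (kvert sp l) = k.
  by have [|l l1 l2] := h k; [rewrite -ltnS | exists l].
have [l lP] := choice h'.
pose g k := J (kvert sp (l k)).
have gI : injective g.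
  move=> k k' e; apply: ord_inj; have [_ <-] := lP k; have [_ <-] := lP k'.
  by rewrite /lab -/(g k) -/(g k') e.
have <- : #|codom g| = d.+2 by rewrite card_codom// card_ord.
apply: subset_leq_card; apply/fintype.subsetP => j /codomP[k ->].
rewrite inE; apply: JP => i; rewrite !mxE -mulrBl normrM.
have N2 : 0 < N.+2%:R :> R by rewrite ltr0n.
rewrite [X in _ * X]ger0_norm ?invr_ge0 1?ltW//.
have b1 (q : 'I_N.+2) (b : bool) : minn (q + b) N.+2 = (q + b)%N.
  by apply/minn_idPl; case: b; rewrite ?addn1 ?addn0 ?ltn_ord// ltnW.
rewrite !ffunE !b1 !natrD opprD addrACA subrr add0r.
apply: (@le_lt_trans _ _ (1 / N.+2%:R)).
  rewrite ler_pM2r ?invr_gt0//.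
  by case: (_ < _)%N; case: (_ < _)%N; rewrite ?subrr ?subr0 ?sub0r ?normrN ?normr1 ?normr0.
by rewrite mul1r ltf_pV2 ?posrE ?ltr0n// ltr_nat.
Qed.

End Lebesgue.

Lemma closed_le_fun (R : realType) (T : topologicalType) (f : T -> R) c :
  continuous f -> closed [set x | f x <= c].
Proof.
by move=> fc; apply: (preimage_closed (f := f) _ (@closed_le _ c)) => y _; apply: fc.
Qed.

Lemma closed_ge_fun (R : realType) (T : topologicalType) (f : T -> R) c :
  continuous f -> closed [set x | c <= f x].
Proof.
by move=> fc; apply: (preimage_closed (f := f) _ (@closed_ge _ c)) => y _; apply: fc.
Qed.

Section MirrorCoordinates.
Variables (R : realType) (n : nat) (Z : simple_cell_complex R).
Local Notation M := (mirror_complex n Z).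

Lemma mcoord_ex (x : total_space M) : exists t : 'rV[R]_n,
  forall (i : 'I_(ncells M)) (p : points (cells i)), chart p = x -> val p = t.
Proof.
have [i [p <-]] := total_space_ex x.
by exists (val p) => j q /mchart_eq[].
Qed.

Definition mcoord (x : total_space M) : 'rV[R]_n := sval (cid (mcoord_ex x)).

Lemma mcoordE (i : 'I_(ncells M)) (p : points (cells i)) : mcoord (chart p) = val p.
Proof. by rewrite /mcoord; case: cid => t /= ->. Qed.

Lemma mcoord_continuous : continuous mcoord.
Proof.
apply/continuousP => A oA; apply/open_total => i; exists A => // p.
by rewrite /preimage /= mcoordE.
Qed.

Lemma mcoordk_continuous k : continuous (fun x => mcoord x 0 k).
Proof.
move=> x; apply: (@continuous_comp _ _ _ mcoord (fun t : 'rV[R]_n => t 0 k)).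
  exact: mcoord_continuous.
exact: coord_cont.
Qed.

End MirrorCoordinates.

(** * The preimage of the skeleton has dimension at least n-1 *)

Section LowerBound.
Variables (R : realType) (d : nat) (Z : simple_cell_complex R).
Hypothesis hZ : simple_cell_pseudomanifold d.+2 Z.
Local Notation M := (mirror_complex d.+2 Z).

Definition facet_point (x : 'rV[R]_d.+1) : 'rV[R]_d.+2 :=
  \row_k (if unlift ord_max k is Some j then x 0 j else 1).

Lemma facet_point_continuous : continuous facet_point.
Proof.
apply: rV_continuous => k; case: (unliftP ord_max k) => [j ->|->].
  rewrite (_ : (fun x => _) = fun x : 'rV[R]_d.+1 => x 0 j); first exact: coord_cont.
  by apply/funext => x; rewrite mxE liftK.
rewrite (_ : (fun x => _) = fun=> 1); first exact: cst_continuous.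
by apply/funext => x; rewrite mxE unlift_none.
Qed.

Lemma facet_point_cube x : cube x -> cube (facet_point x).
Proof.
move=> cx k; rewrite mxE; case: (unliftP ord_max k) => [j _|_]; first exact: cx.
by rewrite ler01 lexx.
Qed.

Lemma facet_codim2 (i : 'I_(ncells M)) (p : points (cells i)) x :
  val p = facet_point x -> codim2_skeleton Z d.+2 (collapse (chart p)).
Proof.
move=> pE; apply: contrapT => /codim2_collapse h.
have := h (ord_max : 'I_d.+2) isT.
by rewrite pE mxE unlift_none ltxx.
Qed.

Lemma preimage_dim_ge : codim2_skeleton Z d.+2 !=set0 ->
  ~ covering_order_le (@collapse R d.+2 Z @^-1` codim2_skeleton Z d.+2) d.+1.
Proof.
move=> [z _] hA; have [a [_ [ga _ _]]] := flag_cover hZ z.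
have [i _] := mirror_ex (finfun (fun=> false)) ga.
pose T : finType := {ffun 'I_d.+1 -> bool}.
pose tk (x : total_space M) (k : 'I_d.+1) := mcoord x 0 (lift ord_max k).
(* No member meets two opposite faces of the (n-1)-cube t_(n-1) = 1, because every coordinate is
   kept above 1/3 or below 2/3; the refinement inherits this. *)
pose U (v : 'I_#|T|) : set (total_space M) := [set x | forall k,
  if (enum_val v : T) k then 3^-1 < tk x k else tk x k < 2 / 3].
have Uo v : open (U v).
  rewrite -closedC; apply: (closed_iff (B := [set x | exists k,
    if (enum_val v : T) k then tk x k <= 3^-1 else 2 / 3 <= tk x k])) => [x|].
    rewrite /setC /U /=; split=> [/existsNP[k hk]|[k hk] /(_ k)]; last first.
      by case: ((enum_val v : T) k) hk => /= h1 h2; lra.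
    exists k; move: hk; case: ((enum_val v : T) k) => /negP; rewrite -leNgt; lra.
  have tc k : continuous (fun x => tk x k) := @mcoordk_continuous R _ Z (lift ord_max k).
  apply: closed_some => k; case: ((enum_val v : T) k).
    exact: closed_le_fun (tc k).
  exact: closed_ge_fun (tc k).
have [|s [W [Wo Wc WU Wle]]] := hA _ U Uo.
  move=> x _; pose v : T := [ffun k => 3^-1 < tk x k].
  exists (enum_rank v) => // k; rewrite enum_rankK ffunE.
  by case: ifP => // /negbT; rewrite -leNgt; lra.
have [V VP] : exists V : 'I_s -> set 'rV[R]_d.+2, forall j, open (V j) /\
    forall p : points (cells (i : 'I_(ncells M))), W j (chart p) <-> V j (val p).
  have h j : exists V : set 'rV[R]_d.+2, open V /\
      forall p : points (cells (i : 'I_(ncells M))), W j (chart p) <-> V (val p).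
    by have /open_total/(_ i)[V Vo VE] := Wo j; exists V.
  by have [V VP] := choice h; exists V.
have pt x : cube x -> exists p : points (cells (i : 'I_(ncells M))), val p = facet_point x.
  by move=> cx; apply: mpoint; apply: facet_point_cube.
have [|x cx|j k x y cx cy|x [cx]] := @cube_cover_order R d s (fun j => facet_point @^-1` V j).
- by move=> j; move/continuousP: facet_point_continuous; apply; case: (VP j).
- have [p pE] := pt x cx; have [j _ Wj] := Wc _ (facet_codim2 pE).
  by exists j; rewrite /preimage /= -pE; apply/(VP j).2.
- have [p pE] := pt x cx; have [q qE] := pt y cy.
  rewrite /preimage /= -pE -qE => /(VP j).2 Wp /(VP j).2 Wq xk yk.
  have [v vU] := WU j.
  have := vU _ (conj Wp (facet_codim2 pE)) k; have := vU _ (conj Wq (facet_codim2 qE)) k.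
  rewrite /tk !mcoordE pE qE !mxE liftK xk yk.
  by case: ((enum_val v : T) k); lra.
have [p pE] := pt x cx.
have := Wle _ (facet_codim2 pE); rewrite ltnNge => h /negP; apply.
apply: leq_trans h; apply: subset_leq_card; apply/fintype.subsetP => j.
by rewrite !inE /preimage /= -pE => h; apply/(VP j).2.
Qed.

End LowerBound.

(** * Coloured pieces of a cube grid *)

Section GridPieces.
Variables (R : realType) (n L : nat).
Implicit Types (S : {set 'I_n}) (z : {ffun 'I_n -> 'I_L.+2}) (t : 'rV[R]_n).

(** Strictly increasing in m and below 1/2 for m at most n, so that intervals of this radius around
    different integers stay disjoint. *)
Definition width (m : nat) : R := m%:R / (2 * n.+1%:R).

Lemma width_lt m m' : (m < m')%N -> width m < width m'.
Proof. by move=> mm; rewrite ltr_pM2r ?ltr_nat// invr_gt0 mulr_gt0// ltr0n. Qed.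

Lemma width_half m : (m <= n)%N -> 2 * width m < 1.
Proof.
move=> mn; have n0 : 0 < n.+1%:R :> R by rewrite ltr0n.
rewrite /width mulrA ltr_pdivrMr ?mulr_gt0// mul1r ltr_pM2l//.
by rewrite ltr_nat.
Qed.

(* The coordinates in [S] are near grid values and the other ones are not; the
   threshold depends on the number of elements of [S], so that the pieces with
   given [#|S|] are disjoint. *)
Definition piece S z : set 'rV[R]_n := [set t | forall k,
  if k \in S then (z k)%:R - width #|S| < L.+1%:R * t 0 k < (z k)%:R + width #|S|
  else (z k)%:R + width #|S| < L.+1%:R * t 0 k < (z k)%:R + 1 - width #|S|].

Lemma card_le S : (#|S| <= n)%N.
Proof. by rewrite -[X in (_ <= X)%N]card_ord max_card. Qed.

Lemma width_ge0 m : 0 <= width m.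
Proof. by rewrite divr_ge0// mulr_ge0. Qed.

Lemma nat_cmp (p q : nat) : [\/ p = q, (p%:R + 1 <= q%:R :> R) | (q%:R + 1 <= p%:R :> R)].
Proof.
case: (ltngtP p q) => [h|h|]; [apply: Or32 | apply: Or33 | exact: Or31];
  by rewrite natr1 ler_nat.
Qed.

Lemma piece_disjoint S S' z z' t : piece S z t -> piece S' z' t -> #|S| = #|S'| ->
  S = S' /\ z = z'.
Proof.
move=> h h' c; have w2 := width_half (card_le S); have w0 := width_ge0 #|S|.
have sub S1 S2 z1 z2 : piece S1 z1 t -> piece S2 z2 t -> #|S1| = #|S| -> #|S2| = #|S| ->
    S1 \subset S2.
  move=> h1 h2 c1 c2; apply/fintype.subsetP => k k1; apply: contraT => k2.
  have := h1 k; have := h2 k; rewrite k1 (negbTE k2) c1 c2 => /andP[q1 q2] /andP[q3 q4]; clear c c1 c2.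
  have [e|?|?] := nat_cmp (z1 k) (z2 k); [|exfalso; lra|exfalso; lra].
  by rewrite -e in q1 q2; clear e; exfalso; lra.
have eS : S = S'.
  apply/eqP; rewrite finset.eqEsubset; apply/andP; split.
    exact: sub h h' _ (esym c).
  exact: sub h' h (esym c) _.
subst S'; clear c; split=> //; apply/ffunP => k; apply: ord_inj.
have := h k; have := h' k; case: ifP => _ /andP[q1 q2] /andP[q3 q4];
  have [//|e|e] := nat_cmp (z k) (z' k); exfalso; lra.
Qed.

Lemma piece_diam S z t t' k : piece S z t -> piece S z t' -> `|t 0 k - t' 0 k| < L.+1%:R^-1.
Proof.
move=> /(_ k) h /(_ k) h'; have w2 := width_half (card_le S); have w0 := width_ge0 #|S|.
have L0 : 0 < L.+1%:R :> R by rewrite ltr0n.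
rewrite -(ltr_pM2l L0) divff ?gt_eqF// -[X in X * _]gtr0_norm// -normrM mulrBr.
by rewrite ltr_norml; move: h h'; case: ifP => _ /andP[q1 q2] /andP[q3 q4]; apply/andP; split; lra.
Qed.

Lemma piece_open S z : open (piece S z).
Proof.
rewrite -closedC.
pose f k (t : 'rV[R]_n) : R := L.+1%:R * t 0 k.
have fc k : continuous (f k).
  have cc : continuous (fun _ : 'rV[R]_n => L.+1%:R : R) by move=> t; exact: cst_continuous.
  have ck := @coord_cont R n k.
  by move=> t; exact: (cvgM (cc t) (ck t)).
pose lo k := if k \in S then (z k)%:R - width #|S| else (z k)%:R + width #|S|.
pose hi k := if k \in S then (z k)%:R + width #|S| else (z k)%:R + 1 - width #|S|.
apply: (closed_iff (B := [set t | exists k, f k t <= lo k \/ hi k <= f k t])) => [t|].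
  rewrite /setC /piece /= /lo /hi /f; split=> [/existsNP[k hk]|[k hk] /(_ k)].
    exists k; move: hk; case: ifP => _ /negP; rewrite negb_and -!leNgt => /orP[]; by [left|right].
  by move: hk; case: ifP => _ hk /andP[q1 q2]; case: hk; lra.
apply: closed_some => k; apply: closedU.
  exact: closed_le_fun.
exact: closed_ge_fun.
Qed.

(** Let m be maximal such that at least m coordinates are within [width m] of the grid. Then exactly
    m are, and the same ones for [width m.+1], so the others are off the grid by more than
    [width m]. A coordinate equal to 1 forces m > 0, which leaves only n colours. *)
Lemma piece_cover t : cube t -> (exists k, t 0 k = 1) ->
  exists S z, (0 < #|S|)%N /\ piece S z t.
Proof.
move=> ct [k1 t1].
pose y k := L.+1%:R * t 0 k.
pose F m : {set 'I_n} := finset (fun k => [exists z : 'I_L.+2, `|y k - z%:R| < width m]).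
have FP m k : reflect (exists z : 'I_L.+2, `|y k - z%:R| < width m) (k \in F m).
  by rewrite finset.in_set; apply: existsP.
have e1 : exists m, (m <= #|F m|)%N.
  exists 1%N; apply/card_gt0P; exists k1; apply/FP; exists ord_max.
  by rewrite /y t1 mulr1 /= subrr normr0 divr_gt0// mulr_gt0// ltr0n.
have bd m : (m <= #|F m|)%N -> (m <= n)%N by move=> h; apply: leq_trans h (card_le _).
case: (ex_maxnP e1 bd) => m mF mmax.
have m0 : (0 < m)%N.
  apply: mmax; apply/card_gt0P; exists k1; apply/FP; exists ord_max.
  by rewrite /y t1 mulr1 /= subrr normr0 divr_gt0// mulr_gt0// ltr0n.
have Fm1 : (#|F m.+1| <= m)%N.
  by rewrite leqNgt; apply/negP => /mmax; rewrite ltnn.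
have sub : F m \subset F m.+1.
  apply/fintype.subsetP => k /FP[z hz]; apply/FP; exists z; apply: lt_trans hz _.
  exact: width_lt.
have eF : F m = F m.+1 by apply/eqP; rewrite eqEcard sub (leq_trans Fm1).
have cF : #|F m| = m by apply/eqP; rewrite eqn_leq mF eF Fm1.
have zP k : exists z : 'I_L.+2,
    if k \in F m then z%:R - width m < y k < z%:R + width m
    else z%:R + width m < y k < z%:R + 1 - width m.
  case: (FP m k) => [[z]|]; first by rewrite ltr_norml => /andP[q1 q2]; exists z; apply/andP; split; lra.
  move=> nF; have nF1 : ~ exists z : 'I_L.+2, `|y k - z%:R| < width m.+1.
    by move/(FP m.+1 k); rewrite -eF => /(FP m k).
  have /andP[t0k t1k] := ct k.
  have y0 : 0 <= y k by rewrite mulr_ge0.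
  have yL : y k <= L.+1%:R by rewrite ger_pMr// ltr0n.
  have /andP[h1 h2] := truncn_itv y0; set q := Num.truncn (y k) in h1 h2.
  have wm := width_lt (ltnSn m); have w0 := width_ge0 m.
  have qL : (q < L.+1)%N.
    rewrite ltnNge; apply/negP => qL; apply: nF1; exists ord_max; rewrite /=.
    have hq : L.+1%:R <= q%:R :> R by rewrite ler_nat.
    by have -> : y k - L.+1%:R = 0; [lra | rewrite normr0; lra].
  have far (q' : nat) : (q' < L.+2)%N -> width m.+1 <= `|y k - q'%:R|.
    by move=> q'L; rewrite leNgt; apply/negP => h; apply: nF1; exists (Ordinal q'L).
  exists (Ordinal (leqW qL)) => /=.
  have f1 := far q (leqW qL); have f2 := far q.+1 qL; clear far nF1 nF.
  rewrite -natr1 in f2 h2; rewrite ger0_norm ?subr_ge0// in f1.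
  rewrite ler0_norm in f2; last by rewrite subr_le0 ltW.
  by apply/andP; split; lra.
have [z hz] := choice zP.
exists (F m), (finfun z); rewrite cF; split=> // k.
by rewrite cF ffunE; apply: hz.
Qed.

End GridPieces.

(** * The preimage of the skeleton has dimension at most n-1 *)

Section UpperBound.
Variables (R : realType) (n : nat) (Z : simple_cell_complex R).
Local Notation M := (mirror_complex n Z).
Implicit Types (b t : 'rV[R]_n) (x : total_space M).

Definition walls : set 'rV[R]_n :=
  [set t | cube t /\ exists k : 'I_n, (0 < k)%N /\ t 0 k = 1].

Lemma walls_compact : compact walls.
Proof.
apply: subclosed_compact (@cube_compact R n) _ => [|t []//].
apply: closedI; first by apply: compact_closed (@cube_compact R n); apply: norm_hausdorff.
apply: closed_some => k; have [k0|k0] := boolP (0 < k)%N; last first.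
  by apply: (closed_iff (B := set0)) closed0 => t; split=> // -[].
apply: (closed_iff (B := [set t : 'rV[R]_n | t 0 k = 1])) => [t|]; first by split=> // -[].
by apply: closed_eqv; apply: coord_cont.
Qed.

Lemma walls_codim2 x : (collapse x \in codim2_skeleton Z n) = (mcoord x \in walls).
Proof.
have [i [p <-]] := total_space_ex x; rewrite mcoordE; apply/idP/idP => /set_mem h; apply/mem_set.
  split; first exact: mpoint_cube.
  apply: contrapT => no; have := h; apply/codim2_collapse => k k0.
  rewrite lt_neqAle; have /andP[_ ->] := mpoint_cube p k; rewrite andbT.
  by apply/eqP => e; apply: no; exists k.
have [_ [k [k0 pk]]] := h; apply: contrapT => /codim2_collapse/(_ k k0).
by rewrite pk ltxx.
Qed.

(* The open star of the face of the cube with [b] in its interior. *)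
Definition ostar b : set 'rV[R]_n :=
  [set t | forall k, (0 < b 0 k -> 0 < t 0 k) /\ (b 0 k < 1 -> t 0 k < 1)].

Lemma ostar_minv b t i j : cube b -> ostar b t -> minv (Z := Z) i t = minv j t -> minv i b = minv j b.
Proof.
move=> cb bt; apply: minv_mono => [k|k _ tk].
  case: (unliftP ord0 k) => [l ->|->]; first by rewrite !face_vertsS => /(bt l).1.
  rewrite !face_verts0 => /forallP h; apply/forallP => l; apply/implyP => l0.
  by have := h l; rewrite l0 /= => /(bt l).2.
apply/eqP; apply: contraT => bk; have := (bt k).2; rewrite tk ltxx => -> //.
by rewrite lt_neqAle bk; case/andP: (cb k).
Qed.

Lemma ostar_nbhs b : nbhs b (ostar b).
Proof.
apply: open_nbhs_nbhs; split; last by move=> k.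
rewrite -closedC; apply: (closed_iff (B := [set t : 'rV[R]_n | exists k,
  (0 < b 0 k /\ t 0 k <= 0) \/ (b 0 k < 1 /\ 1 <= t 0 k)])) => [t|].
  rewrite /setC /ostar /=; split=> [/existsNP[k]|[k h] /(_ k)[h1 h2]].
    by move=> /not_andP[] /not_implyP[h1 /negP]; rewrite -leNgt => h2; exists k; [left|right].
  case: h => -[h3]; [have := h1 h3|have := h2 h3]; by rewrite ltNge => /negP.
apply: closed_some => k; apply: closedU.
  have [h|h] := pselect (0 < b 0 k).
    apply: (closed_iff (B := [set t : 'rV[R]_n | t 0 k <= 0])) => [t|]; first by split=> // -[].
    exact: (@closed_le_fun R _ (fun t : 'rV[R]_n => t 0 k) 0 (@coord_cont R n k)).
  by apply: (closed_iff (B := set0)) closed0 => t; split=> // -[].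
have [h|h] := pselect (b 0 k < 1).
  apply: (closed_iff (B := [set t : 'rV[R]_n | 1 <= t 0 k])) => [t|]; first by split=> // -[].
  exact: (@closed_ge_fun R _ (fun t : 'rV[R]_n => t 0 k) 1 (@coord_cont R n k)).
by apply: (closed_iff (B := set0)) closed0 => t; split=> // -[].
Qed.

Section Cover.
Variables (r : nat) (U : 'I_r -> set (total_space M)).
Hypothesis Uo : forall u, open (U u).
Hypothesis Uc : @collapse R n Z @^-1` codim2_skeleton Z n `<=` \bigcup_u U u.

(** The copies of V in all cubes glued together at b form one set, contained in one member of the
    given cover; inside the open star of b, cubes not glued at b are not glued at all. *)
Definition small (V : set 'rV[R]_n) := exists b, [/\ cube b, V `<=` ostar b &
  forall i : 'I_(ncells M), exists u, forall (j : 'I_(ncells M)) (p : points (cells j)),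
    minv (Z := Z) j b = minv i b -> V (val p) -> U u (chart p)].

Lemma small_sub V V' : V `<=` V' -> small V' -> small V.
Proof.
move=> VV [b [cb Vb h]]; exists b; split=> //; first exact: subset_trans Vb.
by move=> i; have [u hu] := h i; exists u => j p e /VV; apply: hu.
Qed.

Lemma small_walls b : walls b -> exists2 V, nbhs b V & small V.
Proof.
move=> bw; have [cb _] := bw.
have hi (i : 'I_(ncells M)) : exists u, U u (chart (sval (cid (mpoint i cb)))).
  case: cid => p /= pb.
  have pA : codim2_skeleton Z n (collapse (chart p)).
    by apply/set_mem; rewrite walls_codim2 mcoordE; have -> : val p = b := pb; apply/mem_set.
  by have [u _ Uu] := Uc pA; exists u.
have [c cP] := choice hi.
have hV (i j : 'I_(ncells M)) : exists V, nbhs b V /\ forall p : points (cells j),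
    minv (Z := Z) j b = minv i b -> V (val p) -> U (c i) (chart p).
  have [e|ne] := pselect (minv (Z := Z) j b = minv i b); last by exists setT; split; [exact: filterT|].
  have /open_total/(_ j)[V Vo VE] := @Uo (c i).
  exists V; split=> [|p _ /VE//]; apply: open_nbhs_nbhs; split=> //.
  have [q qb] := mpoint j cb; rewrite -qb; apply/VE.
  have -> : chart q = chart (sval (cid (mpoint i cb))) :> total_space M; last exact: cP.
  by apply/mchart_eq; case: cid => p /= ->; rewrite qb.
have [V VP] := choice (fun ij : 'I_(ncells M) * 'I_(ncells M) => hV ij.1 ij.2).
exists (ostar b `&` [set t | forall ij, V ij t]).
  apply: filterI; first exact: ostar_nbhs.
  exact: (@filter_forall _ _ _ (nbhs b) (nbhs_filter b) (fun ij => (VP ij).1)).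
exists b; split; [exact: cb | by move=> t [] | move=> i; exists (c i) => j p e [_ /(_ (i, j))]].
by have [_ h] := VP (i, j); apply: h.
Qed.

Lemma preimage_refine : (exists x, codim2_skeleton Z n (collapse x)) ->
  exists s (W : 'I_s -> set (total_space M)),
  [/\ forall j, open (W j),
      @collapse R n Z @^-1` codim2_skeleton Z n `<=` \bigcup_j W j,
      forall j, exists i, W j `&` (@collapse R n Z @^-1` codim2_skeleton Z n) `<=` U i &
      forall x, (#|[pred j | `[< W j x >]]| <= n)%N].
Proof.
move=> [x0 x0A]; have [u0 _ _] := Uc x0A.
have [L hL] := lebesgue_number walls_compact small_sub small_walls.
pose T : finType := ({set 'I_n} * {ffun 'I_n -> 'I_L.+2} * 'I_(mirror_num n Z))%type.
pose P (w : {set 'I_n} * {ffun 'I_n -> 'I_L.+2}) := @piece R n L w.1 w.2.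
pose act (w : {set 'I_n} * {ffun 'I_n -> 'I_L.+2}) := (0 < #|w.1|)%N /\ exists b, walls b /\ P w b.
have ctr w : exists b, act w -> [/\ cube b, P w `<=` ostar b &
    forall i : 'I_(ncells M), exists u, forall (j : 'I_(ncells M)) (p : points (cells j)),
      minv (Z := Z) j b = minv i b -> P w (val p) -> U u (chart p)].
  have [[w0 [b [bw Pb]]]|na] := pselect (act w); last by exists 0.
  have [|b' hb'] := @small_sub (P w) _ _ (hL b bw); last by exists b'.
  by move=> t Pt k; apply: piece_diam Pt.
have [bc bcP] := choice ctr.
(* The least index represents a class of cubes glued at the center of the piece, so that each class
   yields one member of the refinement. *)
pose canon w i := forall i', minv (Z := Z) i' (bc w) = minv i (bc w) -> (i <= i')%N.
pose W (q : T) : set (total_space M) := [set x | [/\ act q.1, canon q.1 q.2 &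
  exists (j : 'I_(ncells M)) (p : points (cells j)),
    [/\ chart p = x, P q.1 (val p) & minv (Z := Z) j (bc q.1) = minv q.2 (bc q.1)]]].
have WE q (j : 'I_(ncells M)) (p : points (cells j)) : W q (chart p) <->
    [/\ act q.1, canon q.1 q.2, P q.1 (val p) &
      minv (Z := Z) j (bc q.1) = minv q.2 (bc q.1)].
  split=> [[aq cq [j' [p' [/mchart_eq e Pp' ej]]]]|[aq cq Pp ej]]; last by split=> //; exists j, p.
  have [cb Pb _] := bcP _ aq; have et : val p' = val p by case: e.
  have bj := ostar_minv cb (Pb _ Pp').
  split=> //; first by rewrite -et.
  by rewrite -ej; apply/esym/bj; rewrite e et.
exists #|T|, (fun q => W (enum_val q)); split=> [q|x xA|q|x].
- apply/open_total => j; set w := enum_val q.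
  have [h|h] := pselect ([/\ act w.1, canon w.1 w.2 & minv (Z := Z) j (bc w.1) = minv w.2 (bc w.1)]).
    exists (P w.1); first exact: piece_open.
    by have [h1 h2 h3] := h; move=> p; split=> [/WE[]//|Pp]; apply/WE.
  exists set0; first exact: open0.
  by move=> p; split=> // /WE[h1 h2 h3 h4]; apply: h.
- have [j [p px]] := total_space_ex x.
  have pw : walls (val p) by apply/set_mem; rewrite -mcoordE px -walls_codim2; apply/mem_set.
  have [S [z [S0 Pz]]] : exists (S : {set 'I_n}) (z : {ffun 'I_n -> 'I_L.+2}), (0 < #|S|)%N /\ @piece R n L S z (val p).
    have [cp [k [_ pk]]] := pw; apply: piece_cover => //; by exists k.
  pose w := (S, z); have aw : act w by split=> //; exists (val p).
  have [i ij imin] := @arg_minnP _ (j : 'I_(mirror_num n Z))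
    (fun i => `[< minv (Z := Z) i (bc w) = minv j (bc w) >]) (@nat_of_ord _)
    (asboolT erefl).
  exists (enum_rank (w, i) : 'I_#|T|) => //; rewrite -px enum_rankK; apply/WE; split=> //=.
    by move=> i' e; apply: imin; apply/asboolP; rewrite e; apply/asboolP.
  by apply/esym/asboolP.
- set w := enum_val q; have [aq|nq] := pselect (act w.1); last first.
    by exists u0 => x [[] ].
  have [cb _ /(_ w.2)[u hu]] := bcP _ aq; exists u => x [+ _].
  have [j [p <-]] := total_space_ex x => /WE[_ _ Pp e].
  exact: hu e Pp.
(* The number of coordinates near the grid is the colour. A point is in at most one member of each
   colour, and the colour 0 does not occur. *)
pose f (q : 'I_#|T|) : 'I_n.+1 := inord #|(enum_val q).1.1|.
have fE q : f q = #|(enum_val q).1.1| :> nat by rewrite inordK// ltnS card_le.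
have [j [p px]] := total_space_ex x.
have inj : {in [pred q | `[< W (enum_val q) x >]] &, injective f}.
  move=> q q'; rewrite !inE -px => /WE[aq cq Pq eq] /WE[aq' cq' Pq' eq'].
  move=> /(congr1 val); rewrite /= !fE => e.
  have [e1 e2] := piece_disjoint Pq Pq' e.
  have ew : (enum_val q).1 = (enum_val q').1 by rewrite [LHS]surjective_pairing e1 e2 -surjective_pairing.
  apply: enum_val_inj; rewrite [LHS]surjective_pairing [RHS]surjective_pairing ew; congr (_, _).
  have em : minv (Z := Z) (enum_val q).2 (bc (enum_val q).1) = minv (enum_val q').2 (bc (enum_val q).1).
    by rewrite -eq ew.
  apply/ord_inj/eqP; rewrite eqn_leq; apply/andP; split.
    exact: cq.
  by apply: cq'; rewrite -ew.
rewrite -(card_in_imset inj).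
apply: (@leq_trans #|[set~ (ord0 : 'I_n.+1)]%SET|); last by rewrite cardsC1 card_ord.
apply: subset_leq_card; apply/fintype.subsetP => k /imsetP[q].
rewrite inE -px => /WE[[q0 _] _ _ _] ->; rewrite !inE -val_eqE /= fE.
by rewrite -lt0n.
Qed.

End Cover.

Lemma preimage_dim_le :
  covering_order_le (@collapse R n Z @^-1` codim2_skeleton Z n) n.
Proof.
move=> r U Uo Uc.
have [h|h] := pselect (exists x : total_space M, codim2_skeleton Z n (collapse x)).
  have [s [W [Wo Wc WU Wle]]] := preimage_refine Uo Uc h.
  by exists s, W; split.
exists 0%N, (fun _ => set0); split=> [[]//|x xA|[]//|x xA]; by case: h; exists x.
Qed.

End UpperBound.

Lemma preimage_dim (R : realType) (n : nat) (Z : simple_cell_complex R) :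
  simple_cell_pseudomanifold n Z -> codim2_skeleton Z n !=set0 ->
  covering_dim (@collapse R n Z @^-1` codim2_skeleton Z n) n.-1.
Proof.
move=> hZ Z0; have [m mn] : exists m, n = m.+2.
  by have [z [d [c [dn _ _]]]] := Z0; exists n.-2; lia.
subst n; split; first exact: preimage_dim_le.
exact: preimage_dim_ge.
Qed.

Theorem mainTheorem7 (R : realType) (n : nat) (Z : simple_cell_complex R)
    (mu : chain R (total_space Z) n)
    (hZ : simple_cell_pseudomanifold n Z) (hmu : orientation mu) :
  exists (M : cubic_cell_complex R) (g : total_space M -> total_space Z),
    [/\ cubic_combinatorial_manifold M n,
        piecewise_smooth g,
        exists2 k : nat, (0 < k)%N &
          fold_covering g (~` codim2_skeleton Z n) k &
        codim2_skeleton Z n !=set0 ->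
          covering_dim (g @^-1` codim2_skeleton Z n) n.-1].
Proof.
exists (mirror_complex n Z), (@collapse R n Z); split.
- exact: mirror_manifold.
- exact: collapse_piecewise_smooth.
- exact: collapse_covering.
- exact: preimage_dim.
Qed.
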